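(* Let $\ell>0$, $a>0$ and $b\in\mathbb{R}\setminus\{0\}$. The spectrum of $\mathcal{T}_{a,b}$ consists of a sequence $(\lambda_k)_{k\ge1}$ of eigenvalues. Moreover, (i) there exists an integer $m\ge1$ such that all the eigenvalues have algebraic multiplicity smaller than or equal to $m$; (ii) there exists $\gamma_1>0$ such that $\mathrm{Im}(\lambda_k)\le-\gamma_1$ for all $k\ge1$; (iii) there exists a Riesz basis of $\mathscr{S}=L^2(0,\ell;\mathbb{C}^2)$ which consists of generalized eigenfunctions of $\mathcal{T}_{a,b}$.
   Context: On $\mathscr{S}=L^2(0,\ell;\mathbb{C}^2)$ the operator $\mathcal{T}_{a,b}$ acts as $U\mapsto -U''$ (componentwise) on the domain $$\mathrm{Dom}(\mathcal{T}_{a,b})=\{U\in H^2(0,\ell;\mathbb{C}^2): U'(0)+iM_{a,b}U(0)=0,\ U'(\ell)=0\},\qquad M_{a,b}=\begin{pmatrix}a&b\\-b&0\end{pmatrix}.$$ A generalized eigenfunction is a nonzero vector of $\ker((\mathcal{T}_{a,b}-\lambda)^n)$ for some eigenvalue $\lambda$ and some integer $n\ge1$; the algebraic multiplicity of $\lambda$ is $\dim\bigcup_n\ker((\mathcal{T}_{a,b}-\lambda)^n)$. A family $(\Psi_k)_{k\ge1}$ in $\mathscr{S}$ is a Riesz basis if the map $\ell^2(\mathbb{N}^* )\to\mathscr{S}$, $(u_k)\mapsto\sum_{k\ge1}u_k\Psi_k$, is well defined, bounded, bijective and boundedly invertible. *)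

(* Defs.v *)
From HB Require Import structures.
From mathcomp Require Import all_boot all_order all_algebra.
From mathcomp Require Import complex.
From mathcomp Require Import all_classical all_reals all_analysis.

Set Implicit Arguments.
Unset Strict Implicit.
Unset Printing Implicit Defensive.
Import Order.TTheory GRing.Theory Num.Theory.
Import numFieldNormedType.Exports.
Local Open Scope classical_set_scope.
Local Open Scope ring_scope.

(* Elements of L^2(0, l; C^2) are handled through representatives
   U : R -> 'cV[R[i]]_2, whose values outside ]0, l[ are irrelevant; [eqL2] is
   equality of classes. *)
Section L2.
Variables (R : realType) (l : R).
Local Notation mu := (@lebesgue_measure R).
Local Notation vfun := (R -> 'cV[R[i]]_2).

Definition itv0l : set R := `]0, l[.

Definition re_coord (U : vfun) (j : 'I_2) (x : R) : R := complex.Re (U x j 0).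
Definition im_coord (U : vfun) (j : 'I_2) (x : R) : R := complex.Im (U x j 0).

Definition square_integrable (f : R -> R) : Prop :=
  measurable_fun itv0l f /\ mu.-integrable itv0l (fun x => (f x ^+ 2)%:E).

Definition inL2 (U : vfun) : Prop :=
  forall j, square_integrable (re_coord U j) /\
            square_integrable (im_coord U j).

Definition eqL2 (U V : vfun) : Prop := U = V %[ae mu in itv0l].

Definition normL2 (U : vfun) : R :=
  Num.sqrt (\int[mu]_(x in itv0l) (\sum_(j < 2) Normc.normc (U x j 0) ^+ 2)).

(* C^1 functions with compact support in ]0, l[ *)
Definition test_function (phi : R -> R) : Prop :=
  [/\ forall x, derivable phi x 1, continuous (derive1 phi) &
      exists2 K : set R, compact K &
        K `<=` itv0l /\ forall x, ~ K x -> phi x = 0].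

Definition weak_derivative_real (f g : R -> R) : Prop :=
  forall phi, test_function phi ->
    \int[mu]_(x in itv0l) (f x * derive1 phi x) =
    - \int[mu]_(x in itv0l) (g x * phi x).

Definition weak_derivative (U V : vfun) : Prop :=
  forall j, weak_derivative_real (re_coord U j) (re_coord V j) /\
            weak_derivative_real (im_coord U j) (im_coord V j).

(* U is in H^2(0, l; C^2) with U' = U1 and U'' = U2 *)
Definition inH2 (U U1 U2 : vfun) : Prop :=
  [/\ inL2 U, inL2 U1, inL2 U2, weak_derivative U U1 & weak_derivative U1 U2].

(* The representative of U that is continuous on [0, l] takes the value v at x;
   this is the meaning of pointwise values of H^1 functions. *)
Definition trace_at (U : vfun) (x : R) (v : 'cV[R[i]]_2) : Prop :=
  exists Uc : vfun,
    [/\ forall j, {within `[0, l], continuous (re_coord Uc j)} /\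
                  {within `[0, l], continuous (im_coord Uc j)},
        eqL2 Uc U & Uc x = v].

(* Unbounded operators on L^2 are given by their graph: [A U F] means that
   U is in Dom(A) and that A U = F. *)
Local Notation operator := (vfun -> vfun -> Prop).

(* the graph of A - z *)
Definition shift_op (A : operator) (z : R[i]) : operator :=
  fun U F => A U (fun x => F x + z *: U x).

(* the kernel of A ^ n, where Dom(A^(n+1)) is the set of U in Dom(A) such that
   A U is in Dom(A^n) *)
Fixpoint ker_pow (A : operator) (n : nat) (U : vfun) : Prop :=
  if n is n'.+1 then exists2 V, A U V & ker_pow A n' V
  else inL2 U /\ eqL2 U (fun=> 0).

Definition resolvent_set (A : operator) : set R[i] :=
  [set z | [/\ forall U, shift_op A z U (fun=> 0) -> eqL2 U (fun=> 0),
               forall F, inL2 F -> exists U, shift_op A z U F &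
               exists c : R, forall U F, shift_op A z U F ->
                 normL2 U <= c * normL2 F]].

Definition spectrum (A : operator) : set R[i] := ~` resolvent_set A.

Definition op_eigenvalue (A : operator) (z : R[i]) : Prop :=
  exists2 U, shift_op A z U (fun=> 0) & ~ eqL2 U (fun=> 0).

Definition gen_eigenspace (A : operator) (z : R[i]) (U : vfun) : Prop :=
  exists2 n, (0 < n)%N & ker_pow (shift_op A z) n U.

Definition gen_eigenfunction (A : operator) (U : vfun) : Prop :=
  ~ eqL2 U (fun=> 0) /\ exists2 z, op_eigenvalue A z & gen_eigenspace A z U.

Definition lin_indep (n : nat) (U : 'I_n -> vfun) : Prop :=
  forall c : 'I_n -> R[i],
    eqL2 (fun x => \sum_(i < n) c i *: U i x) (fun=> 0) -> forall i, c i = 0.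

(* complex dimension, in N or +oo, of a subspace of L^2 *)
Definition dimL2 (E : vfun -> Prop) : \bar R :=
  ereal_sup [set (n%:R)%:E | n in [set n : nat |
    exists U : 'I_n -> vfun, (forall i, E (U i)) /\ lin_indep U]].

Definition algebraic_multiplicity (A : operator) (z : R[i]) : \bar R :=
  dimL2 (gen_eigenspace A z).

Definition ell2 (u : nat -> R[i]) : Prop :=
  cvgn (series (fun k => Normc.normc (u k) ^+ 2)).

Definition norm_ell2 (u : nat -> R[i]) : R :=
  Num.sqrt (limn (series (fun k => Normc.normc (u k) ^+ 2))).

(* U is the sum in L^2 of the series of general term u_k Psi_k *)
Definition is_sumL2 (Psi : nat -> vfun) (u : nat -> R[i]) (U : vfun) : Prop :=
  inL2 U /\
  normL2 (fun x => U x - \sum_(k < n) u k *: Psi k x) @[n --> \oo] --> (0 : R).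

(* The map u |-> sum of u_k Psi_k from ell2 to L^2 is well defined, bounded,
   bijective and has a bounded inverse. *)
Definition riesz_basis (Psi : nat -> vfun) : Prop :=
  [/\ forall k, inL2 (Psi k),
      forall u, ell2 u -> exists U, is_sumL2 Psi u U,
      exists c : R, forall u U, ell2 u -> is_sumL2 Psi u U ->
        normL2 U <= c * norm_ell2 u,
      (forall u U v V, ell2 u -> ell2 v ->
         is_sumL2 Psi u U -> is_sumL2 Psi v V -> eqL2 U V -> u = v) /\
      (forall U, inL2 U -> exists2 u, ell2 u & is_sumL2 Psi u U) &
      exists c : R, forall u U, ell2 u -> is_sumL2 Psi u U ->
        norm_ell2 u <= c * normL2 U].

Variables a b : R.

Definition Mab : 'M[R[i]]_2 :=
  \matrix_(j, k)
    (nth 0 (nth [::] [:: [:: a; b]; [:: - b; 0]] j) k)%:C%C.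

Definition Tab : operator := fun U F =>
  inL2 F /\
  exists U1 U2 : vfun,
    [/\ inH2 U U1 U2,
        exists u0 v0, [/\ trace_at U 0 u0, trace_at U1 0 v0 &
          v0 + 'i%C *: (Mab *m u0) = 0],
        trace_at U1 l 0 &
        eqL2 F (fun x => - U2 x)].

End L2.

(* Main.v *)
Require Import Defs.
From HB Require Import structures.
From mathcomp Require Import all_boot all_order all_algebra.
From mathcomp Require Import complex.
From mathcomp Require Import all_classical all_reals all_analysis.
From mathcomp Require Import measurable_realfun.
From mathcomp Require Import ring lra.

Set Implicit Arguments.
Unset Strict Implicit.
Unset Printing Implicit Defensive.
Import Order.TTheory GRing.Theory Num.Theory.
Import numFieldNormedType.Exports.
Local Open Scope classical_set_scope.
Local Open Scope ring_scope.

(** The equation [T U = F] integrates to [U = R F] with the explicit bounded operator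
    [R F = i M^-1 \int_0^l F + K F], [K F (x) = \int_0^x \int_s^l F], so everything is read off [R].
    In the orthonormal basis of Neumann cosines, with [lam_n = (n pi / l)^2], and in a Jordan
    basis of [M] (whose eigenvalues have positive real part), [R] acts on two copies of [ell^2],
    coupled at most through their 0-th coordinates.  On each copy it is diagonal with entries
    [1 / lam_n], up to the coupling of every mode with the 0-th one, and its eigenvalue equation
    for [z = lam_k + d] reads [d = 2 / (tau - E_k (d))] with [Im tau > 0] and [E_k = O(1/k)].
    For large [k] a contraction gives a root [d] with [Im d <= - g < 0], and normalised
    (generalized) eigenvectors that are [O(1/k)]-close to the basis vectors.

    Since [R] has dense range, the finitely many remaining basis vectors can be replaced by nearby
    vectors of the range; the resulting family is quadratically close to an orthonormal basis, and
    the associated automorphism conjugates [R] to an operator that is lower triangular beyond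
    some index [N], with the eigenvectors at [n >= N] as basis vectors.  Then [N] is lowered one unit
    at a time: an eigenvector of the finite quotient matrix is corrected to a generalized
    eigenvector of [R], because [(R - nu) g = h] can be solved modulo generalized eigenvectors
    on each tail space, and it replaces one basis vector.  At [N = 0] the family is a Riesz basis
    of generalized eigenvectors in which [R] is triangular, whence the spectrum and the bound on
    multiplicities.  Finally [Im <R F, F>] is a nonnegative multiple of [|F_0|^2] on each copy, and
    an eigenvector has a nonzero 0-th coordinate, so every eigenvalue has negative imaginary part. *)

(** * Square integrable functions and primitives *)

(** The cosines satisfy the Neumann condition at both ends, whereas the condition at 0 mixes value
    and derivative: this is why [R] is not diagonal in their basis and links every mode with mode 0.
    Eliminating the other modes from row 0 gives the eigenvalue equation. The gaps lam_k - lam_n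
    grow like k, so near lam_k the other modes matter less and less while the term 2 / d of mode k
    persists: the shift d tends to 2 / tau and not to 0, which keeps the imaginary parts away from
    0.

    Two obstacles shape the rest. When a = 2 |b| the matrix M is a Jordan block, so even the high
    modes need generalized eigenvectors; differentiating the explicit eigenvector in d supplies
    them, with the same bounds. And the finitely many low eigenvalues may be multiple or coincide
    with high ones, so no explicit vector is available there. A triangular form whose basis vectors
    are generalized eigenvectors can be extended one index at a time, and it still determines the
    spectrum and bounds the multiplicities. *)

Section RealL2.
Variables (R : realType) (l : R).
Local Notation mu := (@lebesgue_measure R).
Local Notation D := (itv0l l).

Implicit Types f g h : R -> R.

Definition intg (f : R -> R) : R := \int[mu]_(x in D) f x.
Definition intgble (f : R -> R) : Prop := mu.-integrable D (EFin \o f).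
Definition sqi (f : R -> R) : Prop := square_integrable l f.
Definition ip (f g : R -> R) : R := intg (fun x => f x * g x).

Lemma aeS (P Q : R -> Prop) : (forall x, P x -> Q x) ->
  (\forall x \ae mu, P x) -> \forall x \ae mu, Q x.
Proof.
move=> PQ; exact: (@filterS _ _ (@ae_filter_ringOfSetsType _ (measurableTypeR R) R mu)).
Qed.

Lemma mD : measurable (D : set (measurableTypeR R)).
Proof. exact: measurable_itv. Qed.

Lemma muD_fin : (mu D < +oo)%E.
Proof. by rewrite /itv0l lebesgue_measure_itv; case: ifP => //= _; rewrite ltry. Qed.

Lemma intgble_cst (c : R) : intgble (fun=> c).
Proof.
apply/integrableP; split; first exact: measurable_cst.
rewrite /comp /= integral_cst //; last exact: mD.
by rewrite lte_mul_pinfty // muD_fin.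
Qed.

Lemma intgble_le (f g : R -> R) : measurable_fun D f ->
  (forall x, D x -> `|f x| <= g x) -> intgble g -> intgble f.
Proof.
move=> mf fg ig; apply: (le_integrable mD _ _ ig); first exact/measurable_EFinP.
move=> x Dx; rewrite /comp /= lee_fin (le_trans (fg _ Dx)) // ler_norm //.
Qed.

Lemma intgble_meas f : intgble f -> measurable_fun D f.
Proof. by move=> /measurable_int /measurable_EFinP. Qed.

Lemma intgbleD f g : intgble f -> intgble g -> intgble (fun x => f x + g x).
Proof. by move=> hf hg; exact: (integrableD mD hf hg). Qed.

Lemma intgbleZ c f : intgble f -> intgble (fun x => c * f x).
Proof. by move=> hf; exact: (integrableZl mD c hf). Qed.

Lemma intgble_norm f : intgble f -> intgble (fun x => `|f x|).
Proof. by move=> hf; exact: (integrable_abse hf). Qed.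

Lemma intgD f g : intgble f -> intgble g ->
  intg (fun x => f x + g x) = intg f + intg g.
Proof. exact: RintegralD mD. Qed.

Lemma intgB f g : intgble f -> intgble g ->
  intg (fun x => f x - g x) = intg f - intg g.
Proof. exact: RintegralB mD. Qed.

Lemma intgZ c f : intgble f -> intg (fun x => c * f x) = c * intg f.
Proof. exact: RintegralZl mD. Qed.

Lemma intgN f : intgble f -> intg (fun x => - f x) = - intg f.
Proof.
move=> hf; rewrite -mulN1r -(intgZ _ hf).
by congr intg; apply/funext => x; rewrite mulN1r.
Qed.

Lemma intg_cst c : 0 < l -> intg (fun=> c) = c * l.
Proof.
move=> l0; rewrite /intg Rintegral_cst; last exact: mD.
have h : (mu D = l%:E)%E.
  transitivity (mu [set` `]0, l[]) => //.
  by rewrite lebesgue_measure_itv /= lte_fin l0 /= oppr0 adde0.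
by transitivity (c * fine l%:E) => //; congr (c * fine _); exact: h.
Qed.

Lemma eq_intg f g : (forall x, D x -> f x = g x) -> intg f = intg g.
Proof. by move=> fg; apply: eq_Rintegral => x; rewrite inE => /fg. Qed.

Lemma ae_eq_intg f g : measurable_fun D f -> measurable_fun D g ->
  f = g %[ae mu in D] -> intg f = intg g.
Proof.
move=> mf mg fg; rewrite /intg /Rintegral; congr fine.
apply: ae_eq_integral => //; [exact: mD|exact/measurable_EFinP|exact/measurable_EFinP|].
by apply: aeS fg => x /= h /h ->.
Qed.

Lemma intg_ge0 f : (forall x, D x -> 0 <= f x) -> 0 <= intg f.
Proof. by move=> h; apply: Rintegral_ge0. Qed.

Lemma intg_sum (n : nat) (F : nat -> R -> R) : (forall i, intgble (F i)) ->
  intgble (fun x => \sum_(i < n) F i x) /\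
  intg (fun x => \sum_(i < n) F i x) = \sum_(i < n) intg (F i).
Proof.
move=> hF; elim: n => [|n [IH1 IH2]].
  have -> : (fun x => \sum_(i < 0) F i x) = (fun=> 0).
    by apply/funext => x; rewrite big_ord0.
  split; first exact: intgble_cst.
  by rewrite big_ord0 /intg Rintegral_cst ?mul0r //; exact: mD.
have -> : (fun x => \sum_(i < n.+1) F i x) = (fun x => \sum_(i < n) F i x + F n x).
  by apply/funext => x; rewrite big_ord_recr.
by split; [exact: intgbleD|rewrite intgD // IH2 big_ord_recr].
Qed.

Lemma sqi_meas f : sqi f -> measurable_fun D f.
Proof. by case. Qed.

Lemma sqi_mul f g : sqi f -> sqi g -> intgble (fun x => f x * g x).
Proof.
move=> [mf hf] [mg hg]; apply: (@intgble_le _ (fun x => f x ^+ 2 + g x ^+ 2)).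
- exact: measurable_funM.
- move=> x _; rewrite normrM; set u := `|_|; set v := `|_|.
  rewrite -[f x ^+ 2]real_normK ?num_real // -[g x ^+ 2]real_normK ?num_real // -/u -/v.
  have := sqr_ge0 (u - v); have := sqr_ge0 u; have := sqr_ge0 v; nra.
- exact: (integrableD mD hf hg).
Qed.

Lemma sqi_bnd f M : measurable_fun D f -> (forall x, D x -> `|f x| <= M) -> sqi f.
Proof.
move=> mf hM; split=> //.
apply: (@intgble_le (fun x => f x ^+ 2) (fun=> M ^+ 2)); last exact: intgble_cst.
  by apply: measurable_funX.
move=> x /hM h; rewrite normrX ler_sqr ?nnegrE //; exact: (le_trans _ h).
Qed.

Lemma sqi_cst c : sqi (fun=> c).
Proof. by apply: (@sqi_bnd _ `|c|) => //; exact: measurable_cst. Qed.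

Lemma sqi_intgble f : sqi f -> intgble f.
Proof.
move=> hf; have := sqi_mul hf (sqi_cst 1).
by congr intgble; apply/funext => x; rewrite mulr1.
Qed.

Lemma sqiD f g : sqi f -> sqi g -> sqi (fun x => f x + g x).
Proof.
move=> hf hg; split; first by apply: measurable_funD; exact: sqi_meas.
have h := intgbleD (intgbleD (sqi_mul hf hf) (sqi_mul hg hg)) (intgbleZ 2 (sqi_mul hf hg)).
by move: h; congr (integrable _ _ _); apply/funext => x; congr EFin => /=; ring.
Qed.

Lemma sqiZ c f : sqi f -> sqi (fun x => c * f x).
Proof.
move=> hf; split; first by apply: measurable_funM; [exact: measurable_cst|exact: sqi_meas].
have h := intgbleZ (c ^+ 2) (sqi_mul hf hf).
by move: h; congr (integrable _ _ _); apply/funext => x; congr EFin => /=; ring.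
Qed.

Lemma sqiN f : sqi f -> sqi (fun x => - f x).
Proof.
move=> hf; have := sqiZ (-1) hf; congr sqi.
by apply/funext => x; rewrite mulN1r.
Qed.

Lemma sqiB f g : sqi f -> sqi g -> sqi (fun x => f x - g x).
Proof. by move=> hf hg; exact: (sqiD hf (sqiN hg)). Qed.

Lemma sqi_sum n (F : nat -> R -> R) : (forall i, sqi (F i)) ->
  sqi (fun x => \sum_(i < n) F i x).
Proof.
move=> hF; elim: n => [|n IH].
  have -> : (fun x => \sum_(i < 0) F i x) = (fun=> 0).
    by apply/funext => x; rewrite big_ord0.
  exact: sqi_cst.
have -> : (fun x => \sum_(i < n.+1) F i x) = (fun x => \sum_(i < n) F i x + F n x).
  by apply/funext => x; rewrite big_ord_recr.
exact: sqiD.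
Qed.

Lemma cont_bnd f : {within `[0, l], continuous f} ->
  exists M, forall x, D x -> `|f x| <= M.
Proof.
move=> cf; have [l0|l0] := ltP 0 l; last first.
  exists 0 => x; rewrite /itv0l /= in_itv /= => /andP[h1 h2].
  by have := lt_le_trans (lt_trans h1 h2) l0; rewrite ltxx.
have [M [_ hM]] := compact_bounded (continuous_compact cf (@segment_compact _ 0 l)).
exists (M + 1) => x Dx; apply: (hM (M + 1)); first by rewrite ltrDl.
exists x => //; move: Dx; rewrite /itv0l /= !in_itv /= => /andP[h1 h2].
by rewrite (ltW h1) (ltW h2).
Qed.

Lemma cont_sqi f : {within `[0, l], continuous f} -> sqi f.
Proof.
move=> cf; have [M hM] := cont_bnd cf; apply: (@sqi_bnd _ M) => //.
have mf : measurable_fun `[0, l] f by apply: subspace_continuous_measurable_fun.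
apply: measurable_funS mf => //; apply: subset_itv_oo_cc.
Qed.

Lemma ipC f g : ip f g = ip g f.
Proof. by congr intg; apply/funext => x; rewrite mulrC. Qed.

Lemma ipDl f g h : sqi f -> sqi g -> sqi h ->
  ip (fun x => f x + g x) h = ip f h + ip g h.
Proof.
move=> hf hg hh; rewrite /ip -intgD; [|exact: sqi_mul|exact: sqi_mul].
by congr intg; apply/funext => x; rewrite mulrDl.
Qed.

Lemma ipZl c f h : sqi f -> sqi h -> ip (fun x => c * f x) h = c * ip f h.
Proof.
move=> hf hh; rewrite /ip -intgZ; last exact: sqi_mul.
by congr intg; apply/funext => x; rewrite mulrA.
Qed.

Lemma ipBl f g h : sqi f -> sqi g -> sqi h ->
  ip (fun x => f x - g x) h = ip f h - ip g h.
Proof.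
move=> hf hg hh; rewrite /ip -intgB; [|exact: sqi_mul|exact: sqi_mul].
by congr intg; apply/funext => x; rewrite mulrBl.
Qed.

Lemma ipDr f g h : sqi f -> sqi g -> sqi h ->
  ip h (fun x => f x + g x) = ip h f + ip h g.
Proof. by move=> *; rewrite ipC ipDl // ipC (ipC g). Qed.

Lemma ipBr f g h : sqi f -> sqi g -> sqi h ->
  ip h (fun x => f x - g x) = ip h f - ip h g.
Proof. by move=> *; rewrite ipC ipBl // ipC (ipC g). Qed.

Lemma ipZr c f h : sqi f -> sqi h -> ip h (fun x => c * f x) = c * ip h f.
Proof. by move=> *; rewrite ipC ipZl // ipC. Qed.

Lemma ip_ge0 f : 0 <= ip f f.
Proof. by apply: intg_ge0 => x _; rewrite -expr2 sqr_ge0. Qed.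

Lemma ip_suml n (F : nat -> R -> R) h : (forall i, sqi (F i)) -> sqi h ->
  ip (fun x => \sum_(i < n) F i x) h = \sum_(i < n) ip (F i) h.
Proof.
move=> hF hh; rewrite /ip.
have [_ <-] := @intg_sum n (fun i x => F i x * h x) (fun i => sqi_mul (hF i) hh).
by congr intg; apply/funext => x; rewrite mulr_suml.
Qed.

Lemma ip_cauchy_schwarz f g : sqi f -> sqi g -> (ip f g) ^+ 2 <= ip f f * ip g g.
Proof.
move=> hf hg.
have key t : 0 <= ip f f * t ^+ 2 - 2 * t * ip f g + ip g g.
  have h : sqi (fun x => t * f x) by exact: sqiZ.
  have := ip_ge0 (fun x => t * f x - g x).
  rewrite ipBl //; last exact: sqiB.
  rewrite !ipBr // !ipZl // ?ipZr // (ipC g f) ?ipZl //.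
  by congr (_ <= _); rewrite ?(ipC g f); ring.
have f0 := ip_ge0 f; have g0 := ip_ge0 g.
have [f00|fn0] := eqVneq (ip f f) 0.
  rewrite f00 mul0r; have [->|n0] := eqVneq (ip f g) 0; first by rewrite expr0n.
  (* With [ip f f = 0] the quadratic is affine in [t], and this [t] would give it the value -1. *)
  have := key ((ip g g + 1) / (2 * ip f g)).
  rewrite f00 mul0r add0r; set A := (X in 0 <= - X + _).
  have -> : A = ip g g + 1 by rewrite /A; field.
  by lra.
have fp : 0 < ip f f by rewrite lt_def fn0.
have := key (ip f g / ip f f).
set A := (X in 0 <= X -> _).
have -> : A = (ip f f * ip g g - ip f g ^+ 2) / ip f f by rewrite /A; field.
by rewrite pmulr_lge0 ?invr_gt0 // subr_ge0.
Qed.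

End RealL2.

Section Primitive.
Variables (R : realType) (l : R).
Hypothesis l0 : 0 < l.
Local Notation mu := (@lebesgue_measure R).
Local Notation D := (itv0l l).
Local Notation TR := (measurableTypeR R).
Implicit Types f g h p : R -> R.

(** The integrand is cut off outside []0, l[]: the values of a representative there are irrelevant,
    and the primitive is defined on the whole line, zero before 0 and constant after [l]. *)
Definition prim f (x : R) : R := \int[mu]_(t in `[0, x]) (f \_ D) t.

Lemma intgble_patch f : intgble l f -> mu.-integrable setT (EFin \o (f \_ D)).
Proof.
move=> hf; rewrite -restrict_EFin; apply/(integrable_mkcond _ (mD l)).1.
exact: hf.
Qed.

Lemma intgble_patchS f (A : set R) : measurable (A : set TR) -> intgble l f ->
  mu.-integrable A (EFin \o (f \_ D)).
Proof.
move=> mA /intgble_patch; apply: integrableS => //.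
Qed.

(** With an indicator in place of a variable domain, exchanging two primitives becomes Fubini's
    theorem on a fixed square. *)
Lemma primE f x : prim f x = intg l (fun t => f t * (t <= x)%R%:R).
Proof.
rewrite /prim /intg [LHS]Rintegral_mkcond [RHS]Rintegral_mkcond.
apply: eq_Rintegral => t _; rewrite !patchE.
case: ifPn => h1; case: ifPn => h2 //=.
- by move: h1; rewrite inE /= in_itv /= => /andP[_ ->]; rewrite mulr1.
- move: h2 h1; rewrite /itv0l inE /= in_itv /= => /andP[/ltW h2 _] /negP h1.
  suff /negbTE -> : ~~ (t <= x) by rewrite mulr0.
  by apply/negP => h3; apply: h1; rewrite inE /= in_itv /= h2 h3.
Qed.

Lemma prim_cont f : intgble l f -> {within `[0, l], continuous (prim f)}.
Proof.
move=> hf; apply: (@parameterized_integral_continuous R 0 l (f \_ D)).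
  exact: ltW.
by apply: intgble_patchS => //; exact: measurable_itv.
Qed.

Lemma prim_ae_derive f : intgble l f ->
  \forall x \ae mu, D x -> is_derive x 1 (prim f) (f x).
Proof.
move=> hf.
have loc : locally_integrable [set: R] (f \_ D).
  by apply: integrable_locally => //; exact: mD.
have := @FTC1 R (f \_ D) (BLeft 0) (fun y => intgble_patchS (measurable_itv _) hf) loc.
apply: aeS => x hx Dx.
have [] := hx; first by move: Dx; rewrite /itv0l /= in_itv /= => /andP[h _]; rewrite lte_fin.
move=> d1 d2; apply: DeriveDef => //.
by rewrite -derive1E [LHS]d2 patchE mem_set.
Qed.

Lemma prim_derive f x : intgble l f -> D x -> {for x, continuous f} ->
  is_derive x 1 (prim f) (f x).
Proof.
move=> hf Dx cf.
have x0 : 0 < x < l by move: Dx; rewrite /itv0l /= in_itv /=.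
have cx : {for x, continuous (f \_ D)}.
  rewrite /prop_for /continuous_at patchE mem_set //.
  apply: cvg_trans cf; apply: near_eq_cvg.
  have : \forall y \near x, D y.
    by apply: open_nbhs_nbhs; split => //; exact: interval_open.
  by apply: filterS => y Dy; rewrite patchE mem_set.
have [] := @continuous_FTC1 R (f \_ D) (BLeft 0) x l _ _ _ cx.
- by case/andP: x0.
- by apply: intgble_patchS => //; exact: measurable_itv.
- by rewrite lte_fin; case/andP: x0.
move=> d1 d2; apply: DeriveDef => //.
by rewrite -derive1E [LHS]d2 patchE mem_set.
Qed.

Lemma prim0 f : prim f 0 = 0.
Proof.
by rewrite /prim set_itv1 Rintegral_set1.
Qed.

Lemma priml f : prim f l = intg l f.
Proof.
rewrite primE; apply: eq_intg => x; rewrite /itv0l /= in_itv /= => /andP[_ /ltW ->].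
by rewrite mulr1.
Qed.

Lemma meas_natb d (T : measurableType d) (A : set T) (c : T -> bool) :
  measurable_fun setT c -> measurable_fun A (fun t => (c t)%:R : R).
Proof.
move=> mc; apply: (@measurable_funS _ _ _ _ setT) => //.
have -> : (fun t => (c t)%:R : R) = (fun t => if c t then 1 else 0).
  by apply/funext => t; case: (c t).
by apply: measurable_fun_ifT.
Qed.

Lemma intgble_ind f x : intgble l f -> intgble l (fun t => f t * (t <= x)%R%:R).
Proof.
move=> hf; apply: (@intgble_le _ _ _ (fun t => `|f t|)); last exact: intgble_norm.
- apply: measurable_funM; [exact: intgble_meas|apply: meas_natb; exact: measurable_fun_ler].
- by move=> t _; case: (t <= x); rewrite ?mulr1 // mulr0 normr0.
Qed.

Lemma coprimE f s : intgble l f ->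
  intg l (fun t => f t * (s <= t)%R%:R) = intg l f - prim f s.
Proof.
move=> hf; rewrite primE -intgB //; last exact: intgble_ind.
have hi := intgble_ind s hf.
have mf := intgble_meas hf.
apply: ae_eq_intg.
- apply: measurable_funM => //.
  by apply: meas_natb; exact: measurable_fun_ler.
- by apply: measurable_funB => //; exact: intgble_meas.
(* The two indicators overlap at the single point [t = s], so the identity of integrands holds only
   almost everywhere. *)
have : \forall x \ae mu, x != s.
  exists [set s]; split => //=; first exact: lebesgue_measure_set1.
  by move=> x /= /negP; rewrite negbK => /eqP.
apply: aeS => t ts Dt /=.
case: (ltgtP s t) ts => //= h _.
- by rewrite mulr1 mulr0 subr0.
- by rewrite mulr0 mulr1 subrr.
Qed.

Lemma intgbleT_natb (q : R -> R) (c : R -> bool) : mu.-integrable setT (EFin \o q) ->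
    measurable_fun (setT : set TR) c ->
    mu.-integrable setT (EFin \o (fun y => q y * (c y)%:R)).
Proof.
move=> hq mc; apply: (le_integrable measurableT _ _ hq).
  apply/measurable_EFinP; apply: measurable_funM; last exact: meas_natb.
  by apply/measurable_EFinP; exact: measurable_int hq.
move=> y _; rewrite /= lee_fin; case: (c y); first by rewrite mulr1.
by rewrite mulr0 normr0 normr_ge0.
Qed.

Lemma integralT_natb (q : R -> R) (c : R -> bool) (k : R) :
  mu.-integrable setT (EFin \o q) -> measurable_fun (setT : set TR) c ->
  (\int[mu]_y (k * (q y * (c y)%:R))%:E)%E = (k * \int[mu]_y (q y * (c y)%:R))%:E.
Proof.
move=> hq mc; have hi := intgbleT_natb hq mc.
rewrite -(RintegralZl k measurableT hi) /Rintegral fineK; first by [].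
by apply: integrable_fin_num; [exact: measurableT|exact: (integrableZl measurableT k hi)].
Qed.

(** By Tonelli the integral of the absolute value is the product of the two L^1 norms. This product
    dominates the integrand of [fubini_le]. *)
Lemma product_integrable (P H : R -> R) :
  mu.-integrable setT (EFin \o P) -> mu.-integrable setT (EFin \o H) ->
  (mu \x mu)%E.-integrable setT (fun z : TR * TR => (H z.1 * P z.2)%:E).
Proof.
move=> iP iH.
have mP : measurable_fun (setT : set TR) P by apply/measurable_EFinP; exact: measurable_int iP.
have mH : measurable_fun (setT : set TR) H by apply/measurable_EFinP; exact: measurable_int iH.
apply/integrable12ltyP.
  apply/measurable_EFinP; apply: measurable_funM.
    by apply: measurableT_comp.
  by apply: measurableT_comp.
have c0 : (0 <= \int[mu]_y `|(P y)%:E|)%E by apply: integral_ge0.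
rewrite (_ : (\int[mu]_x \int[mu]_y `|(H (x, y).1 * P (x, y).2)%:E|)%E =
   (\int[mu]_x (`|(H x)%:E| * \int[mu]_y `|(P y)%:E|))%E); last first.
  apply: eq_integral => x _ /=.
  rewrite -ge0_integralZl //; last first.
    by apply/measurable_EFinP; apply: measurableT_comp.
  by apply: eq_integral => y _; rewrite normrM EFinM.
rewrite ge0_integralZr //; last by apply: measurableT_comp => //; exact/measurable_EFinP.
apply: lte_mul_pinfty.
- exact: integral_ge0.
- have /integrableP[_ hfin] := iH.
  by rewrite ge0_fin_numE //; exact: integral_ge0.
- by have /integrableP[_] := iP.
Qed.

Lemma fubini_le (P H : R -> R) :
  mu.-integrable setT (EFin \o P) -> mu.-integrable setT (EFin \o H) ->
  \int[mu]_x (H x * \int[mu]_y (P y * (y <= x)%R%:R)) =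
  \int[mu]_y (P y * \int[mu]_x (H x * (y <= x)%R%:R)).
Proof.
move=> iP iH.
have mP : measurable_fun (setT : set TR) P by apply/measurable_EFinP; exact: measurable_int iP.
have mH : measurable_fun (setT : set TR) H by apply/measurable_EFinP; exact: measurable_int iH.
pose F (z : TR * TR) : \bar R := (H z.1 * (P z.2 * (z.2 <= z.1)%R%:R))%:E.
have mF : measurable_fun setT F.
  apply/measurable_EFinP; apply: measurable_funM.
    by apply: measurableT_comp.
  apply: measurable_funM.
    by apply: measurableT_comp.
  by apply: meas_natb; exact: measurable_fun_ler.
have int1 : (mu \x mu)%E.-integrable setT F.
  apply: (le_integrable measurableT mF _ (product_integrable iP iH)) => z _.
  rewrite /F /= lee_fin; case: (z.2 <= z.1); first by rewrite mulr1.
  by rewrite !mulr0 normr0.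
have fub := @Fubini _ _ _ _ R mu mu F int1.
rewrite /Rintegral; apply: (congr1 fine).
transitivity (\int[mu]_x \int[mu]_y F (x, y))%E.
  apply: eq_integral => x _; 
  by rewrite -(@integralT_natb P (fun y => y <= x) (H x) iP (measurable_fun_ler _ _)).
rewrite fub; apply: eq_integral => y _.
rewrite -(@integralT_natb H (fun x => y <= x) (P y) iH); last exact: measurable_fun_ler.
by apply: eq_integral => x _; rewrite /F /= mulrCA.
Qed.

Lemma Rintegral_patch_natb (q : R -> R) (c : R -> bool) :
  \int[mu]_y ((q \_ D) y * (c y)%:R) = intg l (fun y => q y * (c y)%:R).
Proof.
rewrite /intg [RHS]Rintegral_mkcond; apply: eq_Rintegral => y _; rewrite !patchE.
by case: ifP => [//|_]; rewrite mul0r.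
Qed.

(** Integration by parts for functions that are merely integrable: both sides are the integral of
    [p y * h x] over the triangle [y <= x]. *)
Lemma triangle_fubini p h : intgble l p -> intgble l h ->
  ip l (prim p) h = ip l p (fun s => intg l h - prim h s).
Proof.
move=> hp hh.
have := fubini_le (intgble_patch hp) (intgble_patch hh).
rewrite /ip /intg [in X in _ -> X]Rintegral_mkcond [in X in _ -> _ = X]Rintegral_mkcond => hF.
transitivity (\int[mu]_x ((h \_ D) x * \int[mu]_y ((p \_ D) y * (y <= x)%R%:R))).
  apply: eq_Rintegral => x _; rewrite Rintegral_patch_natb -primE !patchE.
  by case: ifP => _; [rewrite mulrC|rewrite mul0r].
rewrite hF; apply: eq_Rintegral => x _.
rewrite Rintegral_patch_natb (coprimE _ hh) !patchE.
by case: ifP => [//|_]; rewrite mul0r.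
Qed.

End Primitive.

(** * The orthonormal basis of Neumann cosines *)

Section Cosines.
Variables (R : realType) (l : R).
Hypothesis l0 : 0 < l.
Local Notation mu := (@lebesgue_measure R).
Local Notation D := (itv0l l).
Local Notation TR := (measurableTypeR R).
Implicit Types (f g h p F G : R -> R) (x y : R).

Lemma derive_cont F f : (forall x : R, is_derive x 1 F (f x)) -> continuous F.
Proof.
move=> dF x; apply: differentiable_continuous; apply/derivable1_diffP.
by have [] := dF x.
Qed.

Lemma cont_within f (A : set R) : continuous f -> {within A, continuous f}.
Proof. by move=> cf; apply: continuous_subspaceT. Qed.

Lemma cont_intgble f : continuous f -> intgble l f.
Proof. by move=> cf; apply: sqi_intgble; apply: cont_sqi; exact: cont_within. Qed.

Lemma prim_ftc F f x : (forall x : R, is_derive x 1 F (f x)) -> continuous f ->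
  0 <= x <= l -> prim l f x = F x - F 0.
Proof.
move=> dF cf /andP[]; rewrite le_eqVlt => /orP[/eqP <- _|x0 xl].
  by rewrite prim0 subrr.
have hf := cont_intgble cf.
have ipat (A : set R) : measurable (A : set TR) -> mu.-integrable A (EFin \o (f \_ D)).
  by move=> mA; exact: intgble_patchS.
have icc : mu.-integrable `[0, x] (EFin \o f).
  by apply: continuous_compact_integrable => //; [exact: segment_compact|exact: cont_within].
have ioo : mu.-integrable `]0, x[ (EFin \o f).
  by apply: integrableS icc => //; exact: subset_itv_oo_cc.
have ioc : mu.-integrable `]0, x] (EFin \o f).
  by apply: integrableS icc => //; exact: subset_itv_oc_cc.
(* The cut-off integrand agrees with [f] on the open interval only, hence the passage from closed to
   open intervals and back. *)
rewrite /prim -Rintegral_itv_obnd_cbnd; last by apply: ipat; exact: measurable_itv.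
rewrite -Rintegral_itv_bndo_bndc; last by apply: ipat; exact: measurable_itv.
transitivity (\int[mu]_(t in `]0, x[) f t).
  apply: eq_Rintegral => t; rewrite inE /= in_itv /= => /andP[t0 tx].
  by rewrite patchE mem_set // /itv0l /= in_itv /= t0 (lt_le_trans tx).
rewrite Rintegral_itv_bndo_bndc // Rintegral_itv_obnd_cbnd //.
rewrite /Rintegral (@continuous_FTC2 R f F 0 x x0) //.
- exact: cont_within.
- have cF := derive_cont dF; split.
  + by move=> y _; have [] := dF y.
  + by apply: cvg_at_right_filter; exact: cF.
  + by apply: cvg_at_left_filter; exact: cF.
- by move=> y _; rewrite derive1E; have [_ ->] := dF y.
Qed.

Lemma intg_ftc F f : (forall x : R, is_derive x 1 F (f x)) -> continuous f ->
  intg l f = F l - F 0.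
Proof.
by move=> dF cf; rewrite -priml // (prim_ftc dF cf) // (ltW l0) lexx.
Qed.

Definition freq (n : nat) : R := n%:R * (pi / l).
Definition cs n (x : R) : R := cos (freq n * x).
Definition sn n (x : R) : R := sin (freq n * x).

Lemma freqS_neq0 n : freq n.+1 != 0.
Proof.
by rewrite /freq mulf_neq0 // ?pnatr_eq0 // mulf_neq0 ?invr_eq0 ?gt_eqF // pi_gt0.
Qed.

Lemma freq_l n : freq n * l = n%:R * pi.
Proof. by rewrite /freq -mulrA divfK // gt_eqF. Qed.

Lemma cs_derive n x : is_derive x 1 (cs n) (- freq n * sn n x).
Proof.
have h : is_derive x 1 (fun y => freq n * y) (freq n).
  have := is_deriveZ (freq n) (is_derive_id x (1 : R)).
  by move=> h; apply: is_derive_eq h _; rewrite /GRing.scale /= mulr1.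
have := is_derive1_comp (is_derive_cos (freq n * x)) h.
by move=> h'; apply: is_derive_eq h' _; rewrite /GRing.scale /= mulNr mulrC mulNr.
Qed.

Lemma sn_derive n x : is_derive x 1 (sn n) (freq n * cs n x).
Proof.
have h : is_derive x 1 (fun y => freq n * y) (freq n).
  have := is_deriveZ (freq n) (is_derive_id x (1 : R)).
  by move=> h; apply: is_derive_eq h _; rewrite /GRing.scale /= mulr1.
have := is_derive1_comp (is_derive_sin (freq n * x)) h.
by move=> h'; apply: is_derive_eq h' _; rewrite /GRing.scale /= mulrC.
Qed.

Lemma cs_cont n : continuous (cs n).
Proof. exact: derive_cont (cs_derive n). Qed.

Lemma sn_cont n : continuous (sn n).
Proof. exact: derive_cont (sn_derive n). Qed.

Lemma cs_sqi n : sqi l (cs n).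
Proof. by apply: cont_sqi; apply: cont_within; exact: cs_cont. Qed.

Lemma sn_sqi n : sqi l (sn n).
Proof. by apply: cont_sqi; apply: cont_within; exact: sn_cont. Qed.

Lemma sn_l n : sn n l = 0.
Proof.
rewrite /sn freq_l; elim: n => [|n IH]; first by rewrite mul0r sin0.
by rewrite -natr1 mulrDl mul1r sinDpi IH oppr0.
Qed.

Lemma sn_0 n : sn n 0 = 0.
Proof. by rewrite /sn mulr0 sin0. Qed.

Lemma cs_0 n : cs n 0 = 1.
Proof. by rewrite /cs mulr0 cos0. Qed.

Lemma cs0E x : cs 0 x = 1.
Proof. by rewrite /cs /freq !mul0r cos0. Qed.

Lemma prim_cs n x : 0 <= x <= l -> prim l (cs n.+1) x = (freq n.+1)^-1 * sn n.+1 x.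
Proof.
move=> hx; have n0 := freqS_neq0 n.
have dF y : is_derive y 1 (fun x => (freq n.+1)^-1 * sn n.+1 x) (cs n.+1 y).
  have := is_deriveZ (freq n.+1)^-1 (sn_derive n.+1 y).
  by move=> h; apply: is_derive_eq h _; rewrite /GRing.scale /= mulKf.
by rewrite (prim_ftc dF (@cs_cont _) hx) sn_0 mulr0 subr0.
Qed.

Lemma prim_sn n x : 0 <= x <= l -> prim l (sn n.+1) x = (freq n.+1)^-1 * (1 - cs n.+1 x).
Proof.
move=> hx; have n0 := freqS_neq0 n.
have dF y : is_derive y 1 (fun x => - (freq n.+1)^-1 * cs n.+1 x) (sn n.+1 y).
  have := is_deriveZ (- (freq n.+1)^-1) (cs_derive n.+1 y).
  by move=> h; apply: is_derive_eq h _; rewrite /GRing.scale /= mulrA mulrNN mulVf // mul1r.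
by rewrite (prim_ftc dF (@sn_cont _) hx) cs_0; ring.
Qed.

Lemma intg_cs n : intg l (cs n) = l *+ (n == 0)%N.
Proof.
case: n => [|n].
  rewrite (eq_intg (g := fun=> 1)); last by move=> x _; rewrite cs0E.
  by rewrite intg_cst // mul1r.
by rewrite -priml // prim_cs ?(ltW l0) ?lexx // sn_l mulr0.
Qed.

Lemma csM m n x : (m <= n)%N -> cs m x * cs n x = (cs (n + m) x + cs (n - m) x) / 2.
Proof.
move=> mn; rewrite /cs /freq natrD natrB // !mulrDl !mulNr cosD cosB; by field.
Qed.

Lemma ip_cs m n : ip l (cs m) (cs n) = if (m == n)%N then (if n == 0 then l else l / 2) else 0.
Proof.
wlog mn : m n / (m <= n)%N.
  move=> W; case/orP: (leq_total m n) => [|h]; first exact: W.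
  rewrite ipC W // eq_sym; case: eqP => // ->; by [].
rewrite /ip (eq_intg (g := fun x => 2^-1 * (cs (n + m) x + cs (n - m) x))); last first.
  by move=> x _; rewrite csM // mulrC.
have i k := cont_intgble (cs_cont (n := k)).
rewrite intgZ; last exact: intgbleD.
rewrite intgD // !intg_cs addn_eq0 subn_eq0.
have [->|mn'] := eqVneq m n.
  by rewrite leqnn andbb; case: (n == 0)%N => /=; rewrite ?mulr1n ?mulr0n; field.
have -> : (n <= m)%N = false by apply/negbTE; rewrite -ltnNge ltn_neqAle mn' mn.
have -> : ((n == 0) && (m == 0))%N = false.
  by apply/negbTE/negP => /andP[/eqP a /eqP b]; move: mn'; rewrite a b eqxx.
by rewrite !mulr0n addr0 mulr0.
Qed.

(** Normalisation: the constant cosine has squared norm [l], the others [l / 2]. *)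
Definition ec (n : nat) : R := Num.sqrt ((if n == 0 then 1 else 2) / l).
Definition en n (x : R) : R := ec n * cs n x.

Lemma ec_sq n : ec n ^+ 2 = (if n == 0 then 1 else 2) / l.
Proof. by rewrite sqr_sqrtr // divr_ge0 ?(ltW l0) //; case: (n == 0)%N. Qed.

Lemma ec_gt0 n : 0 < ec n.
Proof. by rewrite sqrtr_gt0 divr_gt0 //; case: (n == 0)%N. Qed.

Lemma en_cont n : continuous (en n).
Proof. by move=> x; apply: cvgM; [exact: cvg_cst|exact: cs_cont]. Qed.

Lemma en_sqi n : sqi l (en n).
Proof. by apply: cont_sqi; apply: cont_within; exact: en_cont. Qed.

Lemma ip_en m n : ip l (en m) (en n) = (m == n)%:R.
Proof.
rewrite ipZl; [|exact: cs_sqi|exact: en_sqi].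
rewrite ipZr; [|exact: cs_sqi|exact: cs_sqi].
rewrite ip_cs mulrA; case: eqP => [->|_]; last by rewrite mulr0.
have ln0 : l != 0 by rewrite gt_eqF.
rewrite -expr2 ec_sq; case: (n == 0)%N => /=; by field.
Qed.

Lemma ip_en_partial (c : nat -> R) N m : 
  ip l (fun x => \sum_(i < N) c i * en i x) (en m) = if (m < N)%N then c m else 0.
Proof.
rewrite (@ip_suml _ _ _ (fun i x => c i * en i x)); [|by move=> i; exact: sqiZ (en_sqi i)|exact: en_sqi].
transitivity (\sum_(i < N) (if i == m :> nat then c i else 0)).
  apply: eq_bigr => i _; rewrite ipZl; [|exact: en_sqi|exact: en_sqi].
  by rewrite ip_en; case: eqP => _; rewrite ?mulr1 ?mulr0.
rewrite -big_mkcond /=; case: ltnP => h.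
  by rewrite (big_pred1 (Ordinal h)).
by rewrite big1 // => i /eqP im; move: (ltn_ord i); rewrite im ltnNge h.
Qed.

Lemma ip_partial (c : nat -> R) N h : sqi l h ->
  ip l (fun x => \sum_(i < N) c i * en i x) h = \sum_(i < N) c i * ip l h (en i).
Proof.
move=> hh; rewrite (@ip_suml _ _ _ (fun i x => c i * en i x)) //; last by move=> i; exact: sqiZ (en_sqi i).
by apply: eq_bigr => i _; rewrite ipZl ?(ipC _ h) //; exact: en_sqi.
Qed.

Lemma sqi_partial (c : nat -> R) N : sqi l (fun x => \sum_(i < N) c i * en i x).
Proof.
exact: (@sqi_sum _ _ N (fun i x => c i * en i x) (fun i => sqiZ _ (en_sqi i))).
Qed.

Lemma partial_dist f N : sqi l f ->
  let s := (fun x => \sum_(i < N) ip l f (en i) * en i x) in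
  ip l (fun x => f x - s x) (fun x => f x - s x) =
  ip l f f - \sum_(i < N) (ip l f (en i)) ^+ 2.
Proof.
move=> hf s; have hs : sqi l s by exact: (sqi_partial (fun i => ip l f (en i))).
rewrite ipBl //; last exact: sqiB.
have e h : sqi l h -> ip l s h = \sum_(i < N) ip l f (en i) * ip l h (en i) by exact: (ip_partial (fun i => ip l f (en i))).
rewrite !ipBr // e // e //.
rewrite (ipC l f) e //.
rewrite [X in _ - (_ - X)](_ : _ = \sum_(i < N) ip l f (en i) * ip l f (en i)); last first.
  by apply: eq_bigr => i _; rewrite (ip_en_partial (fun i => ip l f (en i))) ltn_ord.
rewrite subrr subr0; congr (_ - _).
Qed.

Lemma bessel f N : sqi l f -> \sum_(i < N) (ip l f (en i)) ^+ 2 <= ip l f f.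
Proof. by move=> hf; rewrite -subr_ge0 -partial_dist // ip_ge0. Qed.

End Cosines.

(** * Completeness of the cosine system *)

Section CosineCompleteness.
Variables (R : realType) (l : R).
Hypothesis l0 : 0 < l.
Local Notation mu := (@lebesgue_measure R).
Local Notation D := (itv0l l).
Local Notation TR := (measurableTypeR R).
Local Notation csl := (cs l).
Local Notation snl := (sn l).
Implicit Types (f g h p F G : R -> R) (x y : R).

Lemma DE x : D x <-> 0 < x < l.
Proof. by rewrite /itv0l /= in_itv. Qed.

Lemma freq1 x : freq l 1 * x = x * (pi / l).
Proof. by rewrite /freq mul1r mulrC. Qed.

Lemma sn1_gt0 x : 0 < x < l -> 0 < snl 1 x.
Proof.
move=> /andP[x0 xl]; rewrite /sn freq1; apply: sin_gt0_pi.
have w0 : 0 < pi / l by rewrite divr_gt0 // pi_gt0.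
by rewrite mulr_gt0 //= mulrA ltr_pdivrMr // mulrC ltr_pM2l // pi_gt0.
Qed.

Lemma cs1_lt x y : 0 <= x <= l -> 0 <= y <= l -> x < y -> csl 1 y < csl 1 x.
Proof.
move=> hx hy xy; rewrite /cs !freq1.
have w0 : 0 < pi / l by rewrite divr_gt0 // pi_gt0.
have s z : 0 <= z <= l -> z * (pi / l) \in `[0, pi].
  move=> /andP[z0 zl]; rewrite in_itv /= mulr_ge0 //= ?(ltW w0) //.
  by rewrite mulrA ler_pdivrMr // mulrC ler_pM2l // pi_gt0.
by rewrite ltr_cos ?s // ltr_pM2r.
Qed.

(** The derivative of the cosine vanishes at 0 and [l], so the mean value theorem gives a lower
    bound only on a compact interval [[a, b]] around [x0]. Outside it monotonicity bounds the
    difference below by a constant, and [|x - x0| <= l] suffices. *)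
Lemma cs1_diff x0 : D x0 -> exists2 c, 0 < c &
  forall x, D x -> c * `|x - x0| <= `|csl 1 x - csl 1 x0|.
Proof.
move=> /DE /andP[x00 x0l].
pose a := x0 / 2; pose b := (x0 + l) / 2.
have [a0 ax ab xb bl] : [/\ 0 < a, a < x0, a <= b, x0 < b & b < l].
  by rewrite /a /b; split; lra.
have [m /[!in_itv]/= /andP[am mb] hm] := @EVT_min R (snl 1) a b ab (cont_within (@sn_cont _ _ _)).
have sm : 0 < snl 1 m by apply: sn1_gt0; lra.
have w0 : 0 < freq l 1 by rewrite /freq mul1r divr_gt0 // pi_gt0.
have ca : 0 < csl 1 a - csl 1 x0 by rewrite subr_gt0; apply: cs1_lt; lra.
have cb : 0 < csl 1 x0 - csl 1 b by rewrite subr_gt0; apply: cs1_lt; lra.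
pose c := Num.min (freq l 1 * snl 1 m) (Num.min ((csl 1 a - csl 1 x0) / l) ((csl 1 x0 - csl 1 b) / l)).
have c0 : 0 < c by rewrite !lt_min mulr_gt0 //= !divr_gt0.
have [c1 c2 c3] : [/\ c <= freq l 1 * snl 1 m, c * l <= csl 1 a - csl 1 x0 & c * l <= csl 1 x0 - csl 1 b].
  by rewrite -!ler_pdivlMr // /c !ge_min !lexx /= ?orbT.
exists c => // x /DE /andP[x_0 x_l].
have xl : c * `|x - x0| <= c * l.
  by rewrite ler_pM2l // ler_norml; lra.
have mid u v : a <= u -> u <= v -> v <= b -> c * (v - u) <= csl 1 u - csl 1 v.
  move=> au uv vb.
  have [z] := @MVT_segment R (csl 1) _ u v uv (fun x _ => cs_derive l 1 x) (cont_within (@cs_cont _ _ _)).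
  rewrite in_itv /= => /andP[uz zv] e.
  have -> : csl 1 u - csl 1 v = freq l 1 * snl 1 z * (v - u) by rewrite -opprB e; ring.
  rewrite ler_wpM2r ?subr_ge0 // (le_trans c1) // ler_pM2l // hm // in_itv /=; lra.
have [xa|xa] := ltP x a.
  have : csl 1 a < csl 1 x by apply: cs1_lt; lra.
  move=> h; rewrite (le_trans xl) // (le_trans c2) // ger0_norm; lra.
have [xb'|xb'] := ltP b x.
  have : csl 1 x < csl 1 b by apply: cs1_lt; lra.
  move=> h; rewrite (le_trans xl) // (le_trans c3) // distrC ger0_norm; lra.
have [xx|/ltW xx] := leP x x0.
  rewrite distrC ger0_norm ?subr_ge0 //; have := mid x x0 xa xx (ltW xb).
  by move=> /le_trans; apply; exact: ler_norm.
rewrite ger0_norm ?subr_ge0 //; have := mid x0 x (ltW ax) xx xb'.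
by move=> /le_trans; apply; rewrite distrC; exact: ler_norm.
Qed.

(* If [c_k] are the cosine coefficients of [g = (G - G x0) / (cos - cos x0)], then
   [c_{k+2} + c_k = 2 cos x0 c_{k+1}], so the quadratic form
   [c_k^2 + c_{k+1}^2 - 2 cos x0 c_k c_{k+1}] does not depend on k; by Bessel it vanishes. *)
Lemma cosine_recurrence_zero (c : nat -> R) (k B : R) :
  -1 < k < 1 -> (forall n, c n.+2 + c n = 2 * k * c n.+1) ->
  (forall N, \sum_(i < N) c i ^+ 2 <= B) -> c 0 = 0 /\ c 1 = 0.
Proof.
move=> /andP[k1 k2] rc hB.
pose q n := c n ^+ 2 + c n.+1 ^+ 2 - 2 * k * c n * c n.+1.
have qS n : q n = q 0.
  elim: n => // n <-; rewrite /q; have := rc n => /eqP; rewrite eq_sym -subr_eq => /eqP <-; ring.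
have q0 : 0 <= q 0.
  rewrite /q; have -> : c 0 ^+ 2 + c 1 ^+ 2 - 2 * k * c 0 * c 1 = (c 1 - k * c 0) ^+ 2 + (1 - k ^+ 2) * c 0 ^+ 2 by ring.
  by rewrite addr_ge0 ?sqr_ge0 // mulr_ge0 ?sqr_ge0 // subr_ge0; nra.
have qle n : q 0 <= 2 * (c n ^+ 2 + c n.+1 ^+ 2).
  rewrite -(qS n) /q; have := sqr_ge0 (c n + c n.+1); have := sqr_ge0 (c n - c n.+1).
  rewrite !expr2; nra.
(* [q] is constant, so summing it over N indices would exceed the Bessel bound if [q 0] were
   positive. *)
have qb N : q 0 * N%:R <= 4 * B.
  have h1 : q 0 * N%:R = \sum_(i < N) q 0 by rewrite big_const_ord iter_addr_0 mulr_natr.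
  rewrite h1; apply: (@le_trans _ _ (\sum_(i < N) (2 * c i ^+ 2 + 2 * c i.+1 ^+ 2))).
    by apply: ler_sum => i _; rewrite -mulrDr qle.
  rewrite big_split /= -!mulr_sumr; have := hB N; have := hB N.+1.
  rewrite big_ord_recl /= => h2 h3; have := sqr_ge0 (c 0).
  by under [X in _ -> _ + 2 * X <= _]eq_bigr do rewrite -[X in c X]add1n; move: h2; rewrite /bump /=; nra.
have q00 : q 0 = 0.
  apply/eqP; rewrite eq_le q0 andbT leNgt; apply/negP => qp.
  have hB0 : 0 <= 4 * B / q 0 by rewrite divr_ge0 // (le_trans _ (qb 0%N)) // mulr0.
  have := archi_boundP hB0; set N := Num.bound _; rewrite ltr_pdivrMr // mulrC => h.
  by have := qb N; rewrite leNgt [q 0 * _]mulrC [4 * B]mulrC h.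
have e : (c 1 - k * c 0) ^+ 2 + (1 - k ^+ 2) * c 0 ^+ 2 = 0 by rewrite -q00 /q; ring.
have kk : 0 < 1 - k ^+ 2 by nra.
have c0 : c 0 ^+ 2 = 0.
  have := sqr_ge0 (c 0); have := sqr_ge0 (c 1 - k * c 0); nra.
move/eqP: c0; rewrite sqrf_eq0 => /eqP c0; split => //.
by move: e; rewrite c0 mulr0 subr0 expr0n /= mulr0 addr0 => /eqP; rewrite sqrf_eq0 => /eqP.
Qed.

Lemma measurable_invr (A : set R) : measurable_fun A (fun x => x^-1).
Proof.
apply: (@measurable_funS _ _ _ _ setT) => //.
rewrite -(setvU [set 0]); apply/measurable_funU => //.
  by apply: measurableC.
split; last exact: measurable_fun_set1.
have o : open (~` [set (0 : R)]).
  by apply: closed_openC; exact/accessible_closed_set1/hausdorff_accessible/Rhausdorff.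
apply: open_continuous_measurable_fun => // x; rewrite inE => /= x0.
by apply: inv_continuous; apply/eqP.
Qed.

(** The Lipschitz bound at [x0] keeps the quotient [g] bounded, so Bessel applies to it.
    Orthogonality of [G] to [cs n.+1], with the product formula for cosines, is the recurrence for
    the coefficients of [g]. They vanish at 0 and 1, and the relation for mode 0 then reads
    [0 = - G x0 * l]. *)
Lemma lipschitz_cos_orth G x0 L : measurable_fun D G -> D x0 ->
  (forall x, D x -> `|G x - G x0| <= L * `|x - x0|) ->
  (forall n, ip l G (csl n) = 0) -> G x0 = 0.
Proof.
move=> mG Dx0 hL hG.
have [c c0 hc] := cs1_diff Dx0.
have hsG : sqi l G.
  apply: (@sqi_bnd _ _ _ (`|L| * l + `|G x0|)) => // x Dx.
  have -> : G x = (G x - G x0) + G x0 by ring.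
  rewrite (le_trans (ler_normD _ _)) // lerD2r (le_trans (hL _ Dx)) //.
  rewrite (le_trans (ler_wpM2r _ (ler_norm L))) // ler_wpM2l //.
  by move/DE: Dx; move/DE: Dx0; rewrite ler_norml; lra.
pose g x := (G x - G x0) / (csl 1 x - csl 1 x0).
have csq n := cs_sqi l n.
have hg : sqi l g.
  apply: (@sqi_bnd _ _ _ (`|L| / c)).
    apply: measurable_funM; first by apply: measurable_funB.
    have mi : measurable_fun (setT : set R) (@GRing.inv R) by exact: measurable_invr.
    have md : measurable_fun D (fun x => csl 1 x - csl 1 x0).
      by apply: measurable_funB => //; exact: sqi_meas (csq 1%N).
    exact: (measurableT_comp mi md).
  move=> x Dx; have [->|xx] := eqVneq x x0.
    by rewrite /g subrr mul0r normr0 divr_ge0 // ltW.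
  have xp : 0 < `|x - x0| by rewrite normr_gt0 subr_eq0.
  have dp : 0 < `|csl 1 x - csl 1 x0| by rewrite (lt_le_trans _ (hc _ Dx)) // mulr_gt0.
  rewrite normrM normfV ler_pdivrMr // -mulrA mulrC.
  rewrite (le_trans (hL _ Dx)) // (le_trans (ler_wpM2r (normr_ge0 _) (ler_norm L))) //.
  rewrite [leRHS]mulrC ler_wpM2l //.
  by rewrite ler_pdivlMl // hc.
have rel h : sqi l h -> ip l g (fun x => (csl 1 x - csl 1 x0) * h x) = ip l (fun x => G x - G x0) h.
  move=> hh; apply: eq_intg => x Dx; rewrite /g mulrA.
  have [->|xx] := eqVneq x x0; first by rewrite subrr !mul0r.
  rewrite divfK // -normr_gt0 (lt_le_trans _ (hc _ Dx)) // mulr_gt0 //.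
  by rewrite normr_gt0 subr_eq0.
have GGs : sqi l (fun x => G x - G x0) by apply: sqiB => //; exact: sqi_cst.
have ipG n : ip l (fun x => G x - G x0) (csl n) = - G x0 * (l *+ (n == 0)%N).
  rewrite (ipBl (g := fun=> G x0)) //; last exact: sqi_cst.
  rewrite hG sub0r /ip intgZ ?intg_cs // ?mulNr //; exact: cont_intgble (@cs_cont _ _ _).
pose gc n := ip l g (csl n).
have rec n : gc n.+2 + gc n = 2 * csl 1 x0 * gc n.+1.
  have := rel _ (csq n.+1); rewrite ipG /= mulr0 => h0.
  apply/eqP; rewrite -subr_eq0 -(mulr0 2) -h0; apply/eqP.
  have cc : sqi l (fun x => (csl 1 x - csl 1 x0) * csl n.+1 x).
    apply: cont_sqi; apply: cont_within => x; apply: cvgM; last exact: cs_cont.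
    by apply: cvgB; [exact: cs_cont|exact: cvg_cst].
  rewrite -ipZr //.
  rewrite -[2 * _ * _]mulrA -(ipZr (csl 1 x0)) // -ipZr //; last exact: sqiZ.
  rewrite -ipDr // -ipBr //; [|exact: sqiD|exact: sqiZ (sqiZ _ _)].
  apply: eq_intg => x _; congr (_ * _).
  have := @csM _ l 1 n.+1 x isT; rewrite addn1 subSS subn0 => e.
  have -> : csl n.+2 x + csl n x = 2 * (csl 1 x * csl n.+1 x) by rewrite e; field.
  ring.
have bes N : \sum_(i < N) gc i ^+ 2 <= ip l g g * l.
  rewrite mulrC; apply: le_trans (ler_wpM2l (ltW l0) (bessel l0 N hg)).
  rewrite mulr_sumr; apply: ler_sum => i _.
  rewrite (ipZr (ec l i)) // exprMn ec_sq // mulrA mulrC -subr_ge0 -[X in _ - X]mulr1 -mulrBr.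
  apply: mulr_ge0; first exact: sqr_ge0.
  set t := (if _ then _ else _); have t1 : 1 <= t by rewrite /t; case: ifP => _; rewrite ?ler1n.
  have -> : l * (t / l) = t by rewrite mulrC divfK // gt_eqF.
  by rewrite subr_ge0.
have k1 : -1 < csl 1 x0 < 1.
  move/DE: (Dx0) => /andP[a1 a2]; apply/andP; split.
    have -> : -1 = csl 1 l by rewrite /cs freq_l // mul1r cospi.
    by apply: cs1_lt; lra.
  by rewrite -(cs_0 l 1); apply: cs1_lt; lra.
have [z0 z1] := cosine_recurrence_zero k1 rec bes.
have := rel _ (csq 0); rewrite ipG eqxx mulr1n.
have -> : ip l g (fun x => (csl 1 x - csl 1 x0) * csl 0 x) = gc 1 - csl 1 x0 * gc 0.
  rewrite -ipZr // -ipBr //; last exact: sqiZ.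
  by apply: eq_intg => x _; rewrite cs0E; ring.
rewrite z0 z1 mulr0 subr0 => /esym /eqP; rewrite mulf_eq0 (gt_eqF l0) orbF oppr_eq0.
by move/eqP.
Qed.

Lemma within_cont_interior f x : {within `[0, l], continuous f} -> D x -> {for x, continuous f}.
Proof.
move=> cf /DE hx; have [h _ _] := (continuous_within_itvP f l0).1 cf.
by apply: h; rewrite in_itv.
Qed.

Lemma near_D x : D x -> \forall y \near x, D y.
Proof.
by move=> Dx; apply: open_nbhs_nbhs; split => //; exact: interval_open.
Qed.

Lemma const_derive F x (m d : R) : D x -> (forall y, D y -> F y = m) ->
  is_derive x 1 F d -> d = 0.
Proof.
move=> Dx hF [_ <-].
rewrite (@near_eq_derive _ _ _ F (cst m)) ?oner_neq0 //; first by rewrite derive_cst.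
by have := near_D Dx; apply: filterS => y /hF ->.
Qed.

(** Two primitives make the function Lipschitz, as [lipschitz_cos_orth] requires. Integration by
    parts carries the orthogonality along: [F] is orthogonal to the sines and [G] to the nonconstant
    cosines. Hence [G] minus its mean vanishes, and differentiating twice gives [F = 0] and [f = 0]
    almost everywhere. *)
Lemma cos_complete f : sqi l f -> (forall n, ip l f (csl n) = 0) ->
  \forall x \ae mu, D x -> f x = 0.
Proof.
move=> hf hf0; have if_ := sqi_intgble hf.
pose F := prim l f; pose G := prim l F.
have cF : {within `[0, l], continuous F} by exact: prim_cont.
have sF : sqi l F by exact: cont_sqi.
have iF := sqi_intgble sF.
have cG : {within `[0, l], continuous G} by exact: prim_cont.
have sG : sqi l G by exact: cont_sqi.
have csq n := cs_sqi l n. have ssq n := sn_sqi l n.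
have Dcc x : D x -> 0 <= x <= l by move=> /DE /andP[/ltW -> /ltW ->].
have lcc : 0 <= l <= l by rewrite lexx ltW.
have F0 k : ip l F (snl k.+1) = 0.
  rewrite triangle_fubini //; last exact: sqi_intgble.
  rewrite -priml // prim_sn //.
  transitivity (ip l f (fun x => (freq l k.+1)^-1 * (csl k.+1 x - csl k.+1 l * csl 0 x))).
    by apply: eq_intg => x /Dcc hx; rewrite prim_sn // cs0E; ring.
  have h0 : sqi l (fun x => csl k.+1 l * csl 0 x) by exact: sqiZ.
  by rewrite ipZr ?ipBr ?ipZr ?hf0 //; [ring|exact: sqiB].
have G0 k : ip l G (csl k.+1) = 0.
  rewrite triangle_fubini //; last exact: sqi_intgble.
  rewrite intg_cs //= mulr0n.
  transitivity (ip l F (fun x => - (freq l k.+1)^-1 * snl k.+1 x)).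
    by apply: eq_intg => x /Dcc hx; rewrite prim_cs //; ring.
  by rewrite ipZr // F0 mulr0.
pose m := intg l G / l.
have Gm x0 : D x0 -> G x0 = m.
  move=> Dx0; apply/eqP; rewrite -subr_eq0; apply/eqP.
  have [M hM] := cont_bnd cF.
  apply: (@lipschitz_cos_orth (fun x => G x - m) x0 M) => //.
  - by apply: measurable_funB => //; exact: sqi_meas sG.
  - move=> x Dx.
    have lip u v : D u -> D v -> u <= v -> `|G v - G u| <= M * `|v - u|.
      move=> Du Dv uv; move/DE: (Du) => hu; move/DE: (Dv) => hv.
      have inD z : z \in `[u, v] -> D z by rewrite in_itv /= => hz; apply/DE; lra.
      have dG z : z \in `]u, v[ -> is_derive z 1 G (F z).
        move=> hz; have Dz : D z by apply: inD; exact: subset_itv_oo_cc hz.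
        by apply: prim_derive => //; exact: within_cont_interior.
      have cGuv : {within `[u, v], continuous G}.
        by apply: continuous_subspaceW cG => z /=; rewrite !in_itv /=; lra.
      have [z /inD Dz ->] := MVT_segment uv dG cGuv.
      by rewrite normrM ler_wpM2r // hM.
    have -> : G x - m - (G x0 - m) = G x - G x0 by ring.
    by have [xx|/ltW xx] := leP x0 x; [exact: lip|rewrite distrC [`|x - _|]distrC; exact: lip].
  - move=> n; rewrite (ipBl (g := fun=> m)) //; last exact: sqi_cst.
    rewrite {2}/ip intgZ ?intg_cs //; last exact: sqi_intgble.
    case: n => [|n]; last by rewrite G0 mulr0n mulr0 subr0.
    rewrite eqxx mulr1n /m divfK ?gt_eqF //.
    apply/eqP; rewrite subr_eq0; apply/eqP; apply: eq_intg => x _.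
    by rewrite cs0E mulr1.
have Fz x : D x -> F x = 0.
  move=> Dx; apply: (const_derive Dx Gm).
  by apply: prim_derive => //; exact: within_cont_interior.
have := prim_ae_derive if_; apply: aeS => x hx Dx.
exact: (const_derive Dx Fz (hx Dx)).
Qed.

End CosineCompleteness.

(** * Riesz-Fischer theorem and Parseval's identity *)

Section RieszFischer.
Variables (R : realType) (l : R).
Hypothesis l0 : 0 < l.
Local Notation mu := (@lebesgue_measure R).
Local Notation D := (itv0l l).
Local Notation TR := (measurableTypeR R).
Implicit Types (f g h p F G : R -> R) (x y : R).

Lemma intg_EFin f : intgble l f -> (\int[mu]_(x in D) (f x)%:E)%E = (intg l f)%:E.
Proof.
move=> hf; rewrite /intg /Rintegral fineK //; apply: integrable_fin_num => //; exact: mD.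
Qed.

Lemma sum_half n : \sum_(j < n) (2^-1 : R) ^+ j <= 2.
Proof.
suff -> : \sum_(j < n) (2^-1 : R) ^+ j = 2 - 2 * 2^-1 ^+ n.
  by rewrite gerBl mulr_ge0 // exprn_ge0.
elim: n => [|n IH]; first by rewrite big_ord0 expr0; ring.
by rewrite big_ord_recr /= IH exprS; field.
Qed.

Lemma ip_partial2 (c : nat -> R) N :
  ip l (fun x => \sum_(i < N) c i * en l i x) (fun x => \sum_(i < N) c i * en l i x) =
  \sum_(i < N) c i ^+ 2.
Proof.
rewrite ip_partial //; last exact: sqi_partial.
by apply: eq_bigr => i _; rewrite ip_en_partial // ltn_ord -expr2.
Qed.

Lemma quarter_lt (e : R) (n : nat) : 0 < e -> exists2 k, (n <= k)%N & (4^-1 : R) ^+ k < e.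
Proof.
move=> e0; have c0 : (4^-1 : R) ^+ k @[k --> \oo] --> (0 : R).
  by apply: cvg_expr; rewrite ger0_norm // invf_lt1 // ltr1n.
have [k _ hk] := (cvgrPdist_lt _ _).1 c0 _ e0.
exists (maxn k n); first exact: leq_maxr.
have := hk (maxn k n) (leq_maxl _ _).
by rewrite sub0r normrN ger0_norm // exprn_ge0.
Qed.

Lemma small_tail (c : nat -> R) B : (forall N, \sum_(i < N) c i ^+ 2 <= B) ->
  forall e, 0 < e -> exists N, forall m, (N <= m)%N ->
    \sum_(i < m) c i ^+ 2 - \sum_(i < N) c i ^+ 2 <= e.
Proof.
move=> hB e e0.
pose S := [set y | exists N, y = \sum_(i < N) c i ^+ 2].
have S0 : has_sup S.
  split; first by exists (\sum_(i < 0) c i ^+ 2), 0%N.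
  by exists B => _ [N ->].
have [_ [N ->] hN] := sup_adherent e0 S0.
exists N => m Nm; have : \sum_(i < m) c i ^+ 2 <= sup S.
  by apply: sup_upper_bound => //; exists m.
lra.
Qed.

(** Along the indices [nn] consecutive partial sums are at distance at most 2^-j, so the integrals
    of their absolute differences are summable and the subsequence converges almost everywhere.
    Fatou's lemma bounds the distance from the limit to the partial sums, which yields the
    coefficients and the norm. *)
Lemma riesz_fischer (c : nat -> R) B : (forall N, \sum_(i < N) c i ^+ 2 <= B) ->
  exists f, [/\ sqi l f, forall n, ip l f (en l n) = c n & ip l f f <= B].
Proof.
move=> hB.
pose s N x := \sum_(i < N) c i * en l i x.
have ss N : sqi l (s N) by exact: sqi_partial.
have dist N m : (N <= m)%N -> ip l (fun x => s m x - s N x) (fun x => s m x - s N x) =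
    \sum_(i < m) c i ^+ 2 - \sum_(i < N) c i ^+ 2.
  move=> Nm; rewrite ipBl ?ipBr //; try exact: sqiB.
  rewrite !ip_partial2 (ipC _ (s m)) /s ip_partial //; last exact: sqi_partial.
  rewrite (_ : \sum_(i < N) _ = \sum_(i < N) c i ^+ 2); first by ring.
  by apply: eq_bigr => i _; rewrite ip_en_partial // (leq_trans (ltn_ord i) Nm) -expr2.
have /choice[K hK] j := small_tail hB (exprn_gt0 j (ltac:(by []) : 0 < (4^-1 : R))).
(* Summing makes [nn] monotone and at least [K j]; the added 1 forces [j <= nn j]. *)
pose nn j := (\sum_(i < j.+1) (K i + 1))%N.
have nnS j : (nn j <= nn j.+1)%N by rewrite /nn [X in (_ <= X)%N]big_ord_recr leq_addr.
have nnK j : (K j <= nn j)%N by rewrite /nn big_ord_recr /= addn1 addnS ltnW // ltnS leq_addl.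
have nnle i j : (i <= j)%N -> (nn i <= nn j)%N.
  elim: j => [|j IH]; first by rewrite leqn0 => /eqP ->.
  rewrite leq_eqVlt => /orP[/eqP -> //|]; rewrite ltnS => /IH h; exact: leq_trans h (nnS j).
have nnj j : (j <= nn j)%N.
  rewrite /nn; apply: ltnW; rewrite -[X in (X <= _)%N]muln1 -[X in (X * _ <= _)%N]card_ord -sum_nat_const.
  by apply: leq_sum => i _; rewrite addn1.
have tl j m : (nn j <= m)%N -> ip l (fun x => s m x - s (nn j) x) (fun x => s m x - s (nn j) x) <= 4^-1 ^+ j.
  move=> jm; rewrite dist //; apply: le_trans (hK j m (leq_trans (nnK j) jm)).
  rewrite lerB //.
  rewrite -!(big_mkord xpredT (fun i => c i ^+ 2)) (big_cat_nat _ (nnK j)) //= lerDl.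
  by apply: sumr_ge0 => i _; exact: sqr_ge0.
pose d j x := s (nn j.+1) x - s (nn j) x.
have sd j : sqi l (d j) by exact: sqiB.
have id_ j : intgble l (fun x => `|d j x|) by apply: intgble_norm; exact: sqi_intgble.
(* Cauchy-Schwarz against the constant 1 passes from L^2 to L^1; [1 + l] replaces the square root of
   [l]. *)
have sqd j : intg l (fun x => `|d j x|) <= (1 + l) * 2^-1 ^+ j.
  have sa : sqi l (fun x => `|d j x|).
    split; first by apply: measurableT_comp => //; exact: sqi_meas.
    have [_] := sd j; congr (integrable _ _ _); apply/funext => x /=.
    by rewrite real_normK // num_real.
  have h := ip_cauchy_schwarz sa (sqi_cst l 1).
  have h1 : ip l (fun x => `|d j x|) (fun x => `|d j x|) <= 4^-1 ^+ j.
    apply: le_trans (tl j _ (nnS j)); rewrite le_eqVlt; apply/orP; left; apply/eqP.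
    by apply: eq_intg => x _; rewrite -!expr2 real_normK // num_real.
  have h2 : ip l (fun=> 1) (fun=> 1) = l by rewrite /ip mul1r intg_cst // mul1r.
  have h3 : ip l (fun x => `|d j x|) (fun=> 1) = intg l (fun x => `|d j x|).
    by apply: eq_intg => x _; rewrite mulr1.
  have i0 : 0 <= intg l (fun x => `|d j x|) by exact: intg_ge0.
  have p0 : 0 <= 2^-1 ^+ j :> R by rewrite exprn_ge0.
  have e4 : (4^-1 : R) ^+ j = (2^-1 ^+ j) ^+ 2.
    by rewrite -exprM mulnC exprM; congr (_ ^+ j); field.
  rewrite -(@ler_pXn2r _ 2) ?nnegrE ?mulr_ge0 ?addr_ge0 ?(ltW l0) //.
  rewrite -h3 (le_trans h) // h2 exprMn -e4 mulrC.
  apply: ler_pM => //; [exact: ltW|exact: ip_ge0|].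
  by rewrite expr2; have := ltW l0; nra.
pose T x : \bar R := (\sum_(j <oo) `|d j x|%:E)%E.
have mdj j : measurable_fun D (fun x => `|d j x|%:E).
  by apply/measurable_EFinP; exact: intgble_meas.
have Tfin : (\int[mu]_(x in D) T x < +oo)%E.
  rewrite /T (@integral_nneseries _ _ _ mu D (mD l) (fun j x => `|d j x|%:E)) //.
  apply: (@le_lt_trans _ _ ((1 + l) * 2)%:E); last exact: ltry.
  apply: lime_le.
    by apply: is_cvg_nneseries => j _ _; apply: integral_ge0 => x _; rewrite lee_fin.
  apply: nearW => N; rewrite big_mkord.
  under eq_bigr do rewrite intg_EFin //.
  rewrite sumEFin lee_fin.
  apply: (@le_trans _ _ (\sum_(j < N) (1 + l) * 2^-1 ^+ j)); first exact: ler_sum.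
  by rewrite -mulr_sumr ler_wpM2l ?sum_half // addr_ge0 // ltW.
have T0 x : (0 <= T x)%E by apply: nneseries_ge0 => j _ _; rewrite lee_fin.
have iT : mu.-integrable D T.
  apply/integrableP; split.
    have := @ge0_emeasurable_sum _ _ _ D (fun j x => `|d j x|%:E) xpredT; exact.
  by under eq_integral do rewrite gee0_abs //.
(* An upper limit is measurable whether or not the sequence converges. *)
pose f x := fine (limn_esup (fun j => (s (nn j) x)%:E)).
have mf : measurable_fun D f.
  apply: (measurableT_comp (fine_measurable measurableT)).
  apply: measurable_fun_limn_esup => j; apply/measurable_EFinP; exact: sqi_meas.
have cvf : \forall x \ae mu, D x -> s (nn j) x @[j --> \oo] --> f x.
  have := integrable_ae (mD l) iT; apply: aeS => x hx Dx.
  have Tx : T x \is a fin_num by exact: hx.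
  have cs1 : cvgn (series (fun j => d j x)).
    apply: normed_cvg; apply: nondecreasing_is_cvgn.
      move=> p q pq; rewrite -subr_ge0 sub_series_geq //.
      by apply: sumr_ge0 => i _; exact: normr_ge0.
    exists (fine (T x)) => _ [N _ <-]; rewrite /series /= -lee_fin fineK // -sumEFin.
    by apply: nneseries_lim_ge => j _ _; rewrite lee_fin.
  have cs2 : cvgn (fun j => s (nn j) x).
    have -> : (fun j => s (nn j) x) = (fun j => s (nn 0%N) x + series (fun j => d j x) j).
      by apply/funext => j; rewrite (eq_sum_telescope (fun j => s (nn j) x) j).
    by apply: is_cvgD => //; exact: is_cvg_cst.
  have [y hy] := (cvg_ex _).1 cs2.
  have he : (s (nn j) x)%:E @[j --> \oo] --> y%:E by apply: cvg_EFin => //; exact: nearW.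
  by rewrite /f (cvg_limn_einf_sup he).2.
have fat k : sqi l (fun x => f x - s (nn k) x) /\
    ip l (fun x => f x - s (nn k) x) (fun x => f x - s (nn k) x) <= 4^-1 ^+ k.
  pose h j x := ((s (nn (j + k)%N) x - s (nn k) x) ^+ 2)%:E.
  have mh j : measurable_fun D (h j).
    apply/measurable_EFinP; apply: measurable_funX.
    by apply: measurable_funB; exact: sqi_meas.
  have h0 j x : D x -> (0 <= h j x)%E by move=> _; rewrite lee_fin sqr_ge0.
  have mf2 : measurable_fun D (fun x => (f x - s (nn k) x) ^+ 2).
    by apply: measurable_funX; apply: measurable_funB => //; exact: sqi_meas.
  have le1 : (\int[mu]_(x in D) ((f x - s (nn k) x) ^+ 2)%:E <= (4^-1 ^+ k)%:E)%E.
    apply: (@le_trans _ _ (\int[mu]_(x in D) limn_einf (h^~ x))%E).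
      rewrite le_eqVlt; apply/orP; left; apply/eqP; apply: ae_eq_integral.
      - exact: mD.
      - exact/measurable_EFinP.
      - apply: (measurableT_comp (@oppe_measurable R setT)).
        apply: measurable_fun_limn_esup => j.
        exact: (measurableT_comp (@oppe_measurable R setT) (mh j)).
      move: cvf; apply: aeS => x hx Dx; apply/esym.
      have := hx Dx => cx; apply: (cvg_limn_einf_sup _).1.
      apply: cvg_EFin; first by apply: nearW.
      have c2 : s (nn (j + k)%N) x @[j --> \oo] --> f x.
        exact: (cvg_comp _ _ (cvg_addnr k) cx).
      have c3 : (s (nn (n + k)%N) x - s (nn k) x) @[n --> \oo] --> f x - s (nn k) x.
        by apply: cvgB => //; exact: cvg_cst.
      by rewrite /h /comp /=; under eq_fun do rewrite expr2; rewrite expr2; apply: cvgM.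
    apply: (le_trans (@fatou _ _ R mu D (mD l) h mh h0)).
    rewrite limn_einf_lim; apply: lime_le; first exact: is_cvg_einfs.
    apply: nearW => j; apply: (@le_trans _ _ (\int[mu]_(x in D) h j x)%E).
      by apply: ereal_inf_lbound; exists j => //=.
    rewrite /h intg_EFin; last first.
      by have [_] : sqi l (fun x => s (nn (j + k)%N) x - s (nn k) x) by exact: sqiB.
    rewrite lee_fin; apply: le_trans (tl k (nn (j + k)%N) (nnle _ _ (leq_addl _ _))).
    by rewrite le_eqVlt; apply/orP; left; apply/eqP; apply: eq_intg => x _; rewrite expr2.
  have i2 : intgble l (fun x => (f x - s (nn k) x) ^+ 2).
    apply/integrableP; split; first exact/measurable_EFinP.
    under eq_integral do rewrite gee0_abs ?lee_fin ?sqr_ge0 //.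
    exact: le_lt_trans le1 (ltry _).
  split; first by split => //; apply: measurable_funB => //; exact: sqi_meas.
  rewrite -lee_fin -intg_EFin; last by have := i2; congr intgble; apply/funext => x; rewrite expr2.
  by move: le1; under eq_integral do rewrite expr2.
have sf : sqi l f.
  have := sqiD (fat 0%N).1 (ss (nn 0%N)); congr sqi; apply/funext => x; ring.
have cf n : ip l f (en l n) = c n.
  have key k : (n < k)%N -> (ip l f (en l n) - c n) ^+ 2 <= 4^-1 ^+ k.
    move=> nk; have [h1 h2] := fat k; apply: le_trans h2.
    have := ip_cauchy_schwarz h1 (en_sqi l n); rewrite ip_en // eqxx mulr1.
    rewrite ipBl //; last exact: en_sqi.
    by rewrite [ip l (s _) _]ip_en_partial // (leq_trans nk (nnj k)).
  apply/eqP; rewrite -subr_eq0 -sqrf_eq0 eq_le sqr_ge0 andbT leNgt; apply/negP => p0.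
  have [k nk hk] := quarter_lt n.+1 p0.
  by have := le_lt_trans (key _ nk) hk; rewrite ltxx.
exists f; split => //; apply/ler_addgt0Pr => e e0.
have [k _ hk] := quarter_lt 0 e0.
have [_ h2] := fat k; have := partial_dist l0 (nn k) sf => /=.
under [X in ip l X X]eq_fun do under eq_bigr do rewrite cf.
under eq_bigr do rewrite cf.
move=> e1; move: h2; rewrite /s e1; have := hB (nn k); lra.
Qed.

Lemma ae_ip f g h : sqi l f -> sqi l g -> sqi l h ->
  (\forall x \ae mu, D x -> f x = g x) -> ip l f h = ip l g h.
Proof.
move=> hf hg hh fg; apply: ae_eq_intg.
- by apply: measurable_funM; exact: sqi_meas.
- by apply: measurable_funM; exact: sqi_meas.
by move: fg; apply: aeS => x e Dx /=; rewrite e.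
Qed.

Lemma coef_inj f g : sqi l f -> sqi l g -> (forall n, ip l f (en l n) = ip l g (en l n)) ->
  \forall x \ae mu, D x -> f x = g x.
Proof.
move=> hf hg fg.
have := @cos_complete _ _ l0 (fun x => f x - g x) (sqiB hf hg) _.
have h n : ip l (fun x => f x - g x) (cs l n) = 0.
  rewrite ipBl //; last exact: cs_sqi.
  have := fg n; rewrite !(ipZr (ec l n)) //; try exact: cs_sqi.
  by move=> /(mulfI (lt0r_neq0 (ec_gt0 l0 n))) ->; rewrite subrr.
move=> /(_ h); apply: aeS => x e Dx.
by apply/eqP; rewrite -subr_eq0 e.
Qed.

(** Bessel bounds the limit of the partial sums by the norm. Conversely, Riesz-Fischer with that
    limit as bound gives a function with the same coefficients and no larger norm, and completeness
    identifies it with [f]. *)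
Lemma parseval f : sqi l f ->
  \sum_(i < N) ip l f (en l i) ^+ 2 @[N --> \oo] --> ip l f f.
Proof.
move=> hf; pose u N := \sum_(i < N) ip l f (en l i) ^+ 2.
have hB N : u N <= ip l f f by exact: bessel.
have nd : nondecreasing_seq u.
  apply/nondecreasing_seqP => n; rewrite /u big_ord_recr /= lerDl; exact: sqr_ge0.
have cu : cvgn u by apply: nondecreasing_is_cvgn => //; exists (ip l f f) => _ [N _ <-].
have hB2 N : u N <= limn u by exact: nondecreasing_cvgn_le.
have [g [hg cg gB]] := @riesz_fischer (fun i => ip l f (en l i)) _ hB2.
suff <- : limn u = ip l f f by [].
apply/eqP; rewrite eq_le; apply/andP; split; first by apply: limr_le => //; exact: nearW.
have e := coef_inj hf hg (fun n => esym (cg n)).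
by rewrite (ae_ip hf hg hf e) ipC (ae_ip hf hg hg e).
Qed.

Lemma partial_cvg f : sqi l f ->
  let s N x := \sum_(i < N) ip l f (en l i) * en l i x in
  ip l (fun x => f x - s N x) (fun x => f x - s N x) @[N --> \oo] --> (0 : R).
Proof.
move=> hf s; have -> : (fun N => ip l (fun x => f x - s N x) (fun x => f x - s N x)) =
    (fun N => ip l f f - \sum_(i < N) ip l f (en l i) ^+ 2).
  by apply/funext => N; rewrite partial_dist.
have h := cvgB (cvg_cst (ip l f f)) (parseval hf).
by rewrite subrr in h; exact: h.
Qed.

Lemma parseval2 f g : sqi l f -> sqi l g ->
  \sum_(i < N) ip l f (en l i) * ip l g (en l i) @[N --> \oo] --> ip l f g.
Proof.
move=> hf hg; pose s N x := \sum_(i < N) ip l f (en l i) * en l i x.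
have ss N : sqi l (s N) by exact: (sqi_partial l (fun i => ip l f (en l i))).
have e N : ip l (s N) g = \sum_(i < N) ip l f (en l i) * ip l g (en l i).
  exact: (ip_partial (fun i => ip l f (en l i))).
have h N : (ip l f g - \sum_(i < N) ip l f (en l i) * ip l g (en l i)) ^+ 2 <=
   ip l (fun x => f x - s N x) (fun x => f x - s N x) * ip l g g.
  by rewrite -e -ipBl //; apply: ip_cauchy_schwarz => //; exact: sqiB.
have c0 : ip l (fun x => f x - s N x) (fun x => f x - s N x) * ip l g g @[N --> \oo] --> (0 : R).
  by rewrite -[X in _ --> X](mul0r (ip l g g)); apply: cvgM; [exact: partial_cvg|exact: cvg_cst].
apply/cvgrPdist_lt => eps e0.
have [N _ hN] := (cvgrPdist_lt _ _).1 c0 _ (exprn_gt0 2 e0).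
exists N => // n Nn; have := hN n Nn; rewrite sub0r normrN => hn.
rewrite -(@ltr_pXn2r _ 2) ?nnegrE ?(ltW e0) // real_normK ?num_real //.
exact: le_lt_trans (le_trans (h n) (ler_norm _)) hn.
Qed.

End RieszFischer.

(** * The explicit inverse *)

Section DoublePrimitive.
Variables (R : realType) (l : R).
Hypothesis l0 : 0 < l.
Local Notation mu := (@lebesgue_measure R).
Local Notation D := (itv0l l).
Implicit Types (f g h p F G : R -> R) (x y : R).

(** [dprim f] is the operator K of the overview: the solution of - u'' = f with u (0) = 0 and u' (l)
    = 0, whose derivative is [coprim f]. *)
Definition coprim f x := intg l f - prim l f x.
Definition dprim f := prim l (coprim f).

Lemma prim_sqi f : intgble l f -> sqi l (prim l f).
Proof. by move=> hf; apply: cont_sqi; exact: prim_cont. Qed.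

Lemma coprim_cont f : intgble l f -> {within `[0, l], continuous (coprim f)}.
Proof.
by move=> hf x; apply: cvgB; [exact: cvg_cst|exact: prim_cont].
Qed.

Lemma coprim_sqi f : intgble l f -> sqi l (coprim f).
Proof. by move=> hf; apply: cont_sqi; exact: coprim_cont. Qed.

Lemma dprim_cont f : intgble l f -> {within `[0, l], continuous (dprim f)}.
Proof. by move=> hf; apply: prim_cont => //; exact: sqi_intgble (coprim_sqi hf). Qed.

Lemma dprim_sqi f : intgble l f -> sqi l (dprim f).
Proof. by move=> hf; apply: cont_sqi; exact: dprim_cont. Qed.

Lemma ip_coprim f h : sqi l f -> sqi l h -> ip l (coprim f) h = ip l f (prim l h).
Proof.
move=> hf hh; have if_ := sqi_intgble hf; have ih := sqi_intgble hh.
have sp := prim_sqi if_; have sh := prim_sqi ih.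
have cl (c : R) p : intgble l p -> ip l (fun=> c) p = c * intg l p by exact: intgZ.
rewrite (ipBl (f := fun=> intg l f)) //; last exact: sqi_cst.
rewrite triangle_fubini // (ipBr (f := fun=> intg l h)) //; last exact: sqi_cst.
by rewrite (ipC _ f) !cl //; ring.
Qed.

(** [dprim] is [prim] after [coprim], and these two are adjoint to each other. *)
Lemma dprim_sym f h : sqi l f -> sqi l h -> ip l (dprim f) h = ip l f (dprim h).
Proof.
move=> hf hh; have if_ := sqi_intgble hf; have ih := sqi_intgble hh.
rewrite /dprim triangle_fubini //; last exact: sqi_intgble (coprim_sqi if_).
by rewrite ip_coprim //; exact: coprim_sqi.
Qed.

Lemma eq_prim f g x : (forall y, D y -> f y = g y) -> prim l f x = prim l g x.
Proof. by move=> fg; rewrite !primE; apply: eq_intg => t /fg ->. Qed.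

Lemma primZ c f x : intgble l f -> prim l (fun y => c * f y) x = c * prim l f x.
Proof.
move=> hf; rewrite !primE -intgZ; last exact: intgble_ind.
by apply: eq_intg => t _; rewrite mulrA.
Qed.

Lemma intgE_en0 f : sqi l f -> intg l f = Num.sqrt l * ip l f (en l 0).
Proof.
move=> hf; rewrite (ipZr (ec l 0)) //; last exact: cs_sqi.
have -> : ip l f (cs l 0) = intg l f by apply: eq_intg => x _; rewrite cs0E mulr1.
rewrite mulrA /ec /= mul1r sqrtrV ?(ltW l0) // divff ?mul1r //.
by rewrite gt_eqF // sqrtr_gt0.
Qed.

Lemma dprim_cs n x : 0 <= x <= l ->
  dprim (cs l n.+1) x = ((freq l n.+1) ^+ 2)^-1 * (cs l n.+1 x - 1).
Proof.
move=> hx; rewrite /dprim (@eq_prim _ (fun y => - (freq l n.+1)^-1 * sn l n.+1 y)); last first.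
  move=> y; rewrite /itv0l /= in_itv /= => /andP[y0 yl].
  by rewrite /coprim intg_cs //= mulr0n prim_cs // ?(ltW y0) ?(ltW yl) //; ring.
rewrite primZ; last exact: sqi_intgble (sn_sqi _ _).
by rewrite prim_sn //; field; exact: freqS_neq0.
Qed.

(** By symmetry this is the product of [f] with [dprim] of a cosine, which is [(cos - 1) / freq^2].
    The [- 1], forced by the vanishing at 0, is the coupling with mode 0, and [sqrt 2] is the ratio
    of the normalisations. *)
Lemma dprim_coef f n : sqi l f ->
  ip l (dprim f) (en l n.+1) =
  ((freq l n.+1) ^+ 2)^-1 * (ip l f (en l n.+1) - Num.sqrt 2 * ip l f (en l 0)).
Proof.
move=> hf; have cq k := cs_sqi l k.
rewrite (ipZr (ec l n.+1)) //; last by apply: dprim_sqi; exact: sqi_intgble.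
have -> : ip l (dprim f) (cs l n.+1) =
    ip l f (fun x => ((freq l n.+1) ^+ 2)^-1 * (cs l n.+1 x - cs l 0 x)).
  rewrite dprim_sym //; apply: eq_intg => x; rewrite /itv0l /= in_itv /= => /andP[x0 xl].
  by rewrite dprim_cs ?cs0E // (ltW x0) (ltW xl).
rewrite ipZr //; last exact: sqiB.
rewrite ipBr // mulrCA; congr (_ * _); rewrite (ipZr (ec l n.+1)) // mulrBr; congr (_ - _).
rewrite (ipZr (ec l 0)) // mulrA; congr (_ * _).
by rewrite /ec /= -sqrtrM // mulrA mulr1.
Qed.

Lemma dprim1 x : 0 <= x <= l -> dprim (fun=> 1) x = l * x - x ^+ 2 / 2.
Proof.
move=> hx.
have idx (y : R) : is_derive y 1 (fun z : R => z) 1 by exact: is_derive_id.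
have p1 y : 0 <= y <= l -> prim l (fun=> 1) y = y.
  by move=> hy; rewrite (prim_ftc idx _ hy) ?subr0 // => z; exact: cvg_cst.
rewrite /dprim (@eq_prim _ (fun y => l - y)); last first.
  move=> y; rewrite /itv0l /= in_itv /= => /andP[y0 yl].
  by rewrite /coprim intg_cst // mul1r p1 // (ltW y0) (ltW yl).
have dF (y : R) : is_derive y 1 (fun z : R => l * z - 2^-1 * z ^+ 2) (l - y).
  have h := is_deriveB (is_deriveZ l (idx y)) (is_deriveZ 2^-1 (is_deriveX 2 (idx y))).
  by apply: is_derive_eq h _; rewrite /GRing.scale /= expr1; field.
rewrite (prim_ftc dF _ hx) ?expr0n /=; first by ring.
by move=> z; apply: cvgB; [exact: cvg_cst|exact: cvg_id].
Qed.

Lemma dprim_en0 : ip l (dprim (en l 0)) (en l 0) = l ^+ 2 / 3.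
Proof.
have cq k := cs_sqi l k.
have s1 := sqi_cst l 1.
have e0 : forall x, D x -> en l 0 x = ec l 0 * 1 by move=> x _; rewrite /en cs0E.
have idx (y : R) : is_derive y 1 (fun z : R => z) 1 by exact: is_derive_id.
rewrite (ipZr (ec l 0)) //; last by apply: dprim_sqi; apply: sqi_intgble; exact: en_sqi.
rewrite dprim_sym ?(ipZl (ec l 0)) //; try exact: en_sqi; last first.
  by apply: dprim_sqi; exact: sqi_intgble.
have -> : ip l (cs l 0) (dprim (cs l 0)) = intg l (fun x => l * x - x ^+ 2 / 2).
  apply: eq_intg => x; rewrite /itv0l /= in_itv /= => /andP[x0 xl].
  have hx : 0 <= x <= l by rewrite (ltW x0) (ltW xl).
  rewrite cs0E mul1r -(dprim1 hx).
  apply: eq_prim => y _; rewrite /coprim; congr (_ - _).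
    by apply: eq_intg => t _; rewrite cs0E.
  by apply: eq_prim => t _; rewrite cs0E.
have dF (y : R) : is_derive y 1 (fun z : R => l / 2 * z ^+ 2 - 6^-1 * z ^+ 3) (l * y - y ^+ 2 / 2).
  have h := is_deriveB (is_deriveZ (l / 2) (is_deriveX 2 (idx y))) (is_deriveZ 6^-1 (is_deriveX 3 (idx y))).
  by apply: is_derive_eq h _; rewrite /GRing.scale /= expr1; field.
rewrite mulrA -expr2 ec_sq // (intg_ftc l0 dF); last first.
  move=> z; apply: cvgB; first by apply: cvgM; [exact: cvg_cst|exact: cvg_id].
  by apply: cvgM; [exact: exprn_continuous|exact: cvg_cst].
by rewrite !expr0n /=; field; rewrite gt_eqF.
Qed.

(** Row 0 of the matrix of [dprim] has infinitely many nonzero entries: expand the product of [f]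
    with [dprim (en l 0)] by Parseval and read the coefficients of the latter off [dprim_coef]. The
    diagonal entry is [l ^+ 2 / 3]. *)
Lemma dprim_coef0 f : sqi l f ->
  \sum_(i < N) (ip l f (en l i.+1) * (Num.sqrt 2 / (freq l i.+1) ^+ 2)) @[N --> \oo] -->
    l ^+ 2 / 3 * ip l f (en l 0) - ip l (dprim f) (en l 0).
Proof.
move=> hf; have eq0 := en_sqi l 0.
rewrite dprim_sym //.
have := parseval2 l0 hf (dprim_sqi (sqi_intgble eq0)).
have -> : (fun N => \sum_(i < N) (ip l f (en l i.+1) * (Num.sqrt 2 / freq l i.+1 ^+ 2))) =
  (fun N => l ^+ 2 / 3 * ip l f (en l 0) - \sum_(i < N.+1) ip l f (en l i) * ip l (dprim (en l 0)) (en l i)).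
  apply/funext => N; rewrite big_ord_recl dprim_en0 [X in _ - (X + _)]mulrC opprD addrA subrr sub0r -sumrN.
  apply: eq_bigr => i _; rewrite lift0 dprim_coef // !ip_en //= mulr1 sub0r; ring.
move=> h; apply: cvgB; first exact: cvg_cst.
by rewrite -(cvg_shiftS (fun N => \sum_(i < N) ip l f (en l i) * ip l (dprim (en l 0)) (en l i))) in h.
Qed.

End DoublePrimitive.

(** * Weak derivatives and continuous representatives *)

Section WeakDerivative.
Variables (R : realType) (l : R).
Hypothesis l0 : 0 < l.
Local Notation mu := (@lebesgue_measure R).
Local Notation D := (itv0l l).
Implicit Types (f g h p F G phi : R -> R) (x y : R).

Lemma test_function_ftc phi : test_function l phi ->
  [/\ forall x : R, is_derive x 1 phi (derive1 phi x), continuous (derive1 phi), phi 0 = 0 & phi l = 0].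
Proof.
move=> [dphi cphi [K cK [KD K0]]]; split => //.
- by move=> x; apply: DeriveDef => //; rewrite derive1E.
- by apply: K0 => /KD; rewrite /itv0l /= in_itv /= ltxx.
- by apply: K0 => /KD; rewrite /itv0l /= in_itv /= ltxx andbF.
Qed.

Lemma weak_derivative_prim c f : sqi l f ->
  weak_derivative_real l (fun x => c + prim l f x) f.
Proof.
move=> sf; have hf := sqi_intgble sf => phi /test_function_ftc[dphi cphi phi0 phil].
have iphi := cont_intgble l cphi.
have sphi : sqi l (derive1 phi) by apply: cont_sqi; exact: cont_within.
change (ip l (fun x => c + prim l f x) (derive1 phi) = - ip l f phi).
rewrite (ipDl (f := fun=> c)) //; [|exact: sqi_cst|exact: prim_sqi].
have -> : ip l (fun=> c) (derive1 phi) = 0.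
  by rewrite /ip intgZ // (intg_ftc l0 dphi) // phil phi0 subrr mulr0.
rewrite add0r triangle_fubini // (intg_ftc l0 dphi) // phil phi0 subr0.
have sphi2 : sqi l phi by apply: cont_sqi; apply: cont_within; exact: derive_cont dphi.
rewrite /ip -intgN; last exact: sqi_mul.
apply: eq_intg => x; rewrite /itv0l /= in_itv /= => /andP[x0 xl].
by rewrite (prim_ftc dphi) ?(ltW x0) ?(ltW xl) // phi0; ring.
Qed.

Lemma prim_vanish f x : (forall y, 0 < y <= x -> f y = 0) -> prim l f x = 0.
Proof.
move=> hf; rewrite primE (eq_intg (g := fun=> 0)); first by rewrite intg_cst // mul0r.
move=> t; rewrite /itv0l /= in_itv /= => /andP[t0 tl].
by case: (leP t x) => tx; rewrite ?mulr0 // hf ?mul0r // t0 tx.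
Qed.

Lemma prim_vanish_r f x : (forall y, x < y < l -> f y = 0) -> prim l f x = intg l f.
Proof.
move=> hf; rewrite primE; apply: eq_intg => t; rewrite /itv0l /= in_itv /= => /andP[t0 tl].
by case: (leP t x) => tx; rewrite ?mulr1 // hf ?mul0r // tx tl.
Qed.

(** Where [k] vanishes its primitive is constant: 0 on the left, and on the right the integral of
    [k], which is 0 too. So the primitive has compact support. *)
Lemma prim_test_function k d : continuous k -> 0 < d ->
  (forall x, ~~ (d <= x <= l - d) -> k x = 0) -> intg l k = 0 ->
  test_function l (prim l k) /\ derive1 (prim l k) = k.
Proof.
move=> ck d0 kz ik.
have ik' := cont_intgble l ck.
have zl x : x < d -> prim l k x = 0.
  move=> xd; apply: prim_vanish => y /andP[_ yx]; apply: kz.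
  by rewrite leNgt (le_lt_trans yx xd).
have zr x : l - d < x -> prim l k x = 0.
  move=> xd; rewrite prim_vanish_r ?ik // => y /andP[xy _]; apply: kz.
  by rewrite negb_and -!ltNge (lt_trans xd xy) orbT.
have dk (x : R) : is_derive x 1 (prim l k) (k x).
  have [/andP[x0 xl]|xD] := boolP (0 < x < l).
    by apply: prim_derive => //; [rewrite /itv0l /= in_itv /= x0 xl|exact: ck].
  have zz : \forall y \near x, cst 0 y = prim l k y.
    have [xd|dx] := ltP x d.
      by near=> y; rewrite zl //; near: y; exact: lt_nbhsl.
    have lx : l - d < x.
      move: xD; rewrite negb_and -!leNgt => /orP[|]; move: d0 dx; lra.
    by near=> y; rewrite zr //; near: y; exact: lt_nbhsr.
  have -> : k x = 0.
    apply: kz; apply/negP => /andP[h1 h2]; move: xD; rewrite negb_and -!leNgt => /orP[|]; move: d0 h1 h2; lra.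
  apply: (near_eq_is_derive _ (is_derive_cst 0 x 1)) => //; exact: oner_neq0.
have e : derive1 (prim l k) = k by apply/funext => x; rewrite derive1E; have [_ ->] := dk x.
split=> //; split.
- by move=> x; have [] := dk x.
- by rewrite e.
exists `[d, l - d]%classic; first exact: segment_compact.
split.
  by move=> x; rewrite /itv0l /= !in_itv /= => /andP[h1 h2]; move: d0; lra.
move=> x; rewrite /= in_itv /= => /negP; rewrite negb_and -!ltNge => /orP[/zl|/zr] //.
Unshelve. all: by end_near. Qed.

(** A trapezoid, 0 outside [[d, l - d]] and 1 on [[2 * d, l - 2 * d]]. Continuity is enough, since
    test functions are obtained as primitives. *)
Definition cutoff (d x : R) : R := Num.min 1 (Num.max 0 (Num.min (x - d) (l - d - x) / d)).

Lemma cutoff_cont d : continuous (cutoff d).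
Proof.
move=> x.
have c1 : {for x, continuous (fun z : R => (z - d : R^o))} by apply: cvgB; [exact: cvg_id|exact: cvg_cst].
have c2 : {for x, continuous (fun z : R => (l - d - z : R^o))} by apply: cvgB; [exact: cvg_cst|exact: cvg_id].
have c3 : {for x, continuous (fun z : R => (Num.min (z - d) (l - d - z) / d : R^o))}.
  by apply: cvgM; [exact: (continuous_min c1 c2)|exact: cvg_cst].
have k0 : {for x, continuous (fun z : R => (0 : R^o))} by exact: cvg_cst.
have k1 : {for x, continuous (fun z : R => (1 : R^o))} by exact: cvg_cst.
exact: (continuous_min k1 (continuous_max k0 c3)).
Qed.

Lemma cutoff_out d x : 0 < d -> ~~ (d <= x <= l - d) -> cutoff d x = 0.
Proof.
move=> d0 hx; rewrite /cutoff.
have h : Num.min (x - d) (l - d - x) / d <= 0.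
  rewrite ler_pdivrMr // mul0r ge_min; move: hx; rewrite negb_and -!ltNge => /orP[|] h; apply/orP; [left|right]; lra.
by rewrite (max_idPl h) (min_idPr ler01).
Qed.

Lemma cutoff_bnd d x : 0 <= cutoff d x <= 1.
Proof. by rewrite /cutoff le_min ler01 le_max lexx /= ge_min lexx. Qed.

Lemma cutoff_in d x : 0 < d -> 2 * d <= x <= l - 2 * d -> cutoff d x = 1.
Proof.
move=> d0 /andP[h1 h2]; rewrite /cutoff.
have h : 1 <= Num.min (x - d) (l - d - x) / d.
  by rewrite ler_pdivlMr // mul1r le_min; apply/andP; split; lra.
by rewrite (max_idPr (le_trans ler01 h)) (min_idPl h).
Qed.

Lemma dominated_intg (f_ : nat -> R -> R) f g : (forall n, measurable_fun D (f_ n)) ->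
  measurable_fun D f -> intgble l g ->
  (forall n x, D x -> `|f_ n x| <= g x) -> (forall x, D x -> f_ n x @[n --> \oo] --> f x) ->
  intg l (f_ n) @[n --> \oo] --> intg l f.
Proof.
move=> mf_ mf ig fg cv.
have if_ n : intgble l (f_ n) by exact: intgble_le (mf_ n) (fg n) ig.
have [iff_ _ h] : [/\ mu.-integrable D (EFin \o f),
  [sequence \int[mu]_(x in D) `|(f_ n x)%:E - (f x)%:E|]_n%E @ \oo --> 0%E &
  [sequence \int[mu]_(x in D) (f_ n x)%:E]_n%E @ \oo --> (\int[mu]_(x in D) (f x)%:E)%E].
  apply: (@dominated_convergence _ _ R mu D (mD l) (fun n x => (f_ n x)%:E)
    (fun x => (f x)%:E) (fun x => (g x)%:E)).
  - by move=> n; apply/measurable_EFinP; exact: mf_.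
  - exact/measurable_EFinP.
  - by apply: aeW => x Dx; apply: cvg_EFin; [exact: nearW|exact: cv].
  - exact: ig.
  - by apply: aeW => x n Dx; rewrite /= lee_fin fg.
by move: h; rewrite (intg_EFin iff_) => /fine_cvg.
Qed.

(** Test with the primitive of the combination of [u * cutoff] and [cutoff] that has mean zero, then
    let the width of the cutoff tend to 0. The outcome says that [w] minus its mean is orthogonal to
    [u]. *)
Lemma du_bois_reymond_aux w u : sqi l w -> continuous u ->
  (forall phi, test_function l phi -> ip l w (derive1 phi) = 0) ->
  ip l w u * l = intg l w * intg l u.
Proof.
move=> sw cu hw.
pose d j : R := j.+1%:R^-1.
have d0 j : 0 < d j by rewrite invr_gt0 ltr0n.
have cj j : continuous (cutoff (d j)) by exact: cutoff_cont.
have cuj j : continuous (fun x => u x * cutoff (d j) x).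
  by move=> x; apply: cvgM; [exact: cu|exact: cj].
have su v : continuous v -> sqi l v by move=> cv; apply: cont_sqi; exact: cont_within.
have lim v : intgble l v -> intg l (fun x => v x * cutoff (d j) x) @[j --> \oo] --> intg l v.
  move=> iv; apply: (@dominated_intg _ _ (fun x => `|v x|)).
  - move=> j; apply: measurable_funM; first exact: intgble_meas.
    by apply: sqi_meas; exact: su.
  - exact: intgble_meas.
  - exact: intgble_norm.
  - move=> j x _; rewrite normrM ler_piMr //.
    by have /andP[a1 a2] := cutoff_bnd (d j) x; rewrite ger0_norm.
  move=> x; rewrite /itv0l /= in_itv /= => /andP[x0 xl].
  apply: cvg_near_cst; near=> j; rewrite cutoff_in ?mulr1 //.
  have h : 2 * d j <= Num.min x (l - x).
    rewrite mulrC -ler_pdivlMr // ltW //; near: j.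
    have m0 : 0 < Num.min x (l - x) / 2 by rewrite divr_gt0 // lt_min x0 subr_gt0 xl.
    exact: (near_infty_natSinv_lt (PosNum m0)).
  by move: h; rewrite le_min => /andP[h1 h2]; apply/andP; split; lra.
have swu : intgble l (fun x => w x * u x) by apply: sqi_mul => //; exact: su.
have key j : ip l w (fun x => u x * cutoff (d j) x) * intg l (cutoff (d j)) =
   ip l w (cutoff (d j)) * intg l (fun x => u x * cutoff (d j) x).
  pose c1 := intg l (cutoff (d j)); pose c2 := intg l (fun x => u x * cutoff (d j) x).
  pose k x := c1 * (u x * cutoff (d j) x) - c2 * cutoff (d j) x.
  have ck : continuous k.
    by move=> x; apply: cvgB; apply: cvgM; try exact: cvg_cst; [exact: cuj|exact: cj].
  have kz x : ~~ (d j <= x <= l - d j) -> k x = 0.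
    by move=> hx; rewrite /k cutoff_out // !mulr0 subrr.
  have ik : intg l k = 0.
    rewrite /k intgB; try by apply: intgbleZ; apply: cont_intgble.
    rewrite !intgZ; try exact: cont_intgble.
    by rewrite mulrC subrr.
  have [tk dk] := prim_test_function ck (d0 j) kz ik.
  have := hw _ tk; rewrite dk /k ipBr //; try by apply: sqiZ; exact: su.
  rewrite !ipZr //; try exact: su.
  by move/eqP; rewrite subr_eq0 => /eqP; rewrite mulrC => ->; rewrite mulrC.
have l1 := lim _ swu; have l2 := lim _ (intgble_cst l 1).
have l3 := lim _ (sqi_intgble sw); have l4 := lim _ (cont_intgble l cu).
have e1 := cvgM l1 l2; have e2 := cvgM l3 l4.
have E : (fun j => intg l (fun x => w x * u x * cutoff (d j) x)) \* (fun j => intg l (fun x => 1 * cutoff (d j) x)) =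
   (fun j => intg l (fun x => w x * cutoff (d j) x)) \* (fun j => intg l (fun x => u x * cutoff (d j) x)).
  apply/funext => j /=; rewrite -[RHS]key /ip; congr (_ * _); apply: eq_intg => x _; ring.
have e3 : intg l (fun x => w x * u x) * intg l (fun=> 1) = intg l w * intg l u.
  apply: (cvg_unique _ (e1 _)); first exact: Rhausdorff.
  by rewrite E; exact: (e2 _).
by move: e3; rewrite intg_cst // mul1r.
Unshelve. all: by end_near. Qed.

(** The difference [f - prim l f1] has weak derivative 0, so it has the same products with all
    cosines as its mean, and completeness makes it constant. *)
Lemma weak_derivative_unique f f1 : sqi l f -> sqi l f1 -> weak_derivative_real l f f1 ->
  exists c, \forall x \ae mu, D x -> f x = c + prim l f1 x.
Proof.
move=> sf sf1 wd; have i1 := sqi_intgble sf1; have sp := prim_sqi l0 i1.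
pose w x := f x - prim l f1 x.
have sw : sqi l w by exact: sqiB.
have hw phi : test_function l phi -> ip l w (derive1 phi) = 0.
  move=> tp; have [dphi cphi _ _] := test_function_ftc tp.
  have sphi : sqi l (derive1 phi) by apply: cont_sqi; exact: cont_within.
  have e1 : ip l f (derive1 phi) = - intg l (fun x => f1 x * phi x) := wd _ tp.
  have e2 : ip l (fun x => 0 + prim l f1 x) (derive1 phi) = - intg l (fun x => f1 x * phi x).
    exact: (weak_derivative_prim 0 sf1 tp).
  have e3 : ip l (prim l f1) (derive1 phi) = - intg l (fun x => f1 x * phi x).
    by rewrite -e2; apply: eq_intg => x _; rewrite add0r.
  by rewrite /w ipBl // e1 e3 subrr.
pose m := intg l w / l; exists m.
have smc : sqi l (fun=> m) by exact: sqi_cst.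
have lw u : continuous u -> ip l w u = ip l (fun=> m) u.
  move=> cu; have := du_bois_reymond_aux sw cu hw.
  rewrite [ip l (fun=> m) u]intgZ; last exact: cont_intgble.
  rewrite /m => h; apply: (mulIf (lt0r_neq0 l0)); rewrite h.
  by rewrite mulrAC divfK // gt_eqF.
have := coef_inj l0 sw smc (fun n => lw _ (@en_cont _ _ n)).
by apply: aeS => x h Dx; rewrite -(h Dx) /w subrK.
Qed.

(** Inside, the difference is the derivative of its own primitive, which vanishes identically; the
    end points follow by one-sided limits. This makes traces independent of the chosen continuous
    representative. *)
Lemma cont_ae_eq f g : {within `[0, l], continuous f} -> {within `[0, l], continuous g} ->
  (\forall x \ae mu, D x -> f x = g x) -> forall x, 0 <= x <= l -> f x = g x.
Proof.
move=> cf cg fg.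
have inner x : D x -> f x = g x.
  move=> Dx; pose h y := f y - g y.
  have ch : {within `[0, l], continuous h} by move=> y; apply: cvgB; [exact: cf|exact: cg].
  have ih : intgble l h by apply: sqi_intgble; exact: cont_sqi.
  have ph y : prim l h y = 0.
    rewrite primE (@ae_eq_intg _ _ _ (fun=> 0)) ?intg_cst ?mul0r //.
    - by apply: intgble_meas; exact: intgble_ind.
    - move: fg; apply: aeS => z e Dz; by rewrite /h e // subrr mul0r.
  have dh := prim_derive ih Dx (within_cont_interior l0 ch Dx).
  have := const_derive Dx (fun y _ => ph y) dh.
  by move/eqP; rewrite subr_eq0 => /eqP.
have [_ f0 fl] := (continuous_within_itvP f l0).1 cf.
have [_ g0 gl] := (continuous_within_itvP g l0).1 cg.
move=> x /andP[]; rewrite le_eqVlt => /orP[/eqP <- _|x0].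
  apply: (cvg_unique _ f0); first exact: Rhausdorff.
  apply: cvg_trans g0; apply: near_eq_cvg; near=> y.
  apply/esym/inner; rewrite /itv0l /= in_itv /=; apply/andP; split.
    by near: y; exact: nbhs_right_gt.
  by near: y; exact: nbhs_right_lt.
rewrite le_eqVlt => /orP[/eqP ->|xl]; last by apply: inner; rewrite /itv0l /= in_itv /= x0.
apply: (cvg_unique _ fl); first exact: Rhausdorff.
apply: cvg_trans gl; apply: near_eq_cvg; near=> y.
apply/esym/inner; rewrite /itv0l /= in_itv /=; apply/andP; split.
  by near: y; exact: nbhs_left_gt.
by near: y; exact: nbhs_left_lt.
Unshelve. all: by end_near. Qed.

End WeakDerivative.

(** * The equation integrated explicitly *)

Section ExplicitResolvent.
Variables (R : realType) (l a b : R).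
Hypotheses (l0 : 0 < l) (b0 : b != 0).
Local Notation mu := (@lebesgue_measure R).
Local Notation D := (itv0l l).
Local Notation C := R[i].
Local Notation vfun := (R -> 'cV[C]_2).
Implicit Types (U V F : vfun).

Lemma aeI (P Q : R -> Prop) : (\forall x \ae mu, P x) -> (\forall x \ae mu, Q x) ->
  \forall x \ae mu, P x /\ Q x.
Proof.
move=> hP hQ.
exact: (@filterI _ _ (@ae_filter_ringOfSetsType _ (measurableTypeR R) R mu) _ _ hP hQ).
Qed.

Lemma aeT (P : R -> Prop) : (forall x, P x) -> \forall x \ae mu, P x.
Proof. by move=> h; exact: aeW. Qed.

(** The boolean selects the real or the imaginary part, so that one statement covers all four real
    coordinates. *)
Definition crd (r : bool) U (j : 'I_2) : R -> R :=
  if r then re_coord U j else im_coord U j.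

Definition vcrd (r : bool) (v : 'cV[C]_2) (j : 'I_2) : R :=
  if r then complex.Re (v j 0) else complex.Im (v j 0).

Lemma vcrd0 r j : vcrd r 0 j = 0.
Proof. by rewrite /vcrd mxE; case: r. Qed.

Lemma vcrdN r v j : vcrd r (- v) j = - vcrd r v j.
Proof. by rewrite /vcrd mxE; case: (v j 0) => ? ?; case: r. Qed.

Lemma crdE r U j x : crd r U j x = vcrd r (U x) j.
Proof. by case: r. Qed.

Definition mkv (f : bool -> 'I_2 -> R -> R) : vfun :=
  fun x => \col_j (f true j x +i* f false j x)%C.

Lemma crd_mkv f r j : crd r (mkv f) j = f r j.
Proof. by case: r; apply/funext => x; rewrite /crd /re_coord /im_coord mxE. Qed.

Lemma crd_inj (U V : vfun) x : (forall r j, crd r U j x = crd r V j x) -> U x = V x.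
Proof.
move=> h; apply/matrixP => j k; rewrite ord1.
have := h true j; have := h false j; rewrite /crd /re_coord /im_coord.
by case: (U x j 0) (V x j 0) => [? ?] [? ?] /= -> ->.
Qed.

Lemma inL2P U : inL2 l U <-> forall r j, sqi l (crd r U j).
Proof.
split => [h r j|h j]; first by have [h1 h2] := h j; case: r.
by split; [exact: (h true j)|exact: (h false j)].
Qed.

Lemma eqL2P U V : eqL2 l U V <->
  forall r j, \forall x \ae mu, D x -> crd r U j x = crd r V j x.
Proof.
split=> [h r j|h].
  by apply: aeS h => x h Dx; rewrite !crdE (h Dx).
have h1 := aeI (aeI (h true 0) (h true 1)) (aeI (h false 0) (h false 1)).
apply: aeS h1 => x [[h1 h2] [h3 h4]] Dx; apply: crd_inj => r j.
have [->|->] : j = 0 \/ j = 1 by case: j => [[|[|//]] p]; [left|right]; apply/val_inj.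
  by case: r; [exact: h1|exact: h3].
by case: r; [exact: h2|exact: h4].
Qed.

Lemma eqL2_sym U V : eqL2 l U V -> eqL2 l V U.
Proof. by apply: aeS => x h Dx; rewrite h. Qed.

Lemma weak_derivativeP U V : weak_derivative l U V <->
  forall r j, weak_derivative_real l (crd r U j) (crd r V j).
Proof.
split => [h r j|h j]; first by have [h1 h2] := h j; case: r.
by split; [exact: (h true j)|exact: (h false j)].
Qed.

Lemma weak_derivative_ae f g h : sqi l f -> sqi l g ->
  (\forall x \ae mu, D x -> f x = g x) -> weak_derivative_real l f h ->
  weak_derivative_real l g h.
Proof.
move=> sf sg fg wd phi tp; rewrite -(wd _ tp).
have [dphi cphi _ _] := test_function_ftc tp.
have sphi : sqi l (derive1 phi) by apply: cont_sqi; exact: cont_within.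
by apply: (@ae_ip _ _ g f) => //; apply: aeS fg => x e Dx; rewrite e.
Qed.

Lemma trace_atP U x v : trace_at l U x v <-> exists Uc : vfun,
    [/\ forall r j, {within `[0, l], continuous (crd r Uc j)}, eqL2 l Uc U & Uc x = v].
Proof.
split=> -[Uc [h1 h2 h3]]; exists Uc; split => //.
  by move=> r j; have [c1 c2] := h1 j; case: r.
by move=> j; split; [exact: (h1 true j)|exact: (h1 false j)].
Qed.

Definition vmean F : 'cV[C]_2 := \col_j (intg l (crd true F j) +i* intg l (crd false F j))%C.
(** The value U (0): integrating F gives U' (0) = [vmean F], and the condition at 0 is solved for U
    (0). *)
Definition resu0 F : 'cV[C]_2 := 'i%C *: (invmx (Mab a b) *m vmean F).
Definition resolvent0 F : vfun :=
  mkv (fun r j x => vcrd r (resu0 F) j + dprim l (crd r F j) x).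

Lemma vcrd_inj v w : (forall r j, vcrd r v j = vcrd r w j) -> v = w.
Proof.
move=> h; apply/matrixP => j k; rewrite ord1.
have := h true j; have := h false j; rewrite /vcrd.
by case: (v j 0) (w j 0) => [? ?] [? ?] /= -> ->.
Qed.

Lemma vcrd_mean F r j : vcrd r (vmean F) j = intg l (crd r F j).
Proof. by rewrite /vcrd mxE; case: r. Qed.

Lemma Mab_unit : Mab a b \in unitmx.
Proof.
pose N : 'M[C]_2 := \matrix_(j, k)
    (nth 0 (nth [::] [:: [:: 0; - b^-1]; [:: b^-1; a / b ^+ 2]] j) k)%:C%C.
suff /mulmx1_unit[] : Mab a b *m N = 1%:M by [].
apply/matrixP => i j; rewrite !mxE !big_ord_recl big_ord0 !mxE addr0.
have bC (x y z w : R) : x%:C%C * y%:C%C + z%:C%C * w%:C%C = (x * y + z * w)%:C%C :> C.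
  by rewrite rmorphD !rmorphM.
case: i => [[|[|//]] i]; case: j => [[|[|//]] j]; rewrite /= bC -(rmorph_nat (real_complex R));
  congr (_%:C)%C => /=; by field.
Qed.

Lemma resolvent0_inL2 F : inL2 l F -> inL2 l (resolvent0 F).
Proof.
move=> /inL2P hF; apply/inL2P => r j; rewrite /resolvent0 crd_mkv.
by apply: sqiD; [exact: sqi_cst|apply: dprim_sqi => //; exact: sqi_intgble].
Qed.

Lemma resolvent0_cont F r j : inL2 l F -> {within `[0, l], continuous (crd r (resolvent0 F) j)}.
Proof.
move=> /inL2P hF; rewrite /resolvent0 crd_mkv => x.
by apply: cvgD; [exact: cvg_cst|apply: dprim_cont => //; exact: sqi_intgble].
Qed.

Lemma bc_solve (u v : 'cV[C]_2) : v + 'i%C *: (Mab a b *m u) = 0 <->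
  u = 'i%C *: (invmx (Mab a b) *m v).
Proof.
have ii : 'i%C * 'i%C = -1 :> C by rewrite -expr2 sqr_i.
split.
  move/eqP; rewrite addr_eq0 => /eqP ->.
  rewrite mulmxN -scalemxAr mulKmx ?Mab_unit // scalerN scalerA ii scaleN1r opprK //.
move=> ->; rewrite -scalemxAr mulKVmx ?Mab_unit // scalerA ii scaleN1r subrr //.
Qed.

(** From the domain to the formula: weak derivatives turn U1 and U into primitives up to constants;
    the trace at [l] fixes the first constant as the mean of F, and the condition at 0 the second as
    [resu0 F]. Conversely [coprim] of F and - F serve as the two derivatives. *)
Lemma TabP U F : Tab l a b U F <-> [/\ inL2 l F, inL2 l U & eqL2 l U (resolvent0 F)].
Proof.
split.
  move=> [hF [U1 [U2 [[hU hU1 hU2 wU wU1] [u0 [v0 [t0 t1 bc]]] tl FU2]]]].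
  split=> //.
  have sF := (inL2P F).1 hF; have sU := (inL2P U).1 hU.
  have sU1 := (inL2P U1).1 hU1; have sU2 := (inL2P U2).1 hU2.
  have w1 := (weak_derivativeP U U1).1 wU; have w2 := (weak_derivativeP U1 U2).1 wU1.
  have [Uc [cUc eUc Uc0]] := (trace_atP U 0 u0).1 t0.
  have [Vc [cVc eVc Vc0]] := (trace_atP U1 0 v0).1 t1.
  have [Wc [cWc eWc Wcl]] := (trace_atP U1 l 0).1 tl.
  have L0 : (0 : R) <= 0 <= l by rewrite lexx ltW.
  have Ll : 0 <= l <= l by rewrite lexx ltW.
  have main r j : vcrd r v0 j = intg l (crd r F j) /\
     (\forall x \ae mu, D x -> crd r U j x = vcrd r u0 j + dprim l (crd r F j) x).
    have iF := sqi_intgble (sF r j).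
    have i1 := sqi_intgble (sU1 r j). have i2 := sqi_intgble (sU2 r j).
    have [c hc] := weak_derivative_unique l0 (sU r j) (sU1 r j) (w1 r j).
    have [c1 hc1] := weak_derivative_unique l0 (sU1 r j) (sU2 r j) (w2 r j).
    have cp f d : intgble l f -> {within `[0, l], continuous (fun x => d + prim l f x)}.
      by move=> hf x; apply: cvgD; [exact: cvg_cst|exact: prim_cont].
    have F2 : \forall x \ae mu, D x -> crd r F j x = - crd r U2 j x.
      by apply: aeS FU2 => x e Dx; rewrite !crdE e // vcrdN.
    have pf x : prim l (crd r U2 j) x = - prim l (crd r F j) x.
      rewrite -mulN1r -primZ // !primE; apply: ae_eq_intg.
      - by apply: intgble_meas; exact: intgble_ind.
      - by apply: intgble_meas; apply: intgble_ind; exact: intgbleZ.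
      - by apply: aeS F2 => y e Dy; rewrite e // mulN1r opprK.
    have hW : crd r Wc j l = c1 + prim l (crd r U2 j) l.
      apply: (cont_ae_eq l0 (cWc r j) (cp _ c1 i2) _ Ll).
      have := aeI ((eqL2P Wc U1).1 eWc r j) hc1; apply: aeS => x [e1 e2] Dx.
      by rewrite e1 // e2.
    have hV : crd r Vc j 0 = c1 + prim l (crd r U2 j) 0.
      apply: (cont_ae_eq l0 (cVc r j) (cp _ c1 i2) _ L0).
      have := aeI ((eqL2P Vc U1).1 eVc r j) hc1; apply: aeS => x [e1 e2] Dx.
      by rewrite e1 // e2.
    have hU' : crd r Uc j 0 = c + prim l (crd r U1 j) 0.
      apply: (cont_ae_eq l0 (cUc r j) (cp _ c i1) _ L0).
      have := aeI ((eqL2P Uc U).1 eUc r j) hc; apply: aeS => x [e1 e2] Dx.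
      by rewrite e1 // e2.
    have c1E : c1 = intg l (crd r F j).
      move: hW; rewrite pf priml crdE Wcl vcrd0.
      by move=> /esym/eqP; rewrite subr_eq0 => /eqP.
    have cE : c = vcrd r u0 j by move: hU'; rewrite prim0 addr0 crdE Uc0.
    split; first by move: hV; rewrite prim0 addr0 crdE Vc0 c1E.
    have dp x : prim l (crd r U1 j) x = dprim l (crd r F j) x.
      rewrite /dprim !primE; apply: ae_eq_intg.
      - by apply: intgble_meas; exact: intgble_ind.
      - apply: intgble_meas; apply: intgble_ind; apply: sqi_intgble; exact: coprim_sqi.
      - by apply: aeS hc1 => y e Dy; rewrite e // pf c1E.
    by apply: aeS hc => x e Dx; rewrite e // dp cE.
  have v0E : v0 = vmean F.
    by apply: vcrd_inj => r j; rewrite vcrd_mean; have [] := main r j.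
  have u0E : u0 = resu0 F by move/bc_solve: bc; rewrite v0E.
  apply/eqL2P => r j; rewrite /resolvent0 crd_mkv -u0E.
  by have [] := main r j.
move=> [hF hU eU]; split=> //.
have sF := (inL2P F).1 hF; have sU := (inL2P U).1 hU.
pose U1 := mkv (fun r j => coprim l (crd r F j)).
pose U2 := mkv (fun r j x => - crd r F j x).
have iF r j := sqi_intgble (sF r j).
have sU1 r j : sqi l (crd r U1 j) by rewrite /U1 crd_mkv; exact: coprim_sqi.
have sU2 r j : sqi l (crd r U2 j) by rewrite /U2 crd_mkv; exact: sqiN.
have sRes := (inL2P _).1 (resolvent0_inL2 hF).
exists U1, U2; split.
- split=> //; try exact/inL2P.
  + apply/weak_derivativeP => r j; apply: (weak_derivative_ae (sRes r j) (sU r j)).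
      by have := (eqL2P _ _).1 eU r j; apply: aeS => x e Dx; rewrite e.
    rewrite /resolvent0 /U1 !crd_mkv; apply: weak_derivative_prim => //.
    exact: coprim_sqi.
  + apply/weak_derivativeP => r j; rewrite /U1 /U2 !crd_mkv.
    have -> : coprim l (crd r F j) = (fun x => intg l (crd r F j) + prim l (fun x => - crd r F j x) x).
      apply/funext => x; rewrite /coprim; congr (_ + _); rewrite !primE -intgN; last exact: intgble_ind.
      by apply: eq_intg => y _; rewrite mulNr.
    by apply: weak_derivative_prim => //; exact: sqiN.
- exists (resu0 F), (vmean F); split.
  + apply/trace_atP; exists (resolvent0 F); split.
    * by move=> r j; exact: resolvent0_cont.
    * exact: eqL2_sym.
    * apply: vcrd_inj => r j; rewrite -crdE /resolvent0 crd_mkv.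
      by rewrite /dprim prim0 addr0.
  + apply/trace_atP; exists U1; split.
    * by move=> r j; rewrite /U1 crd_mkv; exact: coprim_cont.
    * by apply: aeT.
    * by apply: vcrd_inj => r j; rewrite -crdE /U1 crd_mkv vcrd_mean /coprim prim0 subr0.
  + exact/bc_solve.
- apply/trace_atP; exists U1; split.
  + by move=> r j; rewrite /U1 crd_mkv; exact: coprim_cont.
  + by apply: aeT.
  + apply: vcrd_inj => r j; rewrite -crdE /U1 crd_mkv /coprim priml // subrr.
    by rewrite vcrd0.
apply: aeT => x Dx; apply: vcrd_inj => r j; rewrite vcrdN -!crdE.
by rewrite /U2 crd_mkv opprK.
Qed.

End ExplicitResolvent.

(** * Complex ell^2 and its bounded operators *)

Section ComplexNorm.
Variable R : realType.
Local Notation C := R[i].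
Local Notation nc := (@Normc.normc R).
Implicit Types (z w : C).

Lemma nc_ge0 z : 0 <= nc z.
Proof. by case: z => x y /=; exact: sqrtr_ge0. Qed.

Lemma nc_sq z : nc z ^+ 2 = complex.Re z ^+ 2 + complex.Im z ^+ 2.
Proof. by case: z => x y /=; rewrite sqr_sqrtr // addr_ge0 // sqr_ge0. Qed.

Lemma nc0 : nc 0 = 0. Proof. exact: Normc.normc0. Qed.
Lemma nc1 : nc 1 = 1. Proof. exact: Normc.normc1. Qed.
Lemma nc_eq0 z : nc z = 0 -> z = 0. Proof. exact: Normc.eq0_normc. Qed.
Lemma ncM z w : nc (z * w) = nc z * nc w. Proof. exact: Normc.normcM. Qed.
Lemma ncV z : nc z^-1 = (nc z)^-1. Proof. exact: Normc.normcV. Qed.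
Lemma ncN z : nc (- z) = nc z. Proof. exact: normcN. Qed.
Lemma ncD z w : nc (z + w) <= nc z + nc w. Proof. exact: le_normcD. Qed.
Lemma ncB z w : nc (z - w) <= nc z + nc w. Proof. by rewrite -[nc w]ncN ncD. Qed.
Lemma ncC z w : nc (z - w) = nc (w - z). Proof. by rewrite -ncN opprB. Qed.

Lemma ncR (x : R) : nc (x%:C)%C = `|x|.
Proof. by rewrite /= expr0n addr0 sqrtr_sqr. Qed.

Lemma nc_gt0 z : z != 0 -> 0 < nc z.
Proof.
by move=> z0; rewrite lt_def nc_ge0 andbT; apply/eqP => /nc_eq0 /eqP; apply/negP.
Qed.

Lemma nc_Re z : `|complex.Re z| <= nc z.
Proof.
rewrite -(@ler_pXn2r _ 2) ?nnegrE ?nc_ge0 // real_normK ?num_real // nc_sq lerDl.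
exact: sqr_ge0.
Qed.

Lemma nc_Im z : `|complex.Im z| <= nc z.
Proof.
rewrite -(@ler_pXn2r _ 2) ?nnegrE ?nc_ge0 // real_normK ?num_real // nc_sq lerDr.
exact: sqr_ge0.
Qed.

Lemma nc_sum n (z : nat -> C) : nc (\sum_(i < n) z i) <= \sum_(i < n) nc (z i).
Proof.
elim: n => [|n IH]; first by rewrite !big_ord0 nc0.
by rewrite !big_ord_recr /= (le_trans (ncD _ _)) // lerD2r.
Qed.

Lemma ReD z w : complex.Re (z + w) = complex.Re z + complex.Re w.
Proof. by case: z w => [? ?] [? ?]. Qed.
Lemma ImD z w : complex.Im (z + w) = complex.Im z + complex.Im w.
Proof. by case: z w => [? ?] [? ?]. Qed.
Lemma ReN z : complex.Re (- z) = - complex.Re z.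
Proof. by case: z. Qed.
Lemma ImN z : complex.Im (- z) = - complex.Im z.
Proof. by case: z. Qed.

Lemma Re_sum n (z : nat -> C) : complex.Re (\sum_(i < n) z i) = \sum_(i < n) complex.Re (z i).
Proof.
elim: n => [|n IH]; first by rewrite !big_ord0.
by rewrite !big_ord_recr /= ReD IH.
Qed.

Lemma Im_sum n (z : nat -> C) : complex.Im (\sum_(i < n) z i) = \sum_(i < n) complex.Im (z i).
Proof.
elim: n => [|n IH]; first by rewrite !big_ord0.
by rewrite !big_ord_recr /= ImD IH.
Qed.

(** Convergence of both real coordinates, so that real limit theorems apply directly. *)
Definition ccvg (u : nat -> C) (z : C) : Prop :=
  complex.Re (u n) @[n --> \oo] --> complex.Re z /\
  complex.Im (u n) @[n --> \oo] --> complex.Im z.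

Lemma ccvg_unique u z w : ccvg u z -> ccvg u w -> z = w.
Proof.
move=> [a1 a2] [b1 b2].
have e1 : complex.Re z = complex.Re w by apply: (cvg_unique _ a1 b1); exact: Rhausdorff.
have e2 : complex.Im z = complex.Im w by apply: (cvg_unique _ a2 b2); exact: Rhausdorff.
by move: e1 e2; case: z w {a1 a2 b1 b2} => [? ?] [? ?] /= -> ->.
Qed.

Lemma ccvgD u v z w : ccvg u z -> ccvg v w -> ccvg (fun n => u n + v n) (z + w).
Proof.
move=> [a1 a2] [b1 b2]; split; rewrite ?ReD ?ImD.
  by under eq_fun do rewrite ReD; apply: cvgD.
by under eq_fun do rewrite ImD; apply: cvgD.
Qed.

Lemma Re_mul z w : complex.Re (z * w) = complex.Re z * complex.Re w - complex.Im z * complex.Im w.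
Proof. by case: z w => [? ?] [? ?]. Qed.
Lemma Im_mul z w : complex.Im (z * w) = complex.Re z * complex.Im w + complex.Im z * complex.Re w.
Proof. by case: z w => [? ?] [? ?] /=; rewrite addrC; congr (_ + _); rewrite mulrC. Qed.

Lemma ccvgZ c u z : ccvg u z -> ccvg (fun n => c * u n) (c * z).
Proof.
move=> [a1 a2]; split; rewrite ?Re_mul ?Im_mul.
  under eq_fun do rewrite Re_mul.
  by apply: cvgB; apply: cvgM => //; exact: cvg_cst.
under eq_fun do rewrite Im_mul.
by apply: cvgD; apply: cvgM => //; exact: cvg_cst.
Qed.

Lemma ccvg_cst z : ccvg (fun=> z) z.
Proof. by split; exact: cvg_cst. Qed.

Lemma ccvg_shift N u z : ccvg (fun n => u (n + N)%N) z -> ccvg u z.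
Proof.
move=> [a1 a2]; split.
  by rewrite -(cvg_shiftn N (fun n => complex.Re (u n))).
by rewrite -(cvg_shiftn N (fun n => complex.Im (u n))).
Qed.

Lemma ccvg_nc2 u z : ccvg u z -> nc (u n) ^+ 2 @[n --> \oo] --> nc z ^+ 2.
Proof.
move=> [a1 a2]; rewrite nc_sq; under eq_fun do rewrite nc_sq.
by rewrite !expr2; under eq_fun do rewrite !expr2; apply: cvgD; apply: cvgM.
Qed.

Lemma ccvg_le u z M : ccvg u z -> (forall n, nc (u n) <= M) -> nc z <= M.
Proof.
move=> cu hM; have M0 : 0 <= M by apply: le_trans (hM 0%N); exact: nc_ge0.
rewrite -(@ler_pXn2r _ 2) ?nnegrE ?nc_ge0 //.
have h := ccvg_nc2 cu.
have <- : limn (fun n => nc (u n) ^+ 2) = nc z ^+ 2 by apply/cvg_lim; [exact: Rhausdorff|exact: h].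
apply: limr_le; first exact: cvgP h.
by apply: nearW => n; rewrite ler_pXn2r ?nnegrE ?nc_ge0.
Qed.

Lemma geo_cvg (u : nat -> R) c q : 0 <= q < 1 ->
  (forall n, `|u n.+1 - u n| <= c * q ^+ n) -> cvgn u.
Proof.
move=> /andP[q0 q1] hu.
have c0 : 0 <= c by have := le_trans (normr_ge0 _) (hu 0%N); rewrite expr0 mulr1.
have q1' : 0 < 1 - q by rewrite subr_gt0.
have cs : cvgn (series (telescope u)).
  apply: normed_cvg; apply: nondecreasing_is_cvgn.
    move=> m n mn; rewrite -subr_ge0 sub_series_geq //.
    by apply: sumr_ge0 => i _; exact: normr_ge0.
  exists (c / (1 - q)) => _ [N _ <-]; rewrite /normed_series_of seriesEord /=.
  apply: (@le_trans _ _ (\sum_(i < N) c * q ^+ i)).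
    by apply: ler_sum => i _; exact: hu.
  rewrite -mulr_sumr ler_wpM2l // -[_^-1]mul1r ler_pdivlMr //.
  have -> : (\sum_(i < N) q ^+ i) * (1 - q) = 1 - q ^+ N.
    by rewrite mulrC -opprB mulNr -subrX1 opprB.
  by rewrite gerBl exprn_ge0.
have -> : u = (fun n => u 0%N + series (telescope u) n).
  by apply/funext => n; rewrite (eq_sum_telescope u n).
by apply: is_cvgD => //; exact: is_cvg_cst.
Qed.

Lemma cgeo_cvg (u : nat -> C) c q : 0 <= q < 1 ->
  (forall n, nc (u n.+1 - u n) <= c * q ^+ n) -> exists z, ccvg u z.
Proof.
move=> hq hu.
have h1 : cvgn (fun n => complex.Re (u n)).
  apply: (geo_cvg hq) => n; apply: le_trans (hu n).
  by rewrite -ReN -ReD nc_Re.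
have h2 : cvgn (fun n => complex.Im (u n)).
  apply: (geo_cvg hq) => n; apply: le_trans (hu n).
  by rewrite -ImN -ImD nc_Im.
exists (limn (fun n => complex.Re (u n)) +i* limn (fun n => complex.Im (u n)))%C.
by split.
Qed.

Definition summ (u : nat -> C) : Prop := exists M, forall n, \sum_(i < n) nc (u i) <= M.
Definition csum (u : nat -> C) : C :=
  (limn (fun n => \sum_(i < n) complex.Re (u i)) +i* limn (fun n => \sum_(i < n) complex.Im (u i)))%C.

Lemma abs_sum_cvg (u : nat -> R) M : (forall n, \sum_(i < n) `|u i| <= M) ->
  cvgn (fun n => \sum_(i < n) u i).
Proof.
move=> hM; have -> : (fun n => \sum_(i < n) u i) = series u.
  by apply/funext => n; rewrite /series /= big_mkord.
apply: normed_cvg; apply: nondecreasing_is_cvgn.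
  move=> m n mn; rewrite -subr_ge0 sub_series_geq //.
  by apply: sumr_ge0 => i _; exact: normr_ge0.
by exists M => _ [N _ <-]; rewrite /normed_series_of seriesEord /=; exact: hM.
Qed.

Lemma csumP u : summ u -> ccvg (fun n => \sum_(i < n) u i) (csum u).
Proof.
move=> [M hM].
have h1 : cvgn (fun n => \sum_(i < n) complex.Re (u i)).
  apply: (@abs_sum_cvg (fun i => complex.Re (u i)) M) => n; apply: le_trans (hM n).
  by apply: ler_sum => i _; exact: nc_Re.
have h2 : cvgn (fun n => \sum_(i < n) complex.Im (u i)).
  apply: (@abs_sum_cvg (fun i => complex.Im (u i)) M) => n; apply: le_trans (hM n).
  by apply: ler_sum => i _; exact: nc_Im.
split; first by under eq_fun do rewrite Re_sum; exact: h1.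
by under eq_fun do rewrite Im_sum; exact: h2.
Qed.

Lemma summD u v : summ u -> summ v -> summ (fun n => u n + v n).
Proof.
move=> [M hM] [N hN]; exists (M + N) => n.
apply: le_trans (lerD (hM n) (hN n)); rewrite -big_split /=.
by apply: ler_sum => i _; exact: ncD.
Qed.

Lemma summZ c u : summ u -> summ (fun n => c * u n).
Proof.
move=> [M hM]; exists (nc c * M) => n.
apply: (@le_trans _ _ (nc c * \sum_(i < n) nc (u i))); last by rewrite ler_wpM2l // nc_ge0.
by rewrite mulr_sumr; apply: ler_sum => i _; rewrite ncM.
Qed.

Lemma csumD u v : summ u -> summ v -> csum (fun n => u n + v n) = csum u + csum v.
Proof.
move=> su sv; apply: (ccvg_unique (csumP (summD su sv))).
have := ccvgD (csumP su) (csumP sv).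
by congr ccvg; apply/funext => n; rewrite big_split.
Qed.

Lemma csumZ c u : summ u -> csum (fun n => c * u n) = c * csum u.
Proof.
move=> su; apply: (ccvg_unique (csumP (summZ c su))).
have := ccvgZ c (csumP su).
by congr ccvg; apply/funext => n; rewrite mulr_sumr.
Qed.

Lemma csum_le u M : summ u -> (forall n, nc (\sum_(i < n) u i) <= M) -> nc (csum u) <= M.
Proof. by move=> su; exact: ccvg_le (csumP su). Qed.

Lemma csum_le_abs (u : nat -> C) M : (forall n, \sum_(i < n) nc (u i) <= M) -> nc (csum u) <= M.
Proof.
move=> hM; apply: csum_le; first by exists M.
by move=> n; exact: le_trans (nc_sum _ _) (hM n).
Qed.

Lemma sum_single n k (z : C) : (k < n)%N -> \sum_(i < n) (if (i == k :> nat) then z else 0) = z.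
Proof.
move=> kn; rewrite -big_mkcond /= (big_pred1 (Ordinal kn)) //.
Qed.

Lemma csum_single k z : summ (fun i => if i == k then z else 0) /\
  csum (fun i => if i == k then z else 0) = z.
Proof.
have s : summ (fun i => if i == k then z else 0).
  exists (nc z) => n; case: (ltnP k n) => h.
    rewrite (bigD1 (Ordinal h)) //= eqxx big1 ?addr0 // => i /negbTE.
    by rewrite -val_eqE /= => ->; rewrite nc0.
  rewrite big1 ?nc_ge0 // => i _; case: eqP => [ik|_]; last by rewrite nc0.
  by move: (ltn_ord i); rewrite ik ltnNge h.
split=> //; apply: (ccvg_unique (csumP s)).
apply: (@ccvg_shift k.+1); have := ccvg_cst z; congr ccvg; apply/funext => n.
by rewrite sum_single // addnS ltnS leq_addl.
Qed.

End ComplexNorm.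

(** * The space ell^2 and its completeness *)

Section Ell2Space.
Variable R : realType.
Local Notation C := R[i].
Local Notation nc := (@Normc.normc R).

Definition sqbnd (u : nat -> C) (M : R) : Prop := forall n, \sum_(i < n) nc (u i) ^+ 2 <= M.

Lemma ell2P (u : nat -> C) : ell2 u <-> exists M, sqbnd u M.
Proof.
have nd : {homo series (fun k => nc (u k) ^+ 2) : n m / (n <= m)%N >-> n <= m}.
  move=> m n mn; rewrite -subr_ge0 sub_series_geq //.
  by apply: sumr_ge0 => i _; exact: sqr_ge0.
split=> [h|[M hM]].
  exists (limn (series (fun k => nc (u k) ^+ 2))) => n.
  by have := nondecreasing_cvgn_le nd h n; rewrite seriesEord.
apply: nondecreasing_is_cvgn => //; exists M => _ [n _ <-].
by rewrite seriesEord; exact: hM.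
Qed.

Lemma sum_nc2_ge0 n (u : nat -> C) : 0 <= \sum_(i < n) nc (u i) ^+ 2.
Proof. by apply: sumr_ge0 => i _; exact: sqr_ge0. Qed.

Lemma norm_ell2_ge0 (u : nat -> C) : 0 <= norm_ell2 u.
Proof. exact: sqrtr_ge0. Qed.

Lemma norm_ell2_sq (u : nat -> C) : ell2 u -> sqbnd u (norm_ell2 u ^+ 2).
Proof.
move=> h n.
have nd : {homo series (fun k => nc (u k) ^+ 2) : n m / (n <= m)%N >-> n <= m}.
  move=> p q pq; rewrite -subr_ge0 sub_series_geq //.
  by apply: sumr_ge0 => i _; exact: sqr_ge0.
have hl := nondecreasing_cvgn_le nd h.
rewrite sqr_sqrtr; first by have := hl n; rewrite seriesEord.
by have := hl 0%N; rewrite seriesEord /= big_ord0.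
Qed.

Lemma norm_ell2_le (u : nat -> C) M : 0 <= M -> sqbnd u (M ^+ 2) -> norm_ell2 u <= M.
Proof.
move=> M0 hM; have h : ell2 u by apply/ell2P; exists (M ^+ 2).
rewrite -[M]sqrtr_sqr_ge0 // || rewrite -[M]ger0_norm // -sqrtr_sqr.
rewrite ler_wsqrtr //; apply: limr_le => //; apply: nearW => n.
by rewrite seriesEord; exact: hM.
Qed.

Lemma sum_cs n (p q : nat -> R) :
  (\sum_(i < n) p i * q i) ^+ 2 <= (\sum_(i < n) p i ^+ 2) * (\sum_(i < n) q i ^+ 2).
Proof.
set A := \sum_(i < n) p i ^+ 2; set B := \sum_(i < n) q i ^+ 2; set P := \sum_(i < n) _.
have A0 : 0 <= A by apply: sumr_ge0 => i _; exact: sqr_ge0.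
have key t : 0 <= A * t ^+ 2 - 2 * t * P + B.
  have -> : A * t ^+ 2 - 2 * t * P + B = \sum_(i < n) (t * p i - q i) ^+ 2.
    rewrite /A /B /P mulr_suml mulr_sumr -sumrB -big_split /=.
    by apply: eq_bigr => i _; ring.
  by apply: sumr_ge0 => i _; exact: sqr_ge0.
have B0 : 0 <= B by apply: sumr_ge0 => i _; exact: sqr_ge0.
have [A00|An0] := eqVneq A 0.
  rewrite A00 mul0r; have [->|n0] := eqVneq P 0; first by rewrite expr0n.
  have := key ((B + 1) / (2 * P)).
  rewrite A00 mul0r add0r; set X := (X in 0 <= - X + _).
  have -> : X = B + 1 by rewrite /X; field.
  by lra.
have Ap : 0 < A by rewrite lt_def An0.
have := key (P / A).
set X := (X in 0 <= X -> _).
have -> : X = (A * B - P ^+ 2) / A by rewrite /X; field.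
by rewrite pmulr_lge0 ?invr_gt0 // subr_ge0.
Qed.

Lemma sqbndD u v M N : 0 <= M -> 0 <= N -> sqbnd u (M ^+ 2) -> sqbnd v (N ^+ 2) ->
  sqbnd (fun n => u n + v n) ((M + N) ^+ 2).
Proof.
move=> M0 N0 hM hN n.
have cs := sum_cs n (fun i => nc (u i)) (fun i => nc (v i)).
have P0 : 0 <= \sum_(i < n) nc (u i) * nc (v i).
  by apply: sumr_ge0 => i _; rewrite mulr_ge0 // nc_ge0.
have P1 : \sum_(i < n) nc (u i) * nc (v i) <= M * N.
  rewrite -(@ler_pXn2r _ 2) ?nnegrE ?mulr_ge0 // (le_trans cs) // exprMn.
  by apply: ler_pM; rewrite ?sum_nc2_ge0.
apply: (@le_trans _ _ (\sum_(i < n) (nc (u i) + nc (v i)) ^+ 2)).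
  apply: ler_sum => i _; rewrite ler_pXn2r ?nnegrE ?addr_ge0 ?nc_ge0 //; exact: ncD.
have -> : \sum_(i < n) (nc (u i) + nc (v i)) ^+ 2 = \sum_(i < n) nc (u i) ^+ 2 +
    2 * (\sum_(i < n) nc (u i) * nc (v i)) + \sum_(i < n) nc (v i) ^+ 2.
  by rewrite mulr_sumr -!big_split /=; apply: eq_bigr => i _; ring.
have := hM n; have := hN n; rewrite sqrrD; lra.
Qed.

Definition ell2b : {pred nat -> C^o} := fun u => `[< ell2 u >].

Lemma ell2_submod_closed : submod_closed ell2b.
Proof.
split.
  rewrite unfold_in; apply/asboolP/ell2P; exists 0 => n.
  by rewrite big1 // => i _; rewrite nc0 expr0n.
move=> c u v; rewrite !unfold_in => /asboolP hu /asboolP hv; apply/asboolP/ell2P.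
exists ((nc c * norm_ell2 u + norm_ell2 v) ^+ 2).
have h : sqbnd (fun n => c * u n) ((nc c * norm_ell2 u) ^+ 2).
  move=> n; under eq_bigr do rewrite ncM exprMn.
  rewrite -mulr_sumr exprMn ler_wpM2l ?sqr_ge0 //; exact: norm_ell2_sq.
apply: (sqbndD _ _ h (norm_ell2_sq hv)); last exact: norm_ell2_ge0.
by rewrite mulr_ge0 ?nc_ge0 ?norm_ell2_ge0.
Qed.

HB.instance Definition _ := GRing.isSubmodClosed.Build C (nat -> C^o) ell2b ell2_submod_closed.

Record ell2T := Ell2 { ell2_val :> nat -> C^o; _ : ell2_val \in ell2b }.
HB.instance Definition _ := [isSub for ell2_val].
HB.instance Definition _ := [Choice of ell2T by <:].
HB.instance Definition _ := [SubChoice_isSubLmodule of ell2T by <:].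

Local Notation H := ell2T.
Implicit Types (x y : H).

Definition nm x : R := norm_ell2 x.

Lemma HE x y : (forall n, x n = y n) -> x = y.
Proof. by move=> h; apply/val_inj/funext. Qed.

Lemma HD x y n : (x + y) n = x n + y n. Proof. by []. Qed.
Lemma HN x n : (- x) n = - x n. Proof. by []. Qed.
Lemma HB_ x y n : (x - y) n = x n - y n. Proof. by []. Qed.
Lemma HZ c x n : (c *: x) n = c * x n. Proof. by []. Qed.
Lemma H0 n : (0 : H) n = 0. Proof. by []. Qed.

Lemma H_ell2 x : ell2 x.
Proof. by case: x => u /= h; move: (h); rewrite unfold_in => /asboolP. Qed.

Definition mkH (u : nat -> C) (hu : ell2 u) : H := @Ell2 u (asboolT hu).

Lemma nm_ge0 x : 0 <= nm x. Proof. exact: norm_ell2_ge0. Qed.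
Lemma nm_sq x : sqbnd x (nm x ^+ 2). Proof. by apply: norm_ell2_sq; exact: H_ell2. Qed.
Lemma nm_le x M : 0 <= M -> sqbnd x (M ^+ 2) -> nm x <= M. Proof. exact: norm_ell2_le. Qed.

Lemma nmD x y : nm (x + y) <= nm x + nm y.
Proof.
apply: nm_le; first by rewrite addr_ge0 ?nm_ge0.
by apply: sqbndD; rewrite ?nm_ge0 //; exact: nm_sq.
Qed.

Lemma nm_coord x n : nc (x n) <= nm x.
Proof.
rewrite -(@ler_pXn2r _ 2) ?nnegrE ?nc_ge0 ?nm_ge0 //.
apply: le_trans (nm_sq x n.+1); rewrite big_ord_recr /= lerDr; exact: sum_nc2_ge0.
Qed.

Lemma nm0 : nm 0 = 0.
Proof.
apply/eqP; rewrite eq_le nm_ge0 andbT; apply: nm_le => // n.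
by rewrite big1 ?expr0n // => i _; rewrite H0 nc0 expr0n.
Qed.

Lemma nm_eq0 x : nm x = 0 -> x = 0.
Proof.
move=> h; apply: HE => n; apply: nc_eq0; apply/eqP; rewrite eq_le nc_ge0 andbT.
by rewrite -h nm_coord.
Qed.

Lemma nmZ_le c x : nm (c *: x) <= nc c * nm x.
Proof.
apply: nm_le; first by rewrite mulr_ge0 ?nc_ge0 ?nm_ge0.
move=> n; under eq_bigr do rewrite HZ ncM exprMn.
by rewrite -mulr_sumr exprMn ler_wpM2l ?sqr_ge0 //; exact: nm_sq.
Qed.

Lemma nmN x : nm (- x) = nm x.
Proof.
by congr Num.sqrt; congr (limn (series _)); apply/funext => n; rewrite HN ncN.
Qed.

Lemma nmB x y : nm (x - y) <= nm x + nm y.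
Proof. by rewrite -[nm y]nmN nmD. Qed.

Lemma nm_subC x y : nm (x - y) = nm (y - x).
Proof. by rewrite -nmN opprB. Qed.

Lemma nm_triangle z x y : nm (x - y) <= nm (x - z) + nm (z - y).
Proof. by apply: le_trans (nmD _ _); rewrite addrA subrK. Qed.

Lemma nm_small x : (forall e, 0 < e -> nm x <= e) -> x = 0.
Proof.
move=> h; apply: nm_eq0; apply/eqP; rewrite eq_le nm_ge0 andbT.
by apply/ler_addgt0Pr => e e0; rewrite add0r h.
Qed.

Lemma sum_nc2_cvg N (u : nat -> nat -> C) (z : nat -> C) M :
  (forall k, ccvg (u^~ k) (z k)) -> (forall n, \sum_(k < N) nc (u n k) ^+ 2 <= M) ->
  \sum_(k < N) nc (z k) ^+ 2 <= M.
Proof.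
move=> cu hM.
have h : \sum_(k < N) nc (u n k) ^+ 2 @[n --> \oo] --> \sum_(k < N) nc (z k) ^+ 2.
  elim: N {hM} => [|N IH]; first by under eq_fun do rewrite big_ord0; rewrite big_ord0; exact: cvg_cst.
  rewrite big_ord_recr /=; under eq_fun do rewrite big_ord_recr /=.
  apply: cvgD; [exact: IH|exact: ccvg_nc2 (cu N)].
have <- : limn (fun n => \sum_(k < N) nc (u n k) ^+ 2) = \sum_(k < N) nc (z k) ^+ 2.
  by apply/cvg_lim; [exact: Rhausdorff|exact: h].
by apply: limr_le; [exact: cvgP h|exact: nearW].
Qed.

(** The limit is taken coordinatewise, and the bounds on finite sums pass to it. Geometric
    increments are all that the iterations below produce, and they come with an explicit error at
    each step. *)
Lemma H_complete (x : nat -> H) c q : 0 <= q < 1 ->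
  (forall n, nm (x n.+1 - x n) <= c * q ^+ n) ->
  exists y, forall n, nm (y - x n) <= c / (1 - q) * q ^+ n.
Proof.
move=> hq hx; have /andP[q0 q1] := hq.
have c0 : 0 <= c by have := le_trans (nm_ge0 _) (hx 0%N); rewrite expr0 mulr1.
have q1' : 0 < 1 - q by rewrite subr_gt0.
have /choice[y hy] k : exists z, ccvg (fun n => x n k) z.
  apply: (@cgeo_cvg _ _ c q hq) => n; apply: le_trans (hx n); rewrite -HB_; exact: nm_coord.
have dist n m : nm (x (n + m)%N - x n) <= c / (1 - q) * q ^+ n * (1 - q ^+ m).
  elim: m => [|m IH]; first by rewrite addn0 subrr nm0 expr0 subrr mulr0.
  apply: (le_trans (nm_triangle (x (n + m)%N) _ _)); rewrite addnS.
  apply: (le_trans (lerD (hx _) IH)); rewrite le_eqVlt; apply/orP; left; apply/eqP.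
  by rewrite exprD exprS; field; rewrite gt_eqF.
have d0 n : 0 <= c / (1 - q) * q ^+ n.
  by rewrite mulr_ge0 ?exprn_ge0 // divr_ge0 // ltW.
have dist' n m : nm (x (n + m)%N - x n) <= c / (1 - q) * q ^+ n.
  by rewrite (le_trans (dist n m)) // ler_piMr // gerBl exprn_ge0.
have bnd n : sqbnd (fun k => y k - x n k) ((c / (1 - q) * q ^+ n) ^+ 2).
  move=> N; apply: (@sum_nc2_cvg N (fun m k => x (n + m)%N k - x n k) (fun k => y k - x n k)).
    move=> k; apply: ccvgD; last exact: ccvg_cst.
    have [h1 h2] := hy k; split.
      by under eq_fun do rewrite addnC; exact: (cvg_comp _ _ (cvg_addnr n) h1).
    by under eq_fun do rewrite addnC; exact: (cvg_comp _ _ (cvg_addnr n) h2).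
  move=> m; apply: (le_trans (nm_sq (x (n + m)%N - x n) N)).
  by rewrite ler_pXn2r ?nnegrE ?nm_ge0 ?d0 // dist'.
have ey : ell2 y.
  apply/ell2P; exists ((c / (1 - q) * q ^+ 0 + nm (x 0%N)) ^+ 2).
  have := sqbndD (d0 0%N) (nm_ge0 (x 0%N)) (bnd 0%N) (nm_sq _).
  by congr sqbnd; apply/funext => k; rewrite subrK.
exists (mkH ey) => n; apply: nm_le; [exact: d0|exact: bnd].
Qed.

End Ell2Space.

Arguments ell2_val : simpl never.

(** * Bounded operators, tail spaces and Neumann series *)

Section Operators.
Variable R : realType.
Local Notation C := R[i].
Local Notation nc := (@Normc.normc R).
Local Notation H := (ell2T R).
Implicit Types (x y : H) (A L Q : H -> H).

Lemma mkHE (u : nat -> C) (hu : ell2 u) n : mkH hu n = u n.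
Proof. by []. Qed.

Definition delta (n : nat) : H.
Proof.
refine (@mkH R (fun i => if i == n then 1 else 0) _).
apply/ell2P; exists 1 => m; case: (ltnP n m) => h.
  rewrite (bigD1 (Ordinal h)) //= eqxx nc1 expr1n big1 ?addr0 // => i /negbTE.
  by rewrite -val_eqE /= => ->; rewrite nc0 expr0n.
rewrite big1 ?ler01 // => i _; case: eqP => [im|_]; last by rewrite nc0 expr0n.
by move: (ltn_ord i); rewrite im ltnNge h.
Defined.

Lemma deltaE n i : delta n i = (if i == n then 1 else 0). Proof. by []. Qed.
Lemma delta_same n : delta n n = 1. Proof. by rewrite deltaE eqxx. Qed.

Lemma delta_neq0 n : delta n != 0.
Proof.
by apply/eqP => h; have := delta_same n; rewrite h H0 => /eqP; rewrite eq_sym oner_eq0.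
Qed.

(** The closed span of the basis vectors of index at least [N]: these spaces form the flag that a
    lower triangular operator preserves. *)
Definition tail (N : nat) (x : H) : Prop := forall n, (n < N)%N -> x n = 0.

Lemma tailD N x y : tail N x -> tail N y -> tail N (x + y).
Proof. by move=> hx hy n nN; rewrite HD hx // hy // addr0. Qed.
Lemma tailZ N c x : tail N x -> tail N (c *: x).
Proof. by move=> hx n nN; rewrite HZ hx // mulr0. Qed.
Lemma tailB N x y : tail N x -> tail N y -> tail N (x - y).
Proof. by move=> hx hy n nN; rewrite HB_ hx // hy // subr0. Qed.
Lemma tail_le M N x : (M <= N)%N -> tail N x -> tail M x.
Proof. by move=> MN hx n nM; apply: hx; exact: leq_trans MN. Qed.
Lemma tail_delta N n : (N <= n)%N -> tail N (delta n).
Proof. by move=> Nn i iN; rewrite deltaE ltn_eqF // (leq_trans iN). Qed.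
Lemma tail_split N x : tail N x -> tail N.+1 (x - x N *: delta N).
Proof.
move=> hx n; rewrite ltnS leq_eqVlt HB_ HZ deltaE => /orP[/eqP ->|nN].
  by rewrite eqxx mulr1 subrr.
by rewrite ltn_eqF // mulr0 subr0 hx.
Qed.

Definition trunc (N : nat) (x : H) : H := \sum_(i < N) x i *: delta i.

Lemma sumH n (z : nat -> H) k : (\sum_(i < n) z i) k = \sum_(i < n) z i k.
Proof. by elim: n => [|n IH]; rewrite ?big_ord0 ?H0 // !big_ord_recr /= HD IH. Qed.

Lemma truncE N x n : trunc N x n = if (n < N)%N then x n else 0.
Proof.
rewrite /trunc (sumH N (fun i => x i *: delta i)).
case: ltnP => h.
  rewrite (bigD1 (Ordinal h)) //= HZ delta_same mulr1 big1 ?addr0 // => i /negbTE.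
  by rewrite -val_eqE /= HZ deltaE eq_sym => ->; rewrite mulr0.
rewrite big1 // => i _; rewrite HZ deltaE; case: eqP => [ni|_]; last by rewrite mulr0.
by move: (ltn_ord i); rewrite -ni ltnNge h.
Qed.

Lemma tail_trunc N x : tail N (x - trunc N x).
Proof. by move=> n nN; rewrite HB_ truncE nN subrr. Qed.

Lemma sqbnd_tail (u : nat -> R) M : (forall i, 0 <= u i) -> (forall n, \sum_(i < n) u i <= M) ->
  forall e, 0 < e -> exists N, forall p q, (N <= p)%N -> \sum_(p <= i < q) u i <= e.
Proof.
move=> u0 hM e e0.
have nd : {homo series u : n m / (n <= m)%N >-> n <= m}.
  move=> p q pq; rewrite -subr_ge0 sub_series_geq //.
  by apply: sumr_ge0 => i _; exact: u0.
have cv : cvgn (series u).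
  apply: nondecreasing_is_cvgn => //; exists M => _ [n _ <-].
  by rewrite seriesEord; exact: hM.
have /cvgrPdist_lt/(_ e e0)[N _ hN] := cv.
exists N => p q Np; have [pq|/ltnW qp] := leqP p q; last by rewrite big_geq // ltW.
rewrite -(sub_series_geq u pq); have := hN p Np; rewrite /= ltr_norml => /andP[_ h].
by have := nondecreasing_cvgn_le nd cv q; lra.
Qed.

Lemma trunc_cvg x e : 0 < e -> exists N, forall n, (N <= n)%N -> nm (x - trunc n x) <= e.
Proof.
move=> e0.
have [N hN] := @sqbnd_tail (fun i => nc (x i) ^+ 2) _ (fun i => sqr_ge0 _) (nm_sq x)
  (e ^+ 2) (exprn_gt0 2 e0).
exists N => n Nn; apply: nm_le; first exact: ltW.
move=> m; apply: le_trans (hN n m Nn).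
rewrite -(big_mkord xpredT (fun i => nc ((x - trunc n x) i) ^+ 2)).
have [mn|/ltnW nm'] := leqP m n.
  rewrite big_nat big1; last by move=> i /= im; rewrite tail_trunc ?(leq_trans im) // nc0 expr0n.
  by apply: sumr_ge0 => i _; exact: sqr_ge0.
rewrite (big_cat_nat (n := n)) //= big_nat big1 ?add0r.
  rewrite le_eqVlt; apply/orP; left; apply/eqP.
  by apply: eq_big_nat => i /andP[ni _]; rewrite HB_ truncE ltnNge ni subr0.
by move=> i /= im; rewrite tail_trunc // nc0 expr0n.
Qed.

Definition blin A : Prop :=
  (forall c x y, A (c *: x + y) = c *: A x + A y) /\
  exists2 K, 0 < K & forall x, nm (A x) <= K * nm x.

Lemma blin0 A : blin A -> A 0 = 0.
Proof.
move=> [h _]; have := h 1 0 0; rewrite !scale1r addr0 => e.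
by apply/eqP; have /eqP := e; rewrite -subr_eq0 opprD addrA subrr add0r oppr_eq0.
Qed.
Lemma blinD A x y : blin A -> A (x + y) = A x + A y.
Proof. by move=> [h _]; have := h 1 x y; rewrite !scale1r. Qed.
Lemma blinZ A c x : blin A -> A (c *: x) = c *: A x.
Proof. by move=> h; have := h.1 c x 0; rewrite !addr0 blin0 // addr0. Qed.
Lemma blinN A x : blin A -> A (- x) = - A x.
Proof. by move=> h; rewrite -scaleN1r blinZ // scaleN1r. Qed.
Lemma blinB A x y : blin A -> A (x - y) = A x - A y.
Proof. by move=> h; rewrite blinD // blinN. Qed.
Lemma blin_sum A n (z : nat -> H) : blin A -> A (\sum_(i < n) z i) = \sum_(i < n) A (z i).
Proof.
by move=> h; elim: n => [|n IH]; rewrite ?big_ord0 ?blin0 // !big_ord_recr /= blinD // IH.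
Qed.

Lemma nm_sum n (z : nat -> H) : nm (\sum_(i < n) z i) <= \sum_(i < n) nm (z i).
Proof.
elim: n => [|n IH]; first by rewrite !big_ord0 nm0.
by rewrite !big_ord_recr /= (le_trans (nmD _ _)) // lerD2r.
Qed.

Lemma blin_id : blin id.
Proof. by split=> //; exists 1; rewrite ?ltr01 // => x; rewrite mul1r. Qed.

Lemma blin_comp A L : blin A -> blin L -> blin (fun x => A (L x)).
Proof.
move=> hA hL; split=> [c x y|]; first by rewrite hL.1 hA.1.
case: hA.2 hL.2 => K K0 hK [M M0 hM]; exists (K * M); first by rewrite mulr_gt0.
by move=> x; rewrite (le_trans (hK _)) // -mulrA ler_wpM2l // ltW.
Qed.

Lemma blinDf A L : blin A -> blin L -> blin (fun x => A x + L x).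
Proof.
move=> hA hL; split=> [c x y|]; first by rewrite hL.1 hA.1 scalerDr addrACA.
case: hA.2 hL.2 => K K0 hK [M M0 hM]; exists (K + M); first by rewrite addr_gt0.
by move=> x; rewrite (le_trans (nmD _ _)) // mulrDl lerD.
Qed.

Lemma blinZf c A : blin A -> blin (fun x => c *: A x).
Proof.
move=> hA; split=> [d x y|]; first by rewrite hA.1 scalerDr !scalerA mulrC.
case: hA.2 => K K0 hK; exists ((nc c + 1) * K).
  by rewrite mulr_gt0 // ltr_wpDl ?nc_ge0.
move=> x; rewrite (le_trans (nmZ_le _ _)) // -mulrA.
apply: ler_pM; rewrite ?nc_ge0 ?nm_ge0 ?hK // lerDl; exact: ler01.
Qed.

Definition sh A (z : C) (x : H) : H := A x - z *: x.

Lemma blin_sh A z : blin A -> blin (sh A z).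
Proof.
move=> hA; have := blinDf hA (blinZf (- z) blin_id).
by congr blin; apply/funext => x; rewrite scaleNr.
Qed.

Lemma blin_rank1 (phi : H -> C) (w : H) :
  (forall c x y, phi (c *: x + y) = c * phi x + phi y) ->
  (exists2 K, 0 <= K & forall x, nc (phi x) <= K * nm x) ->
  blin (fun x => x + phi x *: w).
Proof.
move=> h1 [K K0 hK]; split=> [c x y|].
  by rewrite h1 scalerDl scalerDr scalerA addrACA.
exists (1 + K * nm w); first by rewrite ltr_wpDr ?ltr01 // mulr_ge0 ?nm_ge0.
move=> x; rewrite (le_trans (nmD _ _)) // mulrDl mul1r lerD2l.
by rewrite (le_trans (nmZ_le _ _)) // mulrAC ler_wpM2r ?nm_ge0.
Qed.

Lemma blin_approx A x e : blin A -> 0 < e ->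
  exists N, forall n, (N <= n)%N -> nm (A x - \sum_(i < n) x i *: A (delta i)) <= e.
Proof.
move=> hA e0; case: (hA.2) => K K0 hK.
have [N hN] := trunc_cvg x (divr_gt0 e0 K0).
exists N => n Nn; have -> : \sum_(i < n) x i *: A (delta i) = A (trunc n x).
  rewrite /trunc (@blin_sum A n (fun i => x i *: delta i)) //.
  by apply: eq_bigr => i _; rewrite blinZ.
rewrite -blinB // (le_trans (hK _)) // -ler_pdivlMl // mulrC; exact: hN.
Qed.

Lemma blin_tail A N P x : blin A -> (forall n, (N <= n)%N -> tail P (A (delta n))) ->
  tail N x -> tail P (A x).
Proof.
move=> hA h hx k kP; apply: nc_eq0; apply/eqP; rewrite eq_le nc_ge0 andbT.
apply/ler_addgt0Pr => e e0; rewrite add0r.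
have [M hM] := blin_approx x hA e0; apply: le_trans (hM M (leqnn _)).
have <- : (A x - \sum_(i < M) x i *: A (delta i)) k = A x k; last exact: nm_coord.
rewrite HB_ (sumH M (fun i => x i *: A (delta i))) big1 ?subr0 // => i _; rewrite HZ.
have [iN|Ni] := ltnP i N; first by rewrite hx // mul0r.
by rewrite h // mulr0.
Qed.

Lemma nm_comb n (c : nat -> C) (z : nat -> H) a b : 0 <= a -> 0 <= b ->
  \sum_(i < n) nc (c i) ^+ 2 <= a ^+ 2 -> \sum_(i < n) nm (z i) ^+ 2 <= b ^+ 2 ->
  nm (\sum_(i < n) c i *: z i) <= a * b.
Proof.
move=> a0 b0 ha hb; apply: (le_trans (nm_sum _ (fun i => c i *: z i))).
apply: (@le_trans _ _ (\sum_(i < n) nc (c i) * nm (z i))).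
  by apply: ler_sum => i _; exact: nmZ_le.
rewrite -(@ler_pXn2r _ 2) ?nnegrE ?mulr_ge0 //; last first.
  by apply: sumr_ge0 => i _; rewrite mulr_ge0 ?nc_ge0 ?nm_ge0.
rewrite (le_trans (sum_cs _ (fun i => nc (c i)) (fun i => nm (z i)))) // exprMn.
by apply: ler_pM; rewrite ?sum_nc2_ge0 //; apply: sumr_ge0 => i _; exact: sqr_ge0.
Qed.

(** Cauchy-Schwarz over the columns: on a tail space the operator norm is at most the
    Hilbert-Schmidt norm of the remaining columns. *)
Lemma hs_tail A N q x : blin A -> 0 <= q ->
  (forall M, \sum_(N <= n < M) nm (A (delta n)) ^+ 2 <= q ^+ 2) ->
  tail N x -> nm (A x) <= q * nm x.
Proof.
move=> hA q0 hq hx; apply/ler_addgt0Pr => e e0.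
have [M hM] := blin_approx x hA e0.
have := hM M (leqnn _); set S := \sum_(i < M) _ => h1.
have h2 : nm S <= nm x * q.
  have -> : S = \sum_(i < M) x i *: (if (i < N)%N then 0 else A (delta i)).
    by apply: eq_bigr => i _; case: ltnP => // iN; rewrite hx // scale0r scaler0.
  apply: (@nm_comb M x (fun i => if (i < N)%N then 0 else A (delta i))); rewrite ?nm_ge0 //.
    exact: nm_sq.
  rewrite -(big_mkord xpredT (fun i => nm (if (i < N)%N then 0 else A (delta i)) ^+ 2)).
  have [MN|/ltnW NM] := leqP M N.
    rewrite big_nat big1 ?sqr_ge0 // => i /= iM; rewrite (leq_trans iM) // nm0 expr0n //.
  rewrite (big_cat_nat (n := N)) //= big_nat big1 ?add0r; last first.
    by move=> i /= ->; rewrite nm0 expr0n.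
  apply: le_trans (hq M); rewrite le_eqVlt; apply/orP; left; apply/eqP.
  by apply: eq_big_nat => i /andP[Ni _]; rewrite ltnNge Ni.
rewrite mulrC; have := nmD (A x - S) S; rewrite subrK; lra.
Qed.

(** Square summable columns define an operator; it will carry a family quadratically close to the
    basis onto that basis plus a small perturbation. *)
Lemma hs_colop (v : nat -> H) K : 0 < K -> (forall M, \sum_(n < M) nm (v n) ^+ 2 <= K ^+ 2) ->
  exists L, [/\ blin L, forall n, L (delta n) = v n & forall x, nm (L x) <= K * nm x].
Proof.
move=> K0 hv.
have sm x k : summ (fun n => x n * v n k).
  exists (nm x * K) => M.
  apply: (@le_trans _ _ (\sum_(i < M) nc (x i) * nm (v i))).
    by apply: ler_sum => i _; rewrite ncM ler_wpM2l ?nc_ge0 ?nm_coord.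
  rewrite -(@ler_pXn2r _ 2) ?nnegrE ?mulr_ge0 ?nm_ge0 // ?(ltW K0) //; last first.
    by apply: sumr_ge0 => i _; rewrite mulr_ge0 ?nc_ge0 ?nm_ge0.
  rewrite (le_trans (sum_cs _ (fun i => nc (x i)) (fun i => nm (v i)))) // exprMn.
  apply: ler_pM; rewrite ?sum_nc2_ge0 //; last exact: nm_sq.
  by apply: sumr_ge0 => i _; exact: sqr_ge0.
have bd x : sqbnd (fun k => csum (fun n => x n * v n k)) ((K * nm x) ^+ 2).
  move=> N; apply: (@sum_nc2_cvg R N (fun m k => \sum_(i < m) x i * v i k) (fun k => csum (fun n => x n * v n k))).
    by move=> k; exact: csumP.
  move=> m; have h : nm (\sum_(i < m) x i *: v i) <= nm x * K.
    by apply: nm_comb; rewrite ?nm_ge0 ?(ltW K0) //; exact: nm_sq.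
  apply: (@le_trans _ _ (nm (\sum_(i < m) x i *: v i) ^+ 2)).
    apply: le_trans (nm_sq _ N); rewrite le_eqVlt; apply/orP; left; apply/eqP.
    by apply: eq_bigr => k _; rewrite (sumH m (fun i => x i *: v i)).
  by rewrite mulrC ler_pXn2r ?nnegrE ?mulr_ge0 ?nm_ge0 // ltW.
have el x : ell2 (fun k => csum (fun n => x n * v n k)).
  by apply/ell2P; exists ((K * nm x) ^+ 2).
exists (fun x => mkH (el x)).
have kb x : nm (mkH (el x)) <= K * nm x.
  by apply: nm_le; [rewrite mulr_ge0 ?nm_ge0 // ltW|exact: bd].
split=> //.
  split; last by exists K.
  move=> c x y; apply: HE => k; rewrite HD HZ /=.
  rewrite !mkHE.
  have -> : (fun n => (c *: x + y) n * v n k) = (fun n => c * (x n * v n k) + y n * v n k).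
    by apply/funext => n; rewrite HD HZ mulrDl mulrA.
  by rewrite csumD ?csumZ //; exact: summZ.
move=> n; apply: HE => k; rewrite mkHE; have [_ h] := csum_single n (v n k); rewrite -[RHS]h.
by congr csum; apply/funext => i; rewrite deltaE; case: eqP => [->|_]; rewrite ?mul1r ?mul0r.
Qed.

Lemma H_closed_tail N (x : nat -> H) y : (forall n, tail N (x n)) ->
  (forall e, 0 < e -> exists n, nm (y - x n) <= e) -> tail N y.
Proof.
move=> hx h k kN; apply: nc_eq0; apply/eqP; rewrite eq_le nc_ge0 andbT.
apply/ler_addgt0Pr => e e0; rewrite add0r; have [n hn] := h e e0.
by apply: le_trans hn; have := nm_coord (y - x n) k; rewrite HB_ hx // subr0.
Qed.

Lemma geo_small (c q : R) : 0 <= q < 1 -> forall e, 0 < e -> exists N, c * q ^+ N <= e.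
Proof.
move=> /andP[q0 q1] e e0; have h : c * q ^+ n @[n --> \oo] --> c * 0.
  by apply: cvgM; [exact: cvg_cst|apply: cvg_expr; rewrite ger0_norm].
move: h; rewrite mulr0 => /cvgrPdist_lt/(_ e e0)[N _ hN]; exists N.
by have := hN N (leqnn _); rewrite /= sub0r normrN => /ltW; apply: le_trans; exact: ler_norm.
Qed.

(** The iteration [x := y - L x] started at 0 never leaves the tail space, so smallness of [L] is
    needed only there. *)
Lemma neumann N L q : blin L -> 0 <= q < 1 ->
  (forall x, tail N x -> tail N (L x) /\ nm (L x) <= q * nm x) ->
  forall y, tail N y -> exists x, [/\ tail N x, x + L x = y & nm x <= (1 - q)^-1 * nm y].
Proof.
move=> hL hq h y ty; have /andP[q0 q1] := hq.
have [x [x0 xS]] : exists x : nat -> H, x 0%N = 0 /\ forall n, x n.+1 = y - L (x n).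
  by exists (fix x n := if n is n'.+1 then y - L (x n') else 0).
have tx n : tail N (x n).
  by elim: n => [|n IH]; rewrite ?x0 // xS; apply: tailB => //; have [] := h _ IH.
have hx n : nm (x n.+1 - x n) <= nm y * q ^+ n.
  elim: n => [|n IH]; first by rewrite xS x0 blin0 // !subr0 expr0 mulr1.
  have -> : x n.+2 - x n.+1 = - L (x n.+1 - x n).
    by rewrite blinB // !xS opprB opprB addrC addrA subrK.
  rewrite nmN (le_trans (h _ (tailB (tx _) (tx _))).2) // exprS mulrCA.
  by rewrite ler_wpM2l.
have [z hz] := H_complete hq hx.
exists z.
have tz : tail N z.
  apply: (H_closed_tail tx) => e e0.
  have [n hn] := geo_small (nm y / (1 - q)) hq e0; exists n.
  by apply: le_trans (hz n) hn.
split=> //; last by have := hz 0%N; rewrite x0 subr0 expr0 mulr1 mulrC.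
apply/eqP; rewrite -subr_eq0; apply/eqP; apply: nm_small => e e0.
have [n hn] := geo_small (nm y / (1 - q)) hq (divr_gt0 e0 (ltr0n _ 2)).
have -> : z + L z - y = (z - x n.+1) + L (z - x n).
  by rewrite xS (blinB z (x n) hL) opprB addrACA [L (x n) - y]addrC addrK.
apply: (le_trans (nmD _ _)).
have e1 : nm (L (z - x n)) <= nm (z - x n).
  apply: (le_trans (h _ (tailB tz (tx n))).2); rewrite ler_piMl ?nm_ge0 ?(ltW q1) //.
have e2 : nm (z - x n.+1) <= nm y / (1 - q) * q ^+ n.
  apply: (le_trans (hz _)); rewrite exprS mulrCA ler_piMl ?(ltW q1) //.
  by rewrite mulr_ge0 ?exprn_ge0 // mulr_ge0 ?nm_ge0 // invr_ge0 subr_ge0 ltW.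
have := hz n; lra.
Qed.

Definition aut Q Q' : Prop := [/\ blin Q, blin Q', cancel Q Q' & cancel Q' Q].

Lemma aut_comp P P' Q Q' : aut P P' -> aut Q Q' -> aut (fun x => P (Q x)) (fun x => Q' (P' x)).
Proof.
move=> [h1 h2 h3 h4] [k1 k2 k3 k4]; split.
- exact: blin_comp.
- exact: blin_comp.
- by move=> x; rewrite h3 k3.
- by move=> x; rewrite k4 h4.
Qed.

Lemma neumann_aut L q : blin L -> 0 <= q < 1 -> (forall x, nm (L x) <= q * nm x) ->
  exists Q', aut (fun x => x + L x) Q'.
Proof.
move=> hL hq h; have t x : tail 0 x by [].
have /choice[Q' hQ'] y : exists x, x + L x = y /\ nm x <= (1 - q)^-1 * nm y.
  have [|x [_ h1 h2]] := @neumann 0 L q hL hq _ y (t y); last by exists x.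
  by move=> x _; split.
have /andP[q0 q1] := hq.
have inj x y : x + L x = y + L y -> x = y.
  move=> e; apply/eqP; rewrite -subr_eq0; apply/eqP; apply: nm_eq0; apply/eqP.
  rewrite eq_le nm_ge0 andbT.
  have h1 : nm (x - y) <= q * nm (x - y).
    have {1}-> : x - y = - L (x - y); last by rewrite nmN.
    rewrite blinB // opprB; by apply/eqP; rewrite subr_eq addrAC eq_sym subr_eq e addrC.
  have := nm_ge0 (x - y); nra.
exists Q'; split.
- exact: blinDf blin_id hL.
- split; last first.
    exists (1 - q)^-1; first by rewrite invr_gt0 subr_gt0.
    by move=> x; exact: (hQ' x).2.
  move=> c x y; apply: inj; rewrite (hQ' _).1 hL.1 addrACA -scalerDr.
  by rewrite !(hQ' _).1.
- by move=> x; apply: inj; exact: (hQ' _).1.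
- by move=> x; exact: (hQ' _).1.
Qed.

End Operators.

(** * From a triangular tail to a basis of generalized eigenvectors *)

Section Triangular.
Variable R : realType.
Local Notation C := R[i].
Local Notation nc := (@Normc.normc R).
Local Notation H := (ell2T R).
Local Notation delta := (@delta R).
Implicit Types (x y : H) (A L Q : H -> H).

Lemma iter_blin A m : blin A -> blin (iter m A).
Proof.
move=> hA; elim: m => [|m IH]; first exact: blin_id.
exact: (blin_comp hA IH).
Qed.

Lemma iter_kill A m n x : blin A -> (m <= n)%N -> iter m A x = 0 -> iter n A x = 0.
Proof.
by move=> hA mn h; rewrite -(subnK mn) iterD h blin0 //; exact: iter_blin.
Qed.

(** Beyond [N]: a triangular matrix with diagonal [nu], whose basis vectors are generalized
    eigenvectors. The bound on the columns makes [A] small on far tail spaces. The last clause makes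
    the finite matrix induced on the quotient by the N-th tail space invertible, so its eigenvalues
    are nonzero. *)
Definition setup A (N : nat) (nu : nat -> C) : Prop :=
  [/\ blin A,
      forall n, (N <= n)%N -> tail n.+1 (sh A (nu n) (delta n)),
      forall n, (N <= n)%N -> nu n != 0 /\ exists m, iter m (sh A (nu n)) (delta n) = 0,
      exists K, forall M, \sum_(i < M) nm (A (delta i)) ^+ 2 <= K &
      forall n, (n < N)%N -> exists g, A g = delta n].

Lemma setup_tail A N nu n x : setup A N nu -> (N <= n)%N -> tail n x -> tail n (A x).
Proof.
move=> [hA tri _ _ _] Nn; apply: blin_tail => // k nk.
have Nk := leq_trans Nn nk.
rewrite -[A _](subrK (nu k *: delta k)); apply: tailD.
  exact: tail_le (leqW nk) (tri k Nk).
by apply: tailZ; exact: tail_delta.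
Qed.

Lemma setup_lead A N nu n x : setup A N nu -> (N <= n)%N -> tail n x ->
  (A x) n = nu n * x n.
Proof.
move=> S Nn tx; have [hA tri _ _ _] := S.
rewrite -{1}[x](subrK (x n *: delta n)) blinD // HD.
rewrite (setup_tail S (leqW Nn) (tail_split tx)) // add0r blinZ // HZ mulrC.
rewrite -[A (delta n)](subrK (nu n *: delta n)) HD HZ delta_same mulr1.
by rewrite (tri n Nn) // add0r.
Qed.

(* Solvability of [(A - z) g = h] in the [N]-th tail space modulo generalized eigenvectors,
   with bounds: a substitute for the splitting of [A] along its spectrum near [z]. *)
Definition solv A (z : C) (N : nat) : Prop :=
  exists c m, 0 <= c /\ forall h, tail N h -> exists g k,
    [/\ tail N g, tail N k, h = sh A z g + k, iter m (sh A z) k = 0 &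
        nm g + nm k <= c * nm h].

(** Far enough the columns have Hilbert-Schmidt norm at most |z| / 2, so a Neumann series inverts A
    - z exactly: [k = 0] and [m = 0]. *)
Lemma solv_base A N nu z : setup A N nu -> z != 0 -> exists2 N1, (N <= N1)%N & solv A z N1.
Proof.
move=> S z0; have [hA _ _ [K hK] _] := S.
have nz : 0 < nc z by exact: nc_gt0.
have [N0 hN] := @sqbnd_tail R (fun i => nm (A (delta i)) ^+ 2) _ (fun i => sqr_ge0 _) hK
  ((nc z / 2) ^+ 2) (exprn_gt0 2 (divr_gt0 nz (ltr0n _ 2))).
exists (maxn N N0); first exact: leq_maxl.
set N1 := maxn _ _.
have L1 x : tail N1 x -> nm (A x) <= nc z / 2 * nm x.
  apply: hs_tail => //; first by rewrite divr_ge0 ?ler0n // ltW.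
  by move=> M; apply: hN; exact: leq_maxr.
have hL : blin (fun x => (- z^-1) *: A x) by exact: blinZf.
exists ((1 - 2^-1)^-1 * nc z^-1), 0%N; split.
  by rewrite mulr_ge0 ?nc_ge0 // invr_ge0; lra.
move=> h th.
have [||g [tg e hg]] := @neumann R N1 _ 2^-1 hL _ _ ((- z^-1) *: h) (tailZ _ th).
  by apply/andP; split; lra.
  move=> x tx; split; first by apply: tailZ; exact: setup_tail S (leq_maxl _ _) tx.
  apply: (le_trans (nmZ_le _ _)); rewrite ncN ncV -ler_pdivlMl ?invr_gt0 // invrK mulrA.
  exact: L1.
exists g, 0; split=> //; last first.
  have q2 : 0 <= (1 - 2^-1)^-1 :> R by rewrite invr_ge0; lra.
  rewrite nm0 addr0 (le_trans hg) // -mulrA ler_wpM2l //.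
  by rewrite (le_trans (nmZ_le _ _)) // ncN.
rewrite addr0 /sh; have := congr1 (fun y => (- z) *: y) e.
rewrite /= scalerA mulrNN divff // scale1r => <-.
by rewrite scalerDr scalerA mulrNN divff // scale1r scaleNr addrC.
Qed.

(** One more basis vector enters. If its diagonal entry is [z], it is itself a generalized
    eigenvector for [z] and its coefficient goes into [k]; otherwise the coefficient is divided by
    [nu n - z] and the rest of the column is absorbed by the next tail space. *)
Lemma solv_step A N nu z n : setup A N nu -> (N <= n)%N -> solv A z n.+1 -> solv A z n.
Proof.
move=> S Nn [c [m [c0 hs]]]; have [hA tri gen _ _] := S.
set D := nm (delta n); have D0 : 0 <= D by exact: nm_ge0.
have h1 (h : H) : nm (h - h n *: delta n) <= (1 + D) * nm h.
  apply: (le_trans (nmB _ _)); rewrite mulrDl mul1r lerD2l.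
  by rewrite (le_trans (nmZ_le _ _)) // mulrC ler_wpM2l // nm_coord.
have hB := blin_sh z hA.
have [zn|zn] := eqVneq z (nu n).
  have [_ [p hp]] := gen n Nn; rewrite -zn in hp.
  exists (c * (1 + D) + D), (maxn m p); split.
    by rewrite addr_ge0 // mulr_ge0 // addr_ge0 // ler01.
  move=> h th; have [g [k [tg tk e ik hgk]]] := hs _ (tail_split th).
  exists g, (k + h n *: delta n); split.
  - exact: tail_le (leqnSn n) tg.
  - by apply: tailD; [exact: tail_le (leqnSn n) tk|apply: tailZ; exact: tail_delta].
  - by rewrite addrA -e subrK.
  - rewrite (blinD _ _ (iter_blin _ hB)) (blinZ _ _ (iter_blin _ hB)).
    by rewrite (iter_kill hB (leq_maxl _ _) ik) (iter_kill hB (leq_maxr _ _) hp) scaler0 addr0.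
  - have e1 := nmD k (h n *: delta n); have e2 := nmZ_le (h n) (delta n).
    have e3 : nc (h n) * nm (delta n) <= nm h * D by rewrite ler_wpM2r // nm_coord.
    have e4 := ler_wpM2l c0 (h1 h).
    rewrite mulrDl; lra.
have zn' : nu n - z != 0 by rewrite subr_eq0 eq_sym.
set k0 := sh A (nu n) (delta n); set E := nc (nu n - z)^-1.
have E0 : 0 <= E by exact: nc_ge0.
have sd : sh A z (delta n) = k0 + (nu n - z) *: delta n.
  by rewrite /k0 /sh scalerBl addrA subrK.
exists (c * (1 + D + E * nm k0) + E * D), m; split.
  by rewrite addr_ge0 ?mulr_ge0 ?addr_ge0 ?mulr_ge0 ?nm_ge0 // ler01.
move=> h th; pose w : C := h n / (nu n - z).
have hw : nc w <= E * nm h by rewrite ncM mulrC ler_wpM2l ?nm_coord.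
have [g [k [tg tk e ik hgk]]] := hs (h - h n *: delta n - w *: k0)
   (tailB (tail_split th) (tailZ _ (tri n Nn))).
exists (g + w *: delta n), k; split=> //.
- by apply: tailD; [exact: tail_le (leqnSn n) tg|apply: tailZ; exact: tail_delta].
- exact: tail_le (leqnSn n) tk.
- rewrite (blinD _ _ hB) (blinZ _ _ hB) sd addrAC -e (scalerDr w k0) (scalerA w) /w divfK //.
  by rewrite addrA !subrK.
- have e1 := nmD g (w *: delta n); have e2 := nmZ_le w (delta n).
  have e3 : nc w * nm (delta n) <= E * nm h * D by rewrite ler_wpM2r.
  have e4 : nm (h - h n *: delta n - w *: k0) <= (1 + D + E * nm k0) * nm h.
    apply: (le_trans (nmB _ _)); rewrite [in X in _ <= X]mulrDl lerD //.
    rewrite (le_trans (nmZ_le _ _)) // mulrAC ler_wpM2r ?nm_ge0 //.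
  have e5 := ler_wpM2l c0 e4.
  rewrite mulrDl [E * D * _]mulrAC; lra.
Qed.

Lemma setup_solv A N nu z : setup A N nu -> z != 0 -> solv A z N.
Proof.
move=> S z0; have [N1 NN1] := solv_base S z0; rewrite -(subnKC NN1).
elim: (N1 - N)%N => [|d IH]; first by rewrite addn0.
by move=> h; apply: IH; apply: (solv_step S (leq_addr _ _)); rewrite -addnS.
Qed.

Lemma eigenvector_unit n (G X : 'M[C]_n.+1) : G *m X = 1%:M ->
  exists (v : 'cV[C]_n.+1) z, [/\ v != 0, z != 0 & G *m v = z *: v].
Proof.
move=> GX.
(* The transpose turns the row eigenvectors of [eigenvalue] into column vectors. *)
have [z rz] : exists z, root (char_poly G^T) z.
  by apply/closed_rootP; rewrite size_char_poly.
have /eigenvalueP[v hv v0] : eigenvalue G^T z by rewrite eigenvalue_root_char.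
have e : G *m v^T = z *: v^T.
  by rewrite -[LHS]trmxK trmx_mul trmxK hv linearZ.
exists v^T, z; split=> //; first by rewrite -trmx0 (inj_eq trmx_inj).
apply/eqP => z0; move: e; rewrite z0 scale0r => e.
have GX' : X *m G = 1%:M by exact: mulmx1C.
have := congr1 (mulmx X) e; rewrite mulmxA GX' mul1mx mulmx0 => e2.
by move: v0; rewrite -[v]trmxK e2 trmx0 eqxx.
Qed.

Lemma sum_one M k (c : R) : 0 <= c -> \sum_(i < M) (if i == k :> nat then c else 0) <= c.
Proof.
move=> c0; case: (ltnP k M) => h.
  rewrite (bigD1 (Ordinal h)) //= eqxx big1 ?addr0 // => i /negbTE.
  by rewrite -val_eqE /= => ->.
by rewrite big1 // => i _; case: eqP => // ik; move: (ltn_ord i); rewrite ik ltnNge h.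
Qed.

Lemma coord_blin k : exists2 K, 0 <= K & forall x, nc (x k) <= K * nm x.
Proof. by exists 1; rewrite ?ler01 // => x; rewrite mul1r nm_coord. Qed.

(** [s] exchanges the basis vectors [j] and [N], and [p] then replaces [delta j] by [f]; [p] is
    invertible because the j-th coordinate of [f] is 1. *)
Lemma swap_aut (j N : nat) (f : H) : f j = 1 ->
  exists Q Q', [/\ aut Q Q', Q (delta N) = f, j != N -> Q (delta j) = delta N,
    forall n, n != N -> n != j -> Q (delta n) = delta n &
    forall x, x N = 0 -> x j = 0 -> Q x = x].
Proof.
move=> fj.
pose s x : H := x + (x N - x j) *: (delta j - delta N).
pose p x : H := x + x j *: (f - delta j).
pose p' x : H := x + x j *: (delta j - f).
have bs : blin s.
  apply: blin_rank1 => [c x y|]; first by rewrite !HD !HZ; ring.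
  exists 2; rewrite ?ler0n // => x; rewrite (le_trans (ncB _ _)) //.
  have := nm_coord x N; have := nm_coord x j; lra.
have bp : blin p.
  by apply: (blin_rank1 _ _ (coord_blin j)) => c x y; rewrite HD HZ.
have bp' : blin p'.
  by apply: (blin_rank1 _ _ (coord_blin j)) => c x y; rewrite HD HZ.
have ss x : s (s x) = x.
  apply: HE => k; rewrite /s !(HD, HZ, HB_, HN) !deltaE !eqxx.
  have [->|jN] := eqVneq N j; first by rewrite ?eqxx; ring.
  by rewrite ?(eq_sym j N) ?(negbTE jN); ring.
have pj x : p x j = x j by rewrite /p HD HZ HB_ delta_same fj subrr mulr0 addr0.
have pj' x : p' x j = x j by rewrite /p' HD HZ HB_ delta_same fj subrr mulr0 addr0.
exists (fun x => p (s x)), (fun x => s (p' x)).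
have sd n : n != N -> n != j -> s (delta n) = delta n.
  by move=> h1 h2; rewrite /s !deltaE 2!(eq_sym _ n) (negbTE h1) (negbTE h2) subr0 scale0r addr0.
have pd n : n != j -> p (delta n) = delta n.
  by move=> h2; rewrite /p !deltaE (eq_sym _ n) (negbTE h2) scale0r addr0.
have sN : s (delta N) = delta j.
  rewrite /s !deltaE eqxx; have [->|jN] := eqVneq j N.
    by rewrite subrr scale0r addr0.
  by rewrite subr0 scale1r addrC subrK.
split.
- split.
  + exact: blin_comp.
  + exact: blin_comp.
  + move=> x; rewrite -[RHS]ss; congr s; rewrite /p' pj /p -addrA -scalerDr.
    by rewrite addrA subrK subrr scaler0 addr0.
  + move=> x; rewrite ss /p pj' /p' -addrA -scalerDr.
    by rewrite addrA subrK subrr scaler0 addr0.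
- by rewrite sN /p delta_same scale1r addrC subrK.
- move=> jN; have -> : s (delta j) = delta N by rewrite -[RHS]ss sN.
  by apply: pd; rewrite eq_sym.
- by move=> n h1 h2; rewrite sd // pd.
- by move=> x h1 h2; rewrite /s h1 h2 subr0 scale0r addr0 /p h2 scale0r addr0.
Qed.

Lemma conj_iter A Q Q' z m x : aut Q Q' ->
  iter m (sh (fun x => Q' (A (Q x))) z) x = Q' (iter m (sh A z) (Q x)).
Proof.
move=> [h1 h2 h3 h4]; elim: m => [|m IH] /=; first by rewrite h3.
by rewrite IH /sh h4 (blinB _ _ h2) (blinZ _ _ h2).
Qed.

Lemma setup_step A N nu : setup A N.+1 nu -> exists Q Q' nu',
  [/\ aut Q Q', setup (fun x => Q' (A (Q x))) N nu' & forall n, (N < n)%N -> nu' n = nu n].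
Proof.
move=> S; have [hA tri gen [K hK] rng] := S.
have /choice[gg hg] n : exists g, (n < N.+1)%N -> A g = delta n.
  by case: (ltnP n N.+1) => h; [have [g e] := rng n h; exists g|exists 0].
(* The matrix of [A] on the quotient by the tail space of index [N.+1]; the preimages of the first
   basis vectors give its right inverse [X]. *)
pose G : 'M[C]_N.+1 := \matrix_(i, j) (A (delta j)) i.
pose X : 'M[C]_N.+1 := \matrix_(j, n) (gg n) j.
have comb (u : nat -> C) i :
    (A (\sum_(j < N.+1) u j *: delta j)) i = \sum_(j < N.+1) u j * (A (delta j)) i.
  rewrite (@blin_sum R A N.+1 (fun j => u j *: delta j)) //.
  rewrite (sumH _ (fun j => A (u j *: delta j))).
  by apply: eq_bigr => j _; rewrite blinZ.
have GX : G *m X = 1%:M.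
  apply/matrixP => i n; rewrite !mxE.
  have -> : (i == n)%:R = (A (gg n)) i.
    by rewrite hg ?ltn_ord // deltaE -val_eqE /=; case: eqP.
  rewrite -[gg n](subrK (trunc N.+1 (gg n))) blinD // HD.
  rewrite (setup_tail S (leqnn _) (@tail_trunc _ _ _)) ?ltn_ord // add0r.
  by rewrite (comb (gg n)); apply: eq_bigr => j _; rewrite !mxE mulrC.
have [v [z [v0 z0 Gv]]] := eigenvector_unit GX.
pose u j : C := v (inord j) 0.
pose f0 : H := \sum_(j < N.+1) u j *: delta j.
have uE (j : 'I_N.+1) : u j = v j 0 by rewrite /u inord_val.
have f0E n : (n < N.+1)%N -> f0 n = u n.
  move=> h; rewrite (sumH _ (fun j => u j *: delta j)) (bigD1 (Ordinal h)) //=.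
  rewrite HZ delta_same mulr1 big1 ?addr0 // => i /negbTE.
  by rewrite -val_eqE /= HZ deltaE eq_sym => ->; rewrite mulr0.
have t0 : tail N.+1 (sh A z f0).
  move=> n h; rewrite /sh HB_ HZ f0E // /f0 comb; apply/eqP; rewrite subr_eq0; apply/eqP.
  have := congr1 (fun M : 'cV_N.+1 => M (Ordinal h) 0) Gv; rewrite !mxE.
  rewrite -(uE (Ordinal h)) /= => <-; apply: eq_bigr => j _.
  by rewrite !mxE -uE mulrC.
have [c [m [c0 hs]]] := setup_solv S z0.
have [g [k [tg tk e ik _]]] := hs _ t0.
(* A nonzero coordinate of the eigenvector tells which basis vector it can replace; the tail
   correction [g] does not change it. *)
have [j0 vj0] : exists j0 : 'I_N.+1, u j0 != 0.
  apply/existsP; rewrite -negb_forall; apply: contra v0 => /forallP h.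
  by apply/eqP/matrixP => i j; rewrite ord1 mxE -uE; apply/eqP; exact: h.
pose f := (u j0)^-1 *: (f0 - g).
have fj : f j0 = 1 by rewrite /f HZ HB_ f0E ?ltn_ord // tg ?ltn_ord // subr0 mulVf.
pose k1 := (u j0)^-1 *: k.
have hB := blin_sh z hA.
have Af : A f = k1 + z *: f.
  apply/eqP; rewrite -subr_eq; apply/eqP; rewrite -/(sh A z f) /f (blinZ _ _ hB) (blinB _ _ hB).
  by rewrite e addrC addKr.
have tk1 : tail N.+1 k1 by exact: tailZ.
have ik1 : iter m (sh A z) k1 = 0 by rewrite /k1 (blinZ _ _ (iter_blin _ hB)) ik scaler0.
have [Q [Q' [aQ QN Qj Qn Qx]]] := swap_aut N fj.
have [bQ bQ' QK Q'K] := aQ.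
have Qt x : tail N.+1 x -> Q x = x by move=> tx; apply: Qx; apply: tx; rewrite ?ltn_ord.
have Q't x : tail N.+1 x -> Q' x = x by move=> tx; rewrite -{1}(Qt _ tx) QK.
have Qd n : (N < n)%N -> Q (delta n) = delta n by move=> h; apply: Qt; exact: tail_delta.
exists Q, Q', (fun n => if n == N then z else nu n); split=> //; last first.
  by move=> n; case: ltngtP.
have bA : blin (fun x => Q' (A (Q x))) by apply: blin_comp => //; exact: blin_comp.
split=> //.
- move=> n; rewrite leq_eqVlt eq_sym; case: eqP => [-> _|_ /= Nn].
    by rewrite /sh QN Af (blinD _ _ bQ') (Q't _ tk1) (blinZ _ _ bQ') -{1}QN QK addrK.
  have tn := tri n Nn.
  rewrite /sh (Qd n Nn) -[A _](subrK (nu n *: delta n)) (blinD _ _ bQ') (blinZ _ _ bQ').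
  rewrite (Q't (delta n)); last exact: tail_delta.
    by rewrite addrK (Q't _ (tail_le (leqW Nn) tn)).
- move=> n; rewrite leq_eqVlt eq_sym; case: eqP => [-> _|_ /= Nn].
    (* One application of [sh A z] sends [f] to [k1], and [m] more kill it. *)
    split=> //; exists m.+1; rewrite (conj_iter A z m.+1 (delta N) aQ) QN iterSr.
    have -> : sh A z f = k1 by rewrite /sh Af addrK.
    by rewrite ik1 blin0.
  have [nz [p hp]] := gen n Nn; split=> //; exists p.
  by rewrite (conj_iter A (nu n) p (delta n) aQ) Qd // hp blin0.
(* [Q] moves only the basis vectors [N] and [j0], so all other columns change by the bounded factor
   [Q'] alone. *)
- have [K' K'0 hK'] := bQ'.2; pose T x := nm (Q' (A (Q x))) ^+ 2.
  have T0 x : 0 <= T x by exact: sqr_ge0.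
  exists (K' ^+ 2 * K + T (delta N) + T (delta j0)) => M.
  apply: (@le_trans _ _ (\sum_(i < M) (K' ^+ 2 * nm (A (delta i)) ^+ 2 +
    (if i == N :> nat then T (delta N) else 0) + (if i == j0 :> nat then T (delta j0) else 0)))).
    apply: ler_sum => i _; have nn k2 : 0 <= K' ^+ 2 * nm (A (delta k2)) ^+ 2.
      by rewrite mulr_ge0 ?sqr_ge0.
    have [->|iN] := eqVneq (i : nat) N.
      rewrite -/(T (delta N)); case: ifP => _; have := T0 (delta j0); have := T0 (delta N);
      have := nn N; set a1 := K' ^+ 2 * _; lra.
    have [->|ij] := eqVneq (i : nat) j0.
      rewrite -/(T (delta j0)); have := nn j0; have := T0 (delta j0); set a1 := K' ^+ 2 * _; lra.
    rewrite !addr0 Qn // -exprMn ler_pXn2r ?nnegrE ?mulr_ge0 ?nm_ge0 // ltW //.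
  rewrite !big_split /= -mulr_sumr !lerD ?sum_one // ler_wpM2l ?sqr_ge0 //; exact: hK.
(* [Q] sends [delta j0] to [delta N], which was in the range too; the other basis vectors below [N]
   are fixed. *)
- move=> n nN; have [nj|nj] := eqVneq n j0.
    have [g1 e1] := rng N (ltnSn N); exists (Q' g1).
    rewrite Q'K e1 nj -Qj ?QK //; by rewrite -nj ltn_eqF.
  have [g1 e1] := rng n (leqW nN); exists (Q' g1).
  by rewrite Q'K e1 -{1}(Qn n) ?QK // ltn_eqF.
Qed.

Lemma aut_id : aut (@id H) id.
Proof. by split=> //; exact: blin_id. Qed.

Lemma triangularize A N nu : setup A N nu -> exists Q Q' nu',
  [/\ aut Q Q', setup (fun x => Q' (A (Q x))) 0 nu' & forall n, (N <= n)%N -> nu' n = nu n].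
Proof.
elim: N A nu => [|N IH] A nu S; first by exists id, id, nu; split=> //; exact: aut_id.
have [Q [Q' [nu1 [aQ S1 e1]]]] := setup_step S.
have [P [P' [nu2 [aP S2 e2]]]] := IH _ _ S1.
exists (fun x => Q (P x)), (fun x => P' (Q' x)), nu2; split=> //.
  exact: aut_comp.
by move=> n Nn; rewrite e2 ?e1 // ltnW.
Qed.

Lemma first_coord x : x <> 0 -> exists2 n, tail n x & x n != 0.
Proof.
move=> x0.
have ex : exists n, x n != 0.
  apply: contrapT => h; apply: x0; apply: HE => n; rewrite H0; apply/eqP/negPn/negP => hn.
  by apply: h; exists n.
exists (ex_minn ex); last by case: ex_minnP.
by case: ex_minnP => m _ hm n nm; apply/eqP/negPn/negP => /hm; rewrite leqNgt nm.
Qed.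

Lemma gen_lead A nu z m x n : setup A 0 nu -> tail n x ->
  tail n (iter m (sh A z) x) /\ (iter m (sh A z) x) n = (nu n - z) ^+ m * x n.
Proof.
move=> S tx; elim: m => [|m [t e]]; first by rewrite expr0 mul1r.
split=> /=; first by apply: tailB; [exact: setup_tail S _ t|exact: tailZ].
by rewrite /sh HB_ HZ (setup_lead S _ t) // e exprS; ring.
Qed.

(** The first nonzero coordinate of a vector is multiplied by [nu n - z] at each application, so a
    generalized eigenvector can only start at an index whose diagonal entry is [z]. *)
Lemma gen_eigen_nu A nu z m x n : setup A 0 nu -> iter m (sh A z) x = 0 ->
  tail n x -> x n != 0 -> z = nu n.
Proof.
move=> S h tx xn; have [_ e] := gen_lead z m S tx; move: e; rewrite h H0 => /esym/eqP.
rewrite mulf_eq0 (negbTE xn) orbF expf_eq0 => /andP[_].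
by rewrite subr_eq0 => /eqP.
Qed.

Lemma nu_eigen A nu n : setup A 0 nu -> exists2 x, x <> 0 & A x = nu n *: x.
Proof.
move=> [hA _ gen _ _]; have [_ [m]] := gen n (leq0n n).
have d0 : delta n <> 0 by apply/eqP; exact: delta_neq0.
move: (delta n) d0 => x; elim: m x => [|m IH] x x0; first by move=> h; case: x0.
rewrite iterSr; have [e|/eqP e] := eqVneq (sh A (nu n) x) 0; last exact: IH.
move=> _; exists x => //; by apply/eqP; rewrite -subr_eq0; apply/eqP.
Qed.

(** With more than [size s] vectors, some nontrivial combination vanishes at every index of [s]. It
    is a generalized eigenvector, hence its first nonzero index has diagonal entry [z] and belongs
    to [s], a contradiction. *)
Lemma gen_mult A nu z (s : seq nat) p (x : 'I_p -> H) : setup A 0 nu ->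
  (forall n, nu n = z -> n \in s) ->
  (forall i, exists m, iter m (sh A z) (x i) = 0) ->
  (forall c : 'I_p -> C, \sum_(i < p) c i *: x i = 0 -> forall i, c i = 0) ->
  (p <= size s)%N.
Proof.
move=> S hs gx free; rewrite leqNgt; apply/negP => sp.
have [hA _ _ _ _] := S.
pose M : 'M[C]_(p, size s) := \matrix_(i, j) (x i) (nth 0%N s j).
have kn0 : kermx M != 0.
  rewrite -mxrank_eq0 mxrank_ker -lt0n subn_gt0; exact: leq_ltn_trans (rank_leq_col _) sp.
have /rowV0Pn[v vk v0] := kn0.
have vM : v *m M = 0 by apply/sub_kermxP.
pose y := \sum_(i < p) v 0 i *: x i.
have yE n : y n = \sum_(i < p) v 0 i * x i n.
  rewrite /y (big_morph (fun w : H => (w n : C)) (fun a b => HD a b n) (H0 _ n)).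
  by apply: eq_bigr => i _; rewrite HZ.
have y0 : y <> 0.
  by move=> /free h; move: v0; apply/negP/negPn/eqP/matrixP => i j; rewrite ord1 mxE h.
have [m hm] : exists m, iter m (sh A z) y = 0.
  have /choice[mm hmm] := gx.
  have hB := blin_sh z hA.
  exists (\max_(i < p) mm i)%N; rewrite /y.
  have -> : forall q, iter q (sh A z) (\sum_(i < p) v 0 i *: x i) =
      \sum_(i < p) v 0 i *: iter q (sh A z) (x i).
    move=> q; have hq := iter_blin q hB.
    elim/big_rec2: _ => [|i a b _ <-]; first by rewrite blin0.
    by rewrite (blinD _ _ hq) (blinZ _ _ hq).
  rewrite big1 // => i _; rewrite (iter_kill hB _ (hmm i)) ?scaler0 //.
  exact: leq_bigmax.
have [n tn yn] := first_coord y0.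
have ns := hs n (esym (gen_eigen_nu S hm tn yn)).
move: yn; rewrite yE; apply/negP/negPn/eqP.
have idx : (index n s < size s)%N by rewrite index_mem.
have := congr1 (fun M : 'rV_(size s) => M 0 (Ordinal idx)) vM; rewrite !mxE => e.
rewrite -[RHS]e; apply: eq_bigr => i _; by rewrite !mxE /= nth_index.
Qed.

(** The remainder [k] in [solv] is a generalized eigenvector for [z]; since [z] is no diagonal
    entry, it must vanish. *)
Lemma resolvent_bound A nu z : setup A 0 nu -> z != 0 -> (forall n, nu n != z) ->
  exists c, forall h, exists2 g, sh A z g = h & nm g <= c * nm h.
Proof.
move=> S z0 hz; have [c [m [c0 hs]]] := setup_solv S z0.
exists c => h; have [//|g [k [_ _ e ik b]]] := hs h.
have k0 : k = 0.
  apply: contrapT => /first_coord[n tn kn].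
  by have /eqP := hz n; rewrite (gen_eigen_nu S ik tn kn).
exists g; first by rewrite e k0 addr0.
by move: b; rewrite k0 nm0 addr0.
Qed.

End Triangular.

(** * Eigenvalues of the scalar operator by contraction *)

Section GapSums.
Variable R : realType.

(** Truncated subtraction makes [h (k - n) + h (n - k)] the inverse square of the distance between
    [k] and [n], with value 0 on the diagonal. *)
Let h (j : nat) : R := if j == 0%N then 0 else (j%:R ^+ 2)^-1.

Let h_ge0 j : 0 <= h j.
Proof. by rewrite /h; case: ifP => // _; rewrite invr_ge0 sqr_ge0. Qed.

Lemma sum_inv_sq_le2 M : \sum_(j < M) h j <= 2.
Proof.
case: M => [|M]; first by rewrite big_ord0.
case: M => [|M]; first by rewrite big_ord1 /h.
(* Telescoping: 1 / (x + 1)^2 is at most 1 / x - 1 / (x + 1). *)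
have H1 : \sum_(j < M.+2) h j <= 2 - (M.+1%:R)^-1.
  elim: M => [|M IH]; first by rewrite 2!big_ord_recr big_ord0 /= /h /=; lra.
  rewrite big_ord_recr /=; apply: (le_trans (lerD IH (lexx _))).
  rewrite /h /=; set x := M.+1%:R : R; have x0 : 0 < x by rewrite ltr0n.
  have -> : M.+2%:R = x + 1 :> R by rewrite -natr1.
  have e : (2 - (x + 1)^-1) - (2 - x^-1 + ((x + 1) ^+ 2)^-1) = (x * (x + 1) ^+ 2)^-1.
    by field; rewrite !gt_eqF //; lra.
  by rewrite -subr_ge0 e invr_ge0 mulr_ge0 ?sqr_ge0 // ltW.
by apply: (le_trans H1); rewrite gerBl invr_ge0 ler0n.
Qed.

Lemma sum_below k M : \sum_(n < M) h (k - n) <= 2.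
Proof.
have : \sum_(n < M) h (k - n) <= \sum_(j < k.+1) h j.
  elim: k M => [|k IH] [|M]; rewrite ?big_ord0; try by apply: sumr_ge0.
    by rewrite big1 ?sumr_ge0 // => i _; rewrite sub0n.
  rewrite big_ord_recl /= subn0 [leRHS]big_ord_recr /= [leRHS]addrC lerD2l.
  apply: le_trans (IH M); rewrite le_eqVlt; apply/orP; left; apply/eqP.
  by apply: eq_bigr => i _; rewrite /bump /= subSS.
by move=> e; exact: le_trans e (sum_inv_sq_le2 _).
Qed.

Lemma sum_above k M : \sum_(n < M) h (n - k) <= 2.
Proof.
have : \sum_(n < M) h (n - k) <= \sum_(j < M) h j.
  elim: k M => [|k IH] [|M]; rewrite ?big_ord0 //.
    by under eq_bigr do rewrite subn0.
  rewrite big_ord_recl [leRHS]big_ord_recr /= sub0n {1}/h /= add0r.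
  apply: le_trans (_ : \sum_(n < M) h (n - k) <= _).
    rewrite le_eqVlt; apply/orP; left; apply/eqP.
    by apply: eq_bigr => i _; rewrite /bump /= add1n subSS.
  by apply: (le_trans (IH M)); rewrite lerDl.
by move=> e; exact: le_trans e (sum_inv_sq_le2 _).
Qed.

(** Telescoping with a half step: 1 / x^2 is at most 1 / (x - 1/2) - 1 / (x + 1/2), and 1 / (k -
    1/2) is at most 2 / k. *)
Lemma sum_shift_sq k M : (0 < k)%N -> \sum_(n < M) ((k + n)%:R ^+ 2)^-1 <= 2 / k%:R :> R.
Proof.
move=> k0; have k1 : 1 <= k%:R :> R by rewrite ler1n.
have H1 : \sum_(n < M) ((k + n)%:R ^+ 2)^-1 <= (k%:R - 2^-1)^-1 - (k%:R + M%:R - 2^-1)^-1 :> R.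
  elim: M => [|M IH]; first by rewrite big_ord0 addr0 subrr.
  rewrite big_ord_recr /=; apply: (le_trans (lerD IH (lexx _))).
  rewrite natrD -(natr1 M); set x := k%:R + M%:R : R.
  have x1 : 1 <= x by rewrite /x; have := ler0n R M; lra.
  have -> : k%:R + (M%:R + 1) - 2^-1 = x + 2^-1 :> R by rewrite /x; lra.
  have e : (x - 2^-1)^-1 - (x + 2^-1)^-1 - (x ^+ 2)^-1 = 4^-1 / (x ^+ 2 * (x - 2^-1) * (x + 2^-1)).
    by field; apply/and3P; split; apply/eqP; lra.
  have : 0 <= 4^-1 / (x ^+ 2 * (x - 2^-1) * (x + 2^-1)).
    by rewrite divr_ge0 ?invr_ge0 // !mulr_ge0 ?sqr_ge0 //; lra.
  by rewrite -e; lra.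
apply: (le_trans H1); apply: (@le_trans _ _ (k%:R - 2^-1)^-1).
  by rewrite gerBl invr_ge0; have := ler0n R M; lra.
have -> : 2 / k%:R = (k%:R / 2)^-1 :> R by rewrite invf_div.
by rewrite lef_pV2 ?posrE; lra.
Qed.

Variable L : R.
Hypothesis L0 : 0 < L.
Definition lam (n : nat) : R := L * n%:R ^+ 2.
Definition gapI (k n : nat) : R := if n == k then 0 else `|lam k - lam n|^-1.

Lemma gapI_ge0 k n : 0 <= gapI k n.
Proof. by rewrite /gapI; case: ifP => // _; rewrite invr_ge0. Qed.

Lemma lam_gap k n : n != k ->
  `|lam k - lam n| = L * (`|k%:R - n%:R| * (k + n)%:R).
Proof.
move=> nk; rewrite /lam -mulrBr normrM (gtr0_norm L0); congr (_ * _).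
by rewrite subr_sqr normrM natrD; congr (_ * _); rewrite ger0_norm // addr_ge0 ?ler0n.
Qed.

Lemma natr_dist1 k n : n != k -> 1 <= `|k%:R - n%:R| :> R.
Proof.
case: ltngtP => // nk _.
  by rewrite -natrB ?(ltnW nk) // normr_nat ler1n subn_gt0.
by rewrite distrC -natrB ?(ltnW nk) // normr_nat ler1n subn_gt0.
Qed.

Lemma lam_gap_ge k n : n != k -> L * k%:R <= `|lam k - lam n|.
Proof.
move=> nk; rewrite lam_gap // ler_pM2l //; have := natr_dist1 nk.
rewrite natrD; have := ler0n R k; have := ler0n R n; nra.
Qed.

Let s k n : R := Num.sqrt (h (k - n) + h (n - k)).

Let s_sq k n : s k n ^+ 2 = h (k - n) + h (n - k).
Proof. by rewrite sqr_sqrtr // addr_ge0. Qed.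

Let sE k n : n != k -> s k n = `|k%:R - n%:R|^-1.
Proof.
move=> nk; rewrite -[RHS]ger0_norm ?invr_ge0 // -sqrtr_sqr; congr Num.sqrt.
rewrite exprVn real_normK ?num_real //.
move: nk; case: ltngtP => // nk _; rewrite /h.
  have /eqP -> : (n - k == 0)%N by rewrite subn_eq0 ltnW.
  by rewrite eqxx addr0 subn_eq0 leqNgt nk /= natrB // ltnW.
have /eqP -> : (k - n == 0)%N by rewrite subn_eq0 ltnW.
by rewrite eqxx add0r subn_eq0 leqNgt nk /= natrB ?(ltnW nk) // -sqrrN opprB.
Qed.

Let gap_st k n : gapI k n <= L^-1 * (s k n * ((k + n)%:R)^-1).
Proof.
rewrite /gapI; case: ifPn => nk.
  by rewrite !mulr_ge0 ?invr_ge0 ?ler0n ?sqrtr_ge0 // ltW.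
by rewrite lam_gap // !invfM -sE.
Qed.

(** The gap is [L * |k - n| * (k + n)], and [k + n >= k] leaves the convergent series of inverse
    squares. The resulting factor 1 / k^2 makes the eigenvectors quadratically close to the
    basis. *)
Lemma gap_sum_sq k M : (0 < k)%N -> \sum_(n < M) gapI k n ^+ 2 <= 4 / (L ^+ 2 * k%:R ^+ 2).
Proof.
move=> k0; have kp : 0 < k%:R :> R by rewrite ltr0n.
apply: (@le_trans _ _ (\sum_(n < M) (L ^+ 2 * k%:R ^+ 2)^-1 * (h (k - n) + h (n - k)))).
  apply: ler_sum => n _; rewrite -s_sq -exprMn -exprVn -exprMn.
  rewrite ler_pXn2r ?nnegrE ?gapI_ge0 ?mulr_ge0 ?invr_ge0 ?mulr_ge0 ?sqrtr_ge0 ?(ltW L0) ?(ltW kp) //; try exact: ltW.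
  apply: (le_trans (gap_st _ _)); rewrite invfM -mulrA ler_wpM2l ?invr_ge0 ?(ltW L0) //.
  rewrite mulrC ler_wpM2r ?sqrtr_ge0 // lef_pV2 ?posrE ?ltr0n ?addn_gt0 ?k0 //.
  by rewrite ler_nat leq_addr.
have c0 : 0 <= (L ^+ 2 * k%:R ^+ 2)^-1 by rewrite invr_ge0; apply: mulr_ge0; exact: sqr_ge0.
rewrite -mulr_sumr big_split /= mulrC ler_wpM2r //.
have := sum_below k M; have := sum_above k M; lra.
Qed.

(** Cauchy-Schwarz between 1 / |k - n| and 1 / (k + n): the first has bounded square sum, the second
    a square sum of order 1 / k. *)
Lemma gap_sum k M : (0 < k)%N -> (\sum_(n < M) gapI k n) ^+ 2 <= 8 / (L ^+ 2 * k%:R).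
Proof.
move=> k0; have kp : 0 < k%:R :> R by rewrite ltr0n.
apply: (@le_trans _ _ ((L^-1 * \sum_(n < M) s k n * ((k + n)%:R)^-1) ^+ 2)).
  rewrite mulr_sumr ler_pXn2r ?nnegrE //.
  - by apply: ler_sum => n _; exact: gap_st.
  - by apply: sumr_ge0 => n _; exact: gapI_ge0.
  - by apply: sumr_ge0 => n _; apply: le_trans (gap_st k n); exact: gapI_ge0.
rewrite exprMn invfM exprVn [leRHS]mulrCA ler_wpM2l ?invr_ge0 ?sqr_ge0 //.
apply: (le_trans (sum_cs _ (s k) (fun n => ((k + n)%:R)^-1))).
have -> : 8 / k%:R = 4 * (2 / k%:R) :> R by lra.
apply: ler_pM; try by apply: sumr_ge0 => i _; exact: sqr_ge0.
  under eq_bigr do rewrite s_sq.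
  rewrite big_split /=; have := sum_below k M; have := sum_above k M; lra.
under eq_bigr do rewrite exprVn.
exact: sum_shift_sq.
Qed.

Lemma lam_sum_sq M : \sum_(n < M) (lam n.+1)^-1 ^+ 2 <= 2 / L ^+ 2.
Proof.
apply: (@le_trans _ _ ((L ^+ 2)^-1 * \sum_(n < M) ((1 + n)%:R ^+ 2)^-1)).
  rewrite mulr_sumr; apply: ler_sum => n _; rewrite /lam invfM exprMn exprVn.
  rewrite ler_wpM2l ?invr_ge0 ?sqr_ge0 // add1n exprVn expr2 invfM.
  rewrite ler_piMl ?invr_ge0 ?sqr_ge0 // invf_le1 ?exprn_gt0 ?ltr0n //.
  by rewrite expr_ge1 ?ler0n // ler1n.
rewrite mulrC ler_wpM2r ?invr_ge0 ?sqr_ge0 //.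
by have := @sum_shift_sq 1 M isT; rewrite divr1.
Qed.

Lemma lam_sum M : \sum_(n < M) (lam n.+1)^-1 <= 2 / L.
Proof.
apply: (@le_trans _ _ (L^-1 * \sum_(n < M) ((1 + n)%:R ^+ 2)^-1)).
  by rewrite mulr_sumr; apply: ler_sum => n _; rewrite /lam invfM add1n.
rewrite mulrC ler_wpM2r ?invr_ge0 ?(ltW L0) //.
by have := @sum_shift_sq 1 M isT; rewrite divr1.
Qed.

Lemma lam0 : lam 0 = 0. Proof. by rewrite /lam expr0n mulr0. Qed.
Lemma lam_gt0 n : (0 < n)%N -> 0 < lam n.
Proof. by move=> n0; rewrite mulr_gt0 // exprn_gt0 // ltr0n. Qed.
Lemma lam_inj n k : lam n = lam k -> n = k.
Proof.
move=> e; apply/eqP; apply: contraT => nk; have := lam_gap nk.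
rewrite e subrr normr0 => /esym/eqP; rewrite mulf_eq0 gt_eqF //= mulf_eq0.
have := natr_dist1 nk; case: eqP => [->|_ _ /=]; first by rewrite ler10.
rewrite pnatr_eq0 addn_eq0 => /andP[/eqP k0 /eqP n0].
by move: nk; rewrite k0 n0.
Qed.

End GapSums.

(** * The scalar eigenvalue equation *)

Section Roots.
Variable R : realType.
Local Notation C := R[i].
Local Notation nc := (@Normc.normc R).

Lemma csum_dom (u : nat -> C) (v : nat -> R) B : (forall n, nc (u n) <= v n) ->
  (forall M, \sum_(n < M) v n <= B) -> summ u /\ nc (csum u) <= B.
Proof.
move=> uv hB; have h M : \sum_(n < M) nc (u n) <= B.
  by apply: le_trans (hB M); apply: ler_sum => i _.
by split; [exists B|exact: csum_le_abs].
Qed.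

Lemma contraction_fix (T : C -> C) (rho : R) : 0 <= rho ->
  (forall d, nc d <= rho -> nc (T d) <= rho) ->
  (forall d e, nc d <= rho -> nc e <= rho -> nc (T d - T e) <= 2^-1 * nc (d - e)) ->
  exists2 d, nc d <= rho & T d = d.
Proof.
move=> r0 hT hL; have [d [d0 dS]] : exists d : nat -> C, d 0%N = 0 /\ forall n, d n.+1 = T (d n).
  by exists (fun n => iter n T 0).
have dr n : nc (d n) <= rho by elim: n => [|n IH]; rewrite ?d0 ?nc0 // dS; exact: hT.
have dd n : nc (d n.+1 - d n) <= rho * 2^-1 ^+ n.
  elim: n => [|n IH]; first by rewrite expr0 mulr1 d0 subr0 (dr 1%N).
  have := hL _ _ (dr n.+1) (dr n); rewrite -!dS exprS mulrCA => /le_trans -> //.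
  by rewrite ler_wpM2l ?invr_ge0.
have hq : 0 <= (2^-1 : R) < 1 by apply/andP; split; lra.
(* Completeness of the complex numbers is borrowed from [H_complete], by placing the iterates on the
   line spanned by [delta 0]. *)
pose c := rho * nm (@delta R 0).
have hx n : nm (d n.+1 *: @delta R 0 - d n *: @delta R 0) <= c * 2^-1 ^+ n.
  rewrite -scalerBl (le_trans (nmZ_le _ _)) // /c mulrAC ler_wpM2r ?nm_ge0 //.
have [y hy] := H_complete hq hx.
have hd n : nc (y 0%N - d n) <= c / (1 - 2^-1) * 2^-1 ^+ n.
  apply: le_trans (hy n); have := nm_coord (y - d n *: @delta R 0) 0.
  by rewrite HB_ HZ delta_same mulr1.
have sm e : 0 < e -> exists n, nc (y 0%N - d n) <= e.
  move=> e0; have [n hn] := geo_small (c / (1 - 2^-1)) hq e0.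
  by exists n; exact: le_trans (hd n) hn.
have yr : nc (y 0%N) <= rho.
  apply/ler_addgt0Pr => e e0; have [n hn] := sm e e0.
  have := ncD (y 0%N - d n) (d n); rewrite subrK; have := dr n; lra.
exists (y 0%N) => //; apply/eqP; rewrite -subr_eq0; apply/eqP; apply: nc_eq0.
apply/eqP; rewrite eq_le nc_ge0 andbT; apply/ler_addgt0Pr => e e0; rewrite add0r.
have c0 : 0 <= c by rewrite mulr_ge0 ?nm_ge0.
have [n hn] := geo_small (c / (1 - 2^-1)) hq (divr_gt0 e0 (ltr0n _ 2)).
have -> : T (y 0%N) - y 0%N = (T (y 0%N) - T (d n)) + (d n.+1 - y 0%N).
  by rewrite dS addrA subrK.
have h1 := hL _ _ yr (dr n); have h2 := hd n; have := hd n.+1; rewrite exprS ncC => h3.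
have h4 := ncD (T (y 0%N) - T (d n)) (d n.+1 - y 0%N).
have h5 := nc_ge0 (y 0%N - d n); lra.
Qed.

Variable L : R.
Hypothesis L0 : 0 < L.
Local Notation lam := (@lam R L).
Local Notation gapI := (@gapI R L).

Definition cl (n : nat) : C := (lam n)%:C%C.
(** The weights arise from the square of [sqrt 2] in row and column 0; mode 0 has weight 1. [Ek] is
    the sum of cc_n / (z - lam_n) at z = lam_k + d without its singular term 2 / d, and [Gk] is
    minus its derivative in [d]. *)
Definition cc (n : nat) : C := if n == 0%N then 1 else 2.
Definition qk (k : nat) (d : C) (n : nat) : C := if n == k then 0 else (cl k + d - cl n)^-1.
Definition Ek k d : C := csum (fun n => cc n * qk k d n).
Definition Gk k d : C := csum (fun n => cc n * qk k d n ^+ 2).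

Lemma nc_cc n : nc (cc n) <= 2.
Proof.
rewrite /cc; case: ifP => _; first by rewrite nc1; lra.
have -> : 2 = (2 : R)%:C%C :> C by rewrite rmorphMn.
by rewrite ncR ger0_norm.
Qed.

Section Estimates.
Variables (k : nat) (rho : R).
Hypothesis (k0 : (0 < k)%N) (hk : 2 * rho <= L * k%:R).

(** [hk] makes the disc of radius [rho] around lam_k at most half as large as any gap, so a shift in
    this disc halves no gap more than once. *)
Lemma gap_shift d n : nc d <= rho -> n != k -> `|lam k - lam n| <= 2 * nc (cl k + d - cl n).
Proof.
move=> hd nk; have h1 := lam_gap_ge L0 nk.
have h2 : `|lam k - lam n| <= nc (cl k + d - cl n) + nc d.
  rewrite -ncR rmorphB; have -> : (lam k)%:C%C - (lam n)%:C%C = (cl k + d - cl n) - d.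
    by rewrite addrAC addrK.
  exact: ncB.
have h3 := le_trans hk h1; lra.
Qed.

Lemma shift_neq0 d n : nc d <= rho -> n != k -> cl k + d - cl n != 0.
Proof.
move=> hd nk; apply/eqP => h; have := gap_shift hd nk; rewrite h nc0 mulr0.
have := lam_gap_ge L0 nk; have : 0 < L * k%:R by rewrite mulr_gt0 // ltr0n.
lra.
Qed.

Lemma nc_qk d n : nc d <= rho -> nc (qk k d n) <= 2 * gapI k n.
Proof.
move=> hd; rewrite /qk /gapI; case: ifPn => nk; first by rewrite nc0 mulr0.
have h := gap_shift hd nk; have p : 0 < `|lam k - lam n|.
  by apply: lt_le_trans (lam_gap_ge L0 nk); rewrite mulr_gt0 // ltr0n.
rewrite ncV; have -> : 2 / `|lam k - lam n| = (`|lam k - lam n| / 2)^-1 by rewrite invf_div.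
by rewrite lef_pV2 ?posrE; lra.
Qed.

Lemma Ek_le d B : nc d <= rho -> 0 <= B -> 8 / (L ^+ 2 * k%:R) <= B ^+ 2 ->
  summ (fun n => cc n * qk k d n) /\ nc (Ek k d) <= 4 * B.
Proof.
move=> hd B0 hB; apply: (@csum_dom _ (fun n => 4 * gapI k n)).
  move=> n; rewrite ncM; have -> : 4 * gapI k n = 2 * (2 * gapI k n) by lra.
  by apply: ler_pM; rewrite ?nc_ge0 ?nc_cc ?nc_qk.
move=> M; rewrite -mulr_sumr ler_pM2l //.
rewrite -(@ler_pXn2r _ 2) ?nnegrE //; last by apply: sumr_ge0 => i _; exact: gapI_ge0.
exact: le_trans (gap_sum L0 M k0) hB.
Qed.

(** Bound for [Gk], hence a Lipschitz constant of [Ek]: 8 from [nc_cc] and the square of [nc_qk],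
    times the 4 of [gap_sum_sq]. *)
Definition rk : R := 32 / (L ^+ 2 * k%:R ^+ 2).

Lemma Gk_le d : nc d <= rho ->
  summ (fun n => cc n * qk k d n ^+ 2) /\ nc (Gk k d) <= rk.
Proof.
move=> hd; apply: (@csum_dom _ (fun n => 8 * gapI k n ^+ 2)).
  move=> n; rewrite ncM; have -> : 8 * gapI k n ^+ 2 = 2 * (2 * gapI k n) ^+ 2 by ring.
  apply: ler_pM; rewrite ?nc_ge0 ?nc_cc // !expr2 ncM.
  by apply: ler_pM; rewrite ?nc_ge0 ?nc_qk.
move=> M; rewrite -mulr_sumr; have := gap_sum_sq L0 M k0; rewrite /rk; lra.
Qed.

Lemma Ek_lip d e : nc d <= rho -> nc e <= rho ->
  summ (fun n => cc n * qk k d n) -> summ (fun n => cc n * qk k e n) ->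
  nc (Ek k d - Ek k e) <= rk * nc (d - e).
Proof.
move=> hd he sd se.
have -> : Ek k d - Ek k e = csum (fun n => cc n * qk k d n + (-1) * (cc n * qk k e n)).
  by rewrite csumD ?csumZ ?mulN1r //; exact: summZ.
have [||_ h] := @csum_dom (fun n => cc n * qk k d n + (-1) * (cc n * qk k e n))
  (fun n => 8 * gapI k n ^+ 2 * nc (d - e)) (rk * nc (d - e)); last exact: h.
  move=> n.
  have -> : cc n * qk k d n + -1 * (cc n * qk k e n) = cc n * (qk k d n * qk k e n * (e - d)).
    rewrite /qk; case: ifPn => nk; first by rewrite !(mulr0, mul0r) addr0.
    by field; rewrite !shift_neq0.
  rewrite !ncM mulrA [nc (e - d)]ncC ler_wpM2r ?nc_ge0 //.
  have -> : 8 * gapI k n ^+ 2 = 2 * ((2 * gapI k n) * (2 * gapI k n)) by ring.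
  by apply: ler_pM; rewrite ?mulr_ge0 ?nc_ge0 ?nc_cc //; apply: ler_pM; rewrite ?nc_ge0 ?nc_qk.
move=> M; rewrite -mulr_suml ler_wpM2r ?nc_ge0 // -mulr_sumr.
have := gap_sum_sq L0 M k0; rewrite /rk; lra.
Qed.

End Estimates.

Lemma Im_inv (z : C) : complex.Im (z^-1) = - complex.Im z / nc z ^+ 2.
Proof. by rewrite nc_sq; case: z => x y; rewrite /= mulNr. Qed.

Variable tau : C.
Hypothesis tau0 : 0 < complex.Im tau.

(** If |E_k| <= |tau| / 2, then |2 / (tau - E_k)| <= 4 / |tau| = [rho]. A root also has |d| >= 1 /
    |tau| and Im (1 / d) >= Im tau / 4, whence Im d = - |d|^2 Im (1 / d) <= - [gam]. *)
Definition rho : R := 4 / nc tau.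
Definition gam : R := complex.Im tau / (4 * nc tau ^+ 2).

Lemma tau_im : complex.Im tau <= nc tau.
Proof. exact: le_trans (ler_norm _) (nc_Im tau). Qed.
Lemma tau_gt0 : 0 < nc tau. Proof. exact: lt_le_trans tau_im. Qed.
Lemma rho_gt0 : 0 < rho. Proof. by rewrite divr_gt0 // tau_gt0. Qed.
Lemma gam_gt0 : 0 < gam. Proof. by rewrite divr_gt0 // mulr_gt0 // exprn_gt0 // tau_gt0. Qed.

Lemma root_exists : exists K0, forall k, (K0 <= k)%N -> (0 < k)%N -> exists d,
  [/\ 2 * rho <= L * k%:R, nc d <= rho, complex.Im d <= - gam,
      summ (fun n => cc n * qk k d n) & d * (tau - Ek k d) = 2]
  /\ rk k <= (rho ^+ 2)^-1.
Proof.
have t0 := tau_gt0; have r0 := rho_gt0; pose I := complex.Im tau; pose t := nc tau.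
rewrite -/t in t0; have I0 : 0 < I := tau0.
have r0' := ltW r0; have L0' := ltW L0.
have L2 : 0 < L ^+ 2 by rewrite exprn_gt0.
have hlp x y M : 0 < M -> 0 < y -> x / (L ^+ 2 * M) <= y -> x / (L ^+ 2 * y) <= M.
  move=> M0 y0; rewrite !ler_pdivrMr ?mulr_gt0 //.
  by rewrite mulrCA [M * _]mulrCA [y * M]mulrC.
have hp x M : 0 <= x -> 0 < M -> 0 <= x / (L ^+ 2 * M).
  by move=> x0 M0; rewrite divr_ge0 // mulr_ge0 // ltW.
have M1 : 0 < (I / 8) ^+ 2 by rewrite exprn_gt0 // divr_gt0.
have M2 : 0 < t ^+ 2 / 32 by rewrite divr_gt0 // exprn_gt0.
have M3 : 0 < (rho ^+ 2)^-1 by rewrite invr_gt0 exprn_gt0.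
have a1 : 0 <= 2 * rho / L by apply: divr_ge0 => //; apply: mulr_ge0.
have a2 := hp 8 _ (ler0n _ _) M1; have a3 := hp 32 _ (ler0n _ _) M2.
have a4 := hp 32 _ (ler0n _ _) M3.
(* Four thresholds on k: the disc fits in the gaps, |E_k| <= Im tau / 2, the map is a contraction,
   and [rk] is at most 1 / rho^2, which later bounds the normalising factor of the generalized
   eigenvectors. *)
pose X := 2 * rho / L + 8 / (L ^+ 2 * (I / 8) ^+ 2) + 32 / (L ^+ 2 * (t ^+ 2 / 32)) +
  32 / (L ^+ 2 * (rho ^+ 2)^-1).
have [K0 hK0] : exists K0 : nat, X <= K0%:R.
  by exists (Num.truncn X).+1; rewrite ltW // truncnS_gt.
exists K0 => k K0k k0.
have kX : X <= k%:R by apply: le_trans hK0 _; rewrite ler_nat.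
have k1 : 1 <= k%:R :> R by rewrite ler1n.
have kk : k%:R <= k%:R ^+ 2 :> R by rewrite expr2 ler_peMl.
have kp : 0 < k%:R :> R by rewrite ltr0n.
have kp2 : 0 < k%:R ^+ 2 :> R by rewrite exprn_gt0.
move: kX; rewrite /X; clear hK0 X.
move: a1 a2 a3 a4; set x1 := _ / L; set x2 := _ / _; set x3 := _ / (_ * (_ / 32)).
set x4 := _ / _ => a1 a2 a3 a4 kX.
have [e1 e2 e3 e4] : [/\ x1 <= k%:R, x2 <= k%:R, x3 <= k%:R & x4 <= k%:R].
  by move: k%:R kX => kr kX; clear -a1 a2 a3 a4 kX; split; lra.
have hk : 2 * rho <= L * k%:R by move: e1; rewrite /x1 ler_pdivrMr // [_ * L]mulrC.
have hB : 8 / (L ^+ 2 * k%:R) <= (I / 8) ^+ 2 by exact: hlp e2.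
have r4 : rk k <= t ^+ 2 / 32 by apply: hlp => //; exact: le_trans e3 kk.
have r5 : rk k <= (rho ^+ 2)^-1 by apply: hlp => //; exact: le_trans e4 kk.
clear e1 e2 e3 e4 kX a1 a2 a3 a4 x1 x2 x3 x4 hp hlp M1 M2 M3.
have I8 : 0 <= I / 8 by rewrite divr_ge0 // ltW.
have hE d : nc d <= rho -> summ (fun n => cc n * qk k d n) /\ nc (Ek k d) <= I / 2.
  move=> hd; have [s b] := Ek_le k0 hk hd I8 hB; split=> //; lra.
have It : I <= t by exact: tau_im.
have lowd d : nc d <= rho -> t / 2 <= nc (tau - Ek k d).
  move=> hd; have [_ b] := hE d hd; have := ncD (tau - Ek k d) (Ek k d); rewrite subrK -/t; lra.
have nz d : nc d <= rho -> tau - Ek k d != 0.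
  by move=> hd; apply/eqP => h; have := lowd d hd; rewrite h nc0; lra.
have nc2 : nc (2 : C) = 2.
  have -> : 2 = (2 : R)%:C%C :> C by rewrite rmorphMn.
  by rewrite ncR ger0_norm.
have [||d hd Td] := @contraction_fix (fun d => 2 / (tau - Ek k d)) rho (ltW r0).
- move=> d hd; rewrite ncM ncV nc2 /rho -/t ler_pdivrMr; last by have := lowd d hd; lra.
  rewrite mulrAC ler_pdivlMr //; have := lowd d hd; lra.
- move=> d e hd he; have n1 := nz d hd; have n2 := nz e he.
  have -> : 2 / (tau - Ek k d) - 2 / (tau - Ek k e) =
      2 * (Ek k d - Ek k e) / ((tau - Ek k d) * (tau - Ek k e)).
    by field; rewrite n1 n2.
  have [sd _] := hE d hd; have [se _] := hE e he.
  have lip := Ek_lip k0 hk hd he sd se.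
  have b1 := lowd d hd; have b2 := lowd e he.
  rewrite !ncM ncV ncM nc2 ler_pdivrMr ?mulr_gt0 ?(lt_le_trans _ b1) ?(lt_le_trans _ b2) ?divr_gt0 //.
  have p0 := nc_ge0 (d - e).
  have b3 : t / 2 * (t / 2) <= nc (tau - Ek k d) * nc (tau - Ek k e).
    by apply: ler_pM; rewrite ?divr_ge0 // ltW.
  have b4 : rk k * nc (d - e) <= t ^+ 2 / 32 * nc (d - e) by rewrite ler_wpM2r.
  have b5 := ler_wpM2l p0 b3.
  have -> : 2^-1 * nc (d - e) * (nc (tau - Ek k d) * nc (tau - Ek k e)) =
    2^-1 * (nc (d - e) * (nc (tau - Ek k d) * nc (tau - Ek k e))) by rewrite -!mulrA.
  move: b5; rewrite (_ : nc (d - e) * (t / 2 * (t / 2)) = t ^+ 2 * nc (d - e) / 4); last by field.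
  have : 0 <= t ^+ 2 * nc (d - e) by rewrite mulr_ge0 // sqr_ge0.
  move: b4; rewrite (_ : t ^+ 2 / 32 * nc (d - e) = t ^+ 2 * nc (d - e) / 32); last by ring.
  move: lip; set u1 := rk k * _; set u2 := t ^+ 2 * _; set u3 := nc (d - e) * _; lra.
exists d; split=> //; have [sd bE] := hE d hd; have n1 := nz d hd.
have e2 : d * (tau - Ek k d) = 2 by rewrite -{1}Td divfK.
split=> //.
have d0 : d != 0.
  by apply/eqP => h; move: e2; rewrite h mul0r => /esym/eqP; rewrite pnatr_eq0.
(* Inverting the equation isolates tau, so that Im (1 / d) is half of Im tau up to the error Im
   E_k. *)
have eV : d^-1 + d^-1 = tau - Ek k d.
  rewrite -[RHS](mulKf d0) e2 -mulr2n mulr_natr //.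
have imE : `|complex.Im (Ek k d)| <= I / 2 by apply: le_trans (nc_Im _) bE.
have ImV : I / 4 <= complex.Im (d^-1).
  have := congr1 (@complex.Im R) eV; rewrite ImD ImD ImN -/I.
  by move: imE; rewrite ler_norml => /andP[_]; lra.
have dp : 0 < nc d by exact: nc_gt0.
have dt : t^-1 <= nc d.
  have := congr1 nc e2; rewrite ncM nc2 => e3.
  have b : nc (tau - Ek k d) <= 2 * t by have := ncB tau (Ek k d); rewrite -/t; lra.
  rewrite -[_^-1]mul1r ler_pdivrMr //; have := ler_wpM2l (ltW dp) b; rewrite e3; lra.
move: ImV; rewrite Im_inv ler_pdivlMr ?exprn_gt0 // => h.
have h2 : t^-1 ^+ 2 <= nc d ^+ 2 by rewrite ler_pXn2r ?nnegrE ?invr_ge0 ?(ltW t0) // ltW.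
have h3 := ler_wpM2l (ltW (divr_gt0 I0 (ltr0n _ 4))) h2.
have -> : gam = I / 4 * t^-1 ^+ 2 by rewrite /gam -/I -/t exprVn invfM mulrA.
lra.
Qed.

End Roots.

(** * The scalar operator: existence, dense range, sign of the eigenvalues *)

Section ScalarOperator.
Variable R : realType.
Local Notation C := R[i].
Local Notation nc := (@Normc.normc R).
Local Notation H := (ell2T R).
Local Notation delta := (@delta R).

(** Summability and value in one relation, so that identities between series reduce to identities
    between terms. *)
Definition hsum (u : nat -> C) (s : C) : Prop := summ u /\ csum u = s.

Lemma hsumD u v s t : hsum u s -> hsum v t -> hsum (fun n => u n + v n) (s + t).
Proof. by move=> [su <-] [sv <-]; split; [exact: summD|exact: csumD]. Qed.
Lemma hsumZ c u s : hsum u s -> hsum (fun n => c * u n) (c * s).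
Proof. by move=> [su <-]; split; [exact: summZ|exact: csumZ]. Qed.
Lemma hsum1 k z : hsum (fun i => if i == k then z else 0) z.
Proof. by have [] := csum_single k z. Qed.
Lemma eq_hsum u v s : (forall n, u n = v n) -> hsum u s -> hsum v s.
Proof. by move=> /funext ->. Qed.
Lemma hsum_unique u s t : hsum u s -> hsum u t -> s = t.
Proof. by move=> [_ <-] [_ <-]. Qed.
Lemma hsum_ccvg u s : hsum u s -> ccvg (fun N => \sum_(i < N) u i) s.
Proof. by move=> [su <-]; exact: csumP. Qed.

Lemma dot_hsum (a x : H) : hsum (fun n => a n * x n) (csum (fun n => a n * x n)) /\
  nc (csum (fun n => a n * x n)) <= nm a * nm x.
Proof.
have [] := @csum_dom R (fun n => a n * x n) (fun n => nc (a n) * nc (x n)) (nm a * nm x).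
- by move=> n; rewrite ncM.
- move=> M; rewrite -(@ler_pXn2r _ 2) ?nnegrE ?mulr_ge0 ?nm_ge0 //; last first.
    by apply: sumr_ge0 => i _; rewrite mulr_ge0 ?nc_ge0.
  rewrite (le_trans (sum_cs _ (fun i => nc (a i)) (fun i => nc (x i)))) // exprMn.
  by apply: ler_pM; rewrite ?sum_nc2_ge0 //; exact: nm_sq.
by move=> s b; do !split.
Qed.

(** Bilinear, without conjugation: it applies a row of a matrix to a vector. *)
Definition dot (a x : H) : C := csum (fun n => a n * x n).

Lemma dot_lin (a : H) c x y : dot a (c *: x + y) = c * dot a x + dot a y.
Proof.
have [h _] := dot_hsum a (c *: x + y); apply: (hsum_unique h).
apply: (eq_hsum _ (hsumD (hsumZ c (dot_hsum a x).1) (dot_hsum a y).1)) => n.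
by rewrite HD HZ; ring.
Qed.

Lemma blin_diag (a : nat -> C) M : (forall n, nc (a n) <= M) ->
  exists2 D : H -> H, blin D & forall x n, D x n = a n * x n.
Proof.
move=> hM; have M0 : 0 <= M by apply: le_trans (hM 0%N); exact: nc_ge0.
have bd (x : H) : sqbnd (fun n => a n * x n) ((M * nm x) ^+ 2).
  move=> N; apply: (@le_trans _ _ (\sum_(i < N) M ^+ 2 * nc (x i) ^+ 2)).
    apply: ler_sum => i _; rewrite ncM exprMn ler_wpM2r ?sqr_ge0 //.
    by rewrite ler_pXn2r ?nnegrE ?nc_ge0.
  by rewrite -mulr_sumr exprMn ler_wpM2l ?sqr_ge0 //; exact: nm_sq.
have el (x : H) : ell2 (fun n => a n * x n) by apply/ell2P; exists ((M * nm x) ^+ 2).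
exists (fun x => mkH (el x)) => //; split.
  move=> c x y; apply: HE => n.
  change (a n * (c *: x + y) n = (c *: mkH (el x) + mkH (el y)) n); rewrite !HD !HZ.
  change (a n * (c * x n + y n) = c * (a n * x n) + a n * y n); ring.
exists (M + 1); first by rewrite ltr_wpDl.
move=> x; apply: (@le_trans _ _ (M * nm x)).
  by apply: nm_le; [rewrite mulr_ge0 ?nm_ge0|exact: bd].
by rewrite ler_wpM2r ?nm_ge0 // lerDl.
Qed.

Variable L : R.
Hypothesis L0 : 0 < L.
Local Notation lam := (@lam R L).
Local Notation gapI := (@gapI R L).
Local Notation cl := (@cl R L).
Local Notation cc := (@cc R).
Local Notation qk := (@qk R L).
Local Notation Ek := (@Ek R L).
Local Notation Gk := (@Gk R L).

(** As [cl 0 = 0], the convention for the inverse of 0 gives [lamI 0 = 0], so mode 0 drops out of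
    all sums over [lamI]. *)
Definition lamI (n : nat) : C := (cl n)^-1.
Definition s2 : C := (Num.sqrt 2)%:C%C.

Lemma s2_sq : s2 * s2 = 2.
Proof. by rewrite -rmorphM -expr2 sqr_sqrtr ?ler0n // rmorphMn. Qed.
Lemma s2_neq0 : s2 != 0.
Proof. by apply/eqP => h; have := s2_sq; rewrite h mul0r => /esym/eqP; rewrite pnatr_eq0. Qed.
Lemma s2V : s2^-1 = s2 / 2.
Proof. by apply: (mulfI s2_neq0); rewrite divff ?s2_neq0 // mulrA s2_sq divff // pnatr_eq0. Qed.
Lemma nc_s2 : nc s2 <= 2.
Proof.
rewrite ncR ger0_norm ?sqrtr_ge0 // -[leRHS]ger0_norm // -sqrtr_sqr ler_wsqrtr //.
by rewrite expr2; lra.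
Qed.

Lemma cl0 : cl 0 = 0. Proof. by rewrite /cl lam0. Qed.
Lemma cl_neq0 n : (0 < n)%N -> cl n != 0.
Proof.
by move=> n0; rewrite /cl (fmorph_eq0 (@real_complex R)) gt_eqF // lam_gt0.
Qed.
Lemma lamI0 : lamI 0 = 0. Proof. by rewrite /lamI cl0 invr0. Qed.
Lemma nc_lamI n : nc (lamI n.+1) = (lam n.+1)^-1.
Proof. by rewrite /lamI ncV ncR gtr0_norm // lam_gt0. Qed.

Lemma nc_lamI_le n : nc (lamI n) <= L^-1.
Proof.
case: n => [|n]; first by rewrite lamI0 nc0 invr_ge0 ltW.
rewrite nc_lamI lef_pV2 ?posrE ?lam_gt0 // /lam ler_peMr ?(ltW L0) //.
by rewrite expr_ge1 ?ler0n // ler1n.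
Qed.

Lemma lamI_hsum : hsum lamI (csum lamI).
Proof.
split=> //; exists (2 / L) => -[|M]; first by rewrite big_ord0 divr_ge0 ?ler0n ?ltW.
rewrite big_ord_recl lamI0 nc0 add0r; apply: le_trans (lam_sum L0 M).
by rewrite le_eqVlt; apply/orP; left; apply/eqP; apply: eq_bigr => i _; exact: nc_lamI.
Qed.

Lemma wv_ell2 : ell2 (fun n => - s2 * lamI n).
Proof.
apply/ell2P; exists (nc s2 ^+ 2 * (2 / L ^+ 2)) => -[|M].
  by rewrite big_ord0 mulr_ge0 ?divr_ge0 ?ler0n ?sqr_ge0.
rewrite big_ord_recl lamI0 mulr0 nc0 expr0n add0r.
apply: (@le_trans _ _ (nc s2 ^+ 2 * \sum_(i < M) (lam i.+1)^-1 ^+ 2)); last first.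
  by rewrite ler_wpM2l ?sqr_ge0 ?lam_sum_sq.
rewrite mulr_sumr; apply: ler_sum => i _.
by rewrite ncM ncN exprMn (nc_lamI i).
Qed.

Definition wv : H := mkH wv_ell2.

Lemma wvE n : wv n = - s2 * lamI n. Proof. by []. Qed.
Lemma wv0 : wv 0%N = 0. Proof. by rewrite wvE lamI0 mulr0. Qed.

Variable th : C.

Lemma diag_bound n : nc (if n == 0%N then th else lamI n) <= nc th + L^-1.
Proof.
case: ifP => _; first by rewrite lerDl invr_ge0 ltW.
by apply: (le_trans (nc_lamI_le n)); rewrite lerDr nc_ge0.
Qed.

(** An arrow matrix: a bounded diagonal, plus row 0 and column 0, both carrying the square summable
    vector [wv]. *)
Lemma Rop_exists : exists T : H -> H, [/\ blin T,
  forall x, T x 0%N = th * x 0%N + dot wv x &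
  forall x n, (0 < n)%N -> T x n = lamI n * x n + x 0%N * wv n].
Proof.
have [D bD DE] := blin_diag diag_bound.
have b0 : blin (fun x => x 0%N *: wv).
  split=> [c x y|]; first by rewrite HD HZ scalerDl scalerA.
  exists (nm wv + 1) => [|x]; first by rewrite ltr_wpDl ?nm_ge0.
  rewrite (le_trans (nmZ_le _ _)) // mulrC ler_pM ?nc_ge0 ?nm_ge0 ?nm_coord //.
  by rewrite lerDl.
have b1 : blin (fun x => dot wv x *: delta 0).
  split=> [c x y|]; first by rewrite dot_lin scalerDl scalerA.
  exists ((nm wv + 1) * (nm (delta 0) + 1)) => [|x].
    by rewrite mulr_gt0 // ltr_wpDl ?nm_ge0.
  rewrite (le_trans (nmZ_le _ _)) //.
  apply: (@le_trans _ _ (nm wv * nm x * nm (delta 0))).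
    by rewrite ler_wpM2r ?nm_ge0 // (dot_hsum wv x).2.
  rewrite mulrAC ler_wpM2r ?nm_ge0 // ler_pM ?nm_ge0 // lerDl //.
exists (fun x => D x + (x 0%N *: wv + dot wv x *: delta 0)); split.
- by apply: blinDf => //; exact: blinDf.
- by move=> x; rewrite !HD !HZ DE eqxx wv0 mulr0 add0r delta_same mulr1.
- move=> x n n0; rewrite !HD !HZ DE gtn_eqF // deltaE gtn_eqF //.
  by rewrite mulr0 addr0.
Qed.

Variable T : H -> H.
Hypotheses (bT : blin T) (T0 : forall x, T x 0%N = th * x 0%N + dot wv x)
  (TS : forall x n, (0 < n)%N -> T x n = lamI n * x n + x 0%N * wv n).

Lemma T_delta n : (0 < n)%N -> T (cl n *: delta n) = delta n - s2 *: delta 0.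
Proof.
move=> n0; apply: HE => i; have [->|i0] := posnP i.
  rewrite T0 HZ !HB_ !HZ !deltaE (ltn_eqF n0) eqxx !mulr0 !add0r mulr1.
  have [h _] := dot_hsum wv (cl n *: delta n); apply: (hsum_unique h).
  apply: (eq_hsum _ (hsum1 n (- s2))) => j; rewrite HZ deltaE wvE.
  case: eqP => [->|_]; last by rewrite !mulr0.
  by rewrite mulr1 -mulrA mulVf ?mulr1 // cl_neq0.
rewrite TS // !HZ !HB_ !HZ !deltaE (ltn_eqF n0) (gtn_eqF i0) !mulr0 mul0r subr0 addr0.
case: eqP => [->|_]; last by rewrite !mulr0.
by rewrite mulr1 mulVf // cl_neq0.
Qed.

Lemma nm_delta_sum J : nm (\sum_(j < J) delta j.+1) <= Num.sqrt J%:R.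
Proof.
apply: nm_le; first exact: sqrtr_ge0.
move=> M; rewrite sqr_sqrtr ?ler0n //.
apply: (@le_trans _ _ (\sum_(i < M) \sum_(j < J) (if i == j.+1 :> nat then 1 else 0))).
  apply: ler_sum => i _; rewrite (sumH J (fun j => delta j.+1)).
  have [h|h] := boolP [exists j : 'I_J, i == j.+1 :> nat].
    have /existsP[j /eqP ij] := h.
    rewrite (bigD1 j) //= [leRHS](bigD1 j) //= deltaE ij eqxx !big1 ?addr0.
    - by rewrite nc1 expr1n.
    - by move=> j' /negbTE; rewrite eqSS eq_sym -val_eqE /= => ->.
    - by move=> j' /negbTE; rewrite deltaE eqSS eq_sym -val_eqE /= => ->.
  rewrite big1 ?nc0 ?expr0n ?sumr_ge0 //; first by move=> j _; case: ifP.
  move=> j _; rewrite deltaE; case: eqP => // ij.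
  by move: h; rewrite negb_exists => /forallP/(_ j); rewrite ij eqxx.
rewrite exchange_big /=; apply: (@le_trans _ _ (\sum_(j < J) 1)).
  by apply: ler_sum => j _; exact: (sum_one M j.+1 ler01).
by rewrite sumr_const card_ord.
Qed.

(** [T] maps lam_n delta_n to delta_n - sqrt 2 delta_0, so averaging J of these reaches delta_0 up
    to a vector of norm at most J^(-1/2). All preimages vanish at coordinate 0, where the coupling
    between the two copies would act. *)
Lemma range_dense k e : 0 < e -> exists2 g : H, g 0%N = 0 & nm (T g - delta k) <= e.
Proof.
have base e1 : 0 < e1 -> exists2 g : H, g 0%N = 0 & nm (T g - delta 0) <= e1.
  move=> e0; pose J := (Num.truncn (e1 ^+ 2)^-1).+1.
  have hJ : (e1 ^+ 2)^-1 <= J%:R by rewrite ltW // truncnS_gt.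
  have J0 : 0 < J%:R :> R by rewrite ltr0n.
  have Jn : (J%:R : C) != 0 by rewrite pnatr_eq0.
  pose g := (- (J%:R * s2)^-1) *: \sum_(j < J) cl j.+1 *: delta j.+1.
  exists g.
    rewrite HZ (sumH J (fun j => cl j.+1 *: delta j.+1)) big1 ?mulr0 // => i _.
    by rewrite HZ deltaE mulr0.
  have -> : T g - delta 0 = (- (J%:R * s2)^-1) *: \sum_(j < J) delta j.+1.
    rewrite /g blinZ // (@blin_sum R T J (fun j => cl j.+1 *: delta j.+1)) //.
    under eq_bigr do rewrite T_delta //.
    rewrite sumrB sumr_const card_ord -(scaler_nat J (s2 *: delta 0)) scalerA scalerBr scalerA mulNr.
    by rewrite mulVf ?mulf_neq0 ?s2_neq0 // scaleN1r opprK addrK.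
  rewrite (le_trans (nmZ_le _ _)) // ncN ncV ncM.
  have -> : nc (J%:R : C) = J%:R.
    have -> : (J%:R : C) = (J%:R : R)%:C%C by rewrite rmorph_nat.
    by rewrite ncR ger0_norm ?ler0n.
  have s1 : 1 <= nc s2.
    rewrite ncR ger0_norm ?sqrtr_ge0 // -{1}sqrtr1 ler_wsqrtr //; lra.
  pose S : R := Num.sqrt J%:R; have S0 : 0 < S by rewrite sqrtr_gt0.
  have SS : J%:R = S * S by rewrite -expr2 sqr_sqrtr // ltW.
  apply: (@le_trans _ _ ((J%:R * nc s2)^-1 * S)).
    by rewrite ler_wpM2l ?nm_delta_sum // invr_ge0 mulr_ge0 ?nc_ge0 ?(ltW J0).
  apply: (@le_trans _ _ S^-1).
    rewrite SS -mulrA invfM -[leRHS]mulr1 -mulrA ler_wpM2l ?invr_ge0 ?(ltW S0) //.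
    rewrite mulrC ler_pdivrMr ?mul1r ?mulr_gt0 ?(lt_le_trans ltr01 s1) //.
    by rewrite ler_peMr ?(ltW S0).
  rewrite -[e1]invrK lef_pV2 ?posrE ?invr_gt0 // -(@ler_pXn2r _ 2) ?nnegrE ?invr_ge0 ?(ltW S0) ?(ltW e0) //.
  by rewrite exprVn [S ^+ 2]expr2 -SS.
case: k => [|k] e0; first exact: base.
have [g g0 hg] := base (e / 2) (divr_gt0 e0 (ltr0n _ 2)).
exists (cl k.+1 *: delta k.+1 + s2 *: g).
  by rewrite HD !HZ deltaE g0 !mulr0 addr0.
rewrite blinD // T_delta // (blinZ s2 g bT).
have -> : delta k.+1 - s2 *: delta 0 + s2 *: T g - delta k.+1 = s2 *: (T g - delta 0).
  by rewrite scalerBr addrAC addrC; congr (_ + _); rewrite addrAC subrr add0r.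
rewrite (le_trans (nmZ_le _ _)) //; have := nc_s2; have := nm_ge0 (T g - delta 0); nra.
Qed.

(** The imaginary part of z times the conjugate of w. *)
Definition im2 (z w : C) : R := complex.Im z * complex.Re w - complex.Re z * complex.Im w.

Lemma im2D z v w : im2 z (v + w) = im2 z v + im2 z w.
Proof. by rewrite /im2 ReD ImD; ring. Qed.

Lemma im2_ge0 (z w nu : C) (r q : R) : 0 < q -> complex.Im nu <= 0 ->
  r%:C%C * z - q%:C%C * r%:C%C * w = nu * z -> 0 <= im2 w (r%:C%C * z).
Proof.
move=> q0 nu0 h; rewrite -(pmulr_rge0 _ q0).
have h1 := congr1 (@complex.Re R) h; have h2 := congr1 (@complex.Im R) h.
move: h1 h2 nu0; rewrite /im2 ?(ReD, ImD, ReN, ImN, Re_mul, Im_mul).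
case: z w nu {h} => [x1 x2] [y1 y2] [n1 n2] /= h1 h2 nu0.
have -> : q * (y2 * (r * x1 - 0 * x2) - y1 * (r * x2 + 0 * x1)) = - n2 * (x1 ^+ 2 + x2 ^+ 2).
  have e1 : q * r * y1 = r * x1 - n1 * x1 + n2 * x2 by move: h1; lra.
  have e2 : q * r * y2 = r * x2 - n1 * x2 - n2 * x1 by move: h2; lra.
  have -> : q * (y2 * (r * x1 - 0 * x2) - y1 * (r * x2 + 0 * x1)) =
    (q * r * y2) * x1 - (q * r * y1) * x2 by ring.
  by rewrite e1 e2; ring.
by rewrite mulr_ge0 ?addr_ge0 ?sqr_ge0 // oppr_ge0.
Qed.

Lemma im2_zero (z s nu : C) (q : R) : 0 < complex.Im th -> complex.Im nu <= 0 -> 0 < q ->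
  th * z - q%:C%C * s = nu * z -> 0 <= im2 z s -> z = 0.
Proof.
move=> th0 nu0 q0 h hs.
have h1 := congr1 (@complex.Re R) h; have h2 := congr1 (@complex.Im R) h.
move: h1 h2 nu0 hs th0; rewrite /im2 ?(ReD, ImD, ReN, ImN, Re_mul, Im_mul).
case: z s nu th {h} => [x1 x2] [y1 y2] [n1 n2] [t1 t2] /= h1 h2 nu0 hs th0.
have e : t2 * (x1 ^+ 2 + x2 ^+ 2) = n2 * (x1 ^+ 2 + x2 ^+ 2) - q * (x2 * y1 - x1 * y2).
  have e1 : q * y1 = t1 * x1 - t2 * x2 - n1 * x1 + n2 * x2 by move: h1; lra.
  have e2 : q * y2 = t1 * x2 + t2 * x1 - n1 * x2 - n2 * x1 by move: h2; lra.
  have -> : q * (x2 * y1 - x1 * y2) = x2 * (q * y1) - x1 * (q * y2) by ring.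
  by rewrite e1 e2; ring.
have p : 0 <= x1 ^+ 2 + x2 ^+ 2 by rewrite addr_ge0 ?sqr_ge0.
have z0 : x1 ^+ 2 + x2 ^+ 2 = 0.
  apply/eqP; rewrite eq_le p andbT -(pmulr_rle0 _ th0) e.
  have a1 := mulr_le0_ge0 nu0 p; have a2 := mulr_ge0 (ltW q0) hs.
  by rewrite subr_le0 (le_trans a1).
by move/eqP: z0; rewrite paddr_eq0 ?sqr_ge0 // !sqrf_eq0 => /andP[/eqP -> /eqP ->].
Qed.

(** Apart from the entry [th] the matrix is real symmetric, so the imaginary part of its form is Im
    th |x_0|^2. Termwise: if Im nu <= 0, each equation n > 0 gives its contribution to row 0 a sign;
    after summation, equation 0 forces x_0 = 0. *)
Lemma eigen_im (nu : C) (x : H) : 0 < complex.Im th -> T x = nu *: x -> x <> 0 ->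
  0 < complex.Im nu.
Proof.
move=> th0 e x0; rewrite ltNge; apply/negP => nu0.
pose s := csum (fun n => lamI n * x n).
have hs : hsum (fun n => lamI n * x n) s.
  split=> //; have := (hsumZ (- s2^-1) (dot_hsum wv x).1).1; congr summ; apply/funext => n.
  by rewrite wvE !mulrA mulrNN mulVf ?mul1r // s2_neq0.
have w_s : dot wv x = - s2 * s.
  have [h _] := dot_hsum wv x; apply: (hsum_unique h).
  by apply: (eq_hsum _ (hsumZ (- s2) hs)) => n; rewrite wvE mulrA.
have en n : (0 < n)%N -> lamI n * x n - s2 * lamI n * x 0%N = nu * x n.
  by move=> n0; have := congr1 (fun y : H => y n) e; rewrite /= TS // HZ wvE => <-; ring.
have e0 : th * x 0%N - s2 * s = nu * x 0%N by have := congr1 (fun y : H => y 0%N) e; rewrite /= T0 w_s HZ mulNr.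
have pos n : 0 <= im2 (x 0%N) (lamI n * x n).
  case: n => [|n]; first by rewrite lamI0 mul0r /im2 /= !mulr0 subrr.
  have rE : lamI n.+1 = ((lam n.+1)^-1)%:C%C by rewrite /lamI fmorphV.
  have := en n.+1 isT; rewrite rE; apply: im2_ge0 nu0; by rewrite sqrtr_gt0.
have sneg : 0 <= im2 (x 0%N) s.
  have [c1 c2] := hsum_ccvg hs.
  have h : im2 (x 0%N) (\sum_(i < N) lamI i * x i) @[N --> \oo] --> im2 (x 0%N) s.
    by apply: cvgB; apply: cvgM => //; exact: cvg_cst.
  rewrite -(cvg_lim (@Rhausdorff R) h); apply: limr_ge; first exact: cvgP h.
  apply: nearW => N; elim: N => [|N IH]; first by rewrite big_ord0 /im2 /= !mulr0 subrr.
  by rewrite big_ord_recr im2D addr_ge0.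
have xc0 : x 0%N = 0 by exact: im2_zero th0 nu0 _ e0 sneg.
(* With x_0 = 0 the matrix acts diagonally, so x is a multiple of a single basis vector, but row 0
   then gives [wv n0 * x n0 = 0]. *)
apply: x0; apply: contrapT => /first_coord[n0 t0 xn0].
have n0p : (0 < n0)%N by case: n0 xn0 {t0} => //; rewrite xc0 eqxx.
have nuE : nu = lamI n0.
  have := en n0 n0p; rewrite xc0 mulr0 subr0 => h; apply: (mulIf xn0); exact: esym.
have [h _] := dot_hsum wv x.
have h2 : hsum (fun n => wv n * x n) (wv n0 * x n0).
  apply: (eq_hsum _ (hsum1 n0 (wv n0 * x n0))) => n; case: eqP => [->//|nn].
  have [->|n_gt0] := posnP n; first by rewrite wv0 mul0r.
  have := en n n_gt0; rewrite xc0 mulr0 subr0 nuE => /eqP; rewrite -subr_eq0 -mulrBl mulf_eq0.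
  case/orP => [|/eqP ->]; last by rewrite mulr0.
  rewrite subr_eq0 /lamI => /eqP/invr_inj/(congr1 (@complex.Re R)) /= /(lam_inj L0) e1.
  by case: nn.
have := hsum_unique h h2; rewrite -/(dot wv x) w_s.
move: e0; rewrite xc0 !mulr0 sub0r mulNr => -> /esym/eqP; apply/negP.
by rewrite wvE !mulf_neq0 ?oppr_eq0 ?s2_neq0 // invr_eq0 cl_neq0.
Qed.

End ScalarOperator.

(** * Eigenvectors close to the basis vectors *)

Section EigenVectors.
Variable R : realType.
Local Notation C := R[i].
Local Notation nc := (@Normc.normc R).
Local Notation H := (ell2T R).
Local Notation delta := (@delta R).
Variable L : R.
Hypothesis L0 : 0 < L.
Local Notation lam := (@lam R L).
Local Notation gapI := (@gapI R L).
Local Notation cl := (@cl R L).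
Local Notation cc := (@cc R).
Local Notation qk := (@qk R L).
Local Notation Ek := (@Ek R L).
Local Notation Gk := (@Gk R L).
Local Notation lamI := (@lamI R L).
Local Notation s2 := (@s2 R).
Local Notation wv := (wv L0).

Variables (th : C) (T : H -> H).
Hypotheses (bT : blin T) (T0 : forall x, T x 0%N = th * x 0%N + dot wv x)
  (TS : forall x n, (0 < n)%N -> T x n = lamI n * x n + x 0%N * wv n).

(** Rows n > 0 of T x = x / z give x_n = sqrt 2 x_0 z / (z - lam_n). Substituted in row 0 and split
    into partial fractions, this leaves tau = sum of cc_n / (z - lam_n), where 1 / z is the term of
    mode 0. *)
Definition tauT : C := th - 2 * csum lamI.

(** With these weights the eigenvector has coordinates proportional to [wt n / (z - cl n)], mode 0
    included. *)
Definition wt (n : nat) : C := if n == 0%N then s2^-1 else 1.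

Lemma nc_s2_ge1 : 1 <= nc s2.
Proof. by rewrite ncR ger0_norm ?sqrtr_ge0 // -{1}sqrtr1 ler_wsqrtr //; lra. Qed.

Lemma nc_wt n : nc (wt n) <= 1.
Proof.
rewrite /wt; case: ifP => _; last by rewrite nc1.
by rewrite ncV invf_le1 ?nc_s2_ge1 // (lt_le_trans ltr01 nc_s2_ge1).
Qed.

Section OneRoot.
Variables (k : nat) (d : C) (r : R).
Hypotheses (k0 : (0 < k)%N) (r0 : 0 < r) (hk : 2 * r <= L * k%:R) (hd : nc d <= r)
  (sq : summ (fun n => cc n * qk k d n)) (hroot : d * (tauT - Ek k d) = 2)
  (hrk : rk L k <= (r ^+ 2)^-1).

Let z : C := cl k + d.
(** Minus the derivative in [d] of 2 / d + E_k (d). *)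
Let G : C := 2 / d ^+ 2 + Gk k d.
Let pw n : C := (z - cl n)^-1.

Let kp : 0 < k%:R :> R. Proof. by rewrite ltr0n. Qed.
Let Lk : 0 < L * k%:R. Proof. by rewrite mulr_gt0. Qed.

Let d_neq0 : d != 0.
Proof. by apply/eqP => h; move: hroot; rewrite h mul0r => /esym/eqP; rewrite pnatr_eq0. Qed.

Let tauE : tauT = Ek k d + 2 / d.
Proof. by rewrite -hroot mulrC mulrA mulVf // mul1r addrC subrK. Qed.

Let zn_neq0 n : z - cl n != 0.
Proof.
have [->|nk] := eqVneq n k; first by rewrite /z addrAC subrr add0r.
rewrite /z; exact: (shift_neq0 L0 k0 hk hd nk).
Qed.

Let z_neq0 : z != 0. Proof. by have := zn_neq0 0; rewrite cl0 subr0. Qed.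

Let pwE n : pw n = (if n == k then d^-1 else 0) + qk k d n.
Proof.
rewrite /pw /qk; case: eqP => [->|_]; last by rewrite add0r.
by rewrite addr0 /z addrAC subrr add0r.
Qed.

Let pw0 : pw 0 = z^-1. Proof. by rewrite /pw cl0 subr0. Qed.

Let nc2 : nc (2 : C) = 2.
Proof.
have -> : 2 = (2 : R)%:C%C :> C by rewrite rmorphMn.
by rewrite ncR ger0_norm.
Qed.

(** Then |G| >= 1 / r^2: the term 2 / d^2 is at least 2 / r^2, and by [hrk] the sum [Gk] takes away
    at most 1 / r^2. *)
Let GkP := Gk_le L0 k0 hk hd.

Let ncG : nc G^-1 <= r ^+ 2.
Proof.
have dp : 0 < nc d by exact: nc_gt0.
have r2 : 0 < r ^+ 2 by rewrite exprn_gt0.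
have h1 : (r ^+ 2)^-1 <= nc G.
  have := ncB G (Gk k d); rewrite {1}/G addrK ncM nc2 ncV expr2 ncM -expr2 => h2.
  have h3 : (r ^+ 2)^-1 <= (nc d ^+ 2)^-1.
    by rewrite lef_pV2 ?posrE ?exprn_gt0 // ler_pXn2r ?nnegrE ?nc_ge0 // ltW.
  have h4 := le_trans GkP.2 hrk; lra.
by rewrite ncV -[leRHS]invrK lef_pV2 ?posrE ?invr_gt0 // (lt_le_trans _ h1) // invr_gt0.
Qed.

Let G_neq0 : G != 0.
Proof.
apply/eqP => h; have r2 : 0 < r ^+ 2 by rewrite exprn_gt0.
have := ncB G (Gk k d); rewrite {1}/G addrK ncM nc2 ncV expr2 ncM -expr2 h nc0 => h2.
have dp : 0 < nc d by exact: nc_gt0.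
have h3 : (r ^+ 2)^-1 <= (nc d ^+ 2)^-1.
  by rewrite lef_pV2 ?posrE ?exprn_gt0 // ler_pXn2r ?nnegrE ?nc_ge0 // ltW.
have h4 := le_trans GkP.2 hrk; have : 0 < (r ^+ 2)^-1 by rewrite invr_gt0.
lra.
Qed.

Let ncq n : nc (qk k d n) <= 2 * gapI k n := nc_qk L0 k0 hk n hd.

Let ncq1 n : r * nc (qk k d n) <= 1.
Proof.
have [->|nk] := eqVneq n k; first by rewrite /qk eqxx nc0 mulr0.
have h1 : gapI k n <= (L * k%:R)^-1.
  rewrite /gapI (negbTE nk) lef_pV2 ?posrE //; last first.
    exact: lt_le_trans Lk (lam_gap_ge L0 nk).
  exact: lam_gap_ge.
have h2 : r * (L * k%:R)^-1 <= 2^-1 by have := hk; rewrite ler_pdivrMr //; lra.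
have h3 := ler_wpM2l (ltW r0) (ncq n); have h4 := ler_wpM2l (ltW r0) h1; lra.
Qed.

Let ell_gap (u : nat -> C) (c : R) : 0 <= c -> (forall n, nc (u n) <= c * gapI k n) ->
  sqbnd u ((2 * c / (L * k%:R)) ^+ 2).
Proof.
move=> c0 hu M; apply: (@le_trans _ _ (\sum_(n < M) c ^+ 2 * gapI k n ^+ 2)).
  apply: ler_sum => i _; rewrite -exprMn ler_pXn2r ?nnegrE ?nc_ge0 ?mulr_ge0 //.
  exact: gapI_ge0.
rewrite -mulr_sumr; apply: le_trans (ler_wpM2l (sqr_ge0 c) (gap_sum_sq L0 M k0)) _.
rewrite le_eqVlt; apply/orP; left; apply/eqP.
by field; rewrite !gt_eqF.
Qed.

(** The factor [d] normalises the k-th coordinate of the eigenvector to 1; [V] consists of all the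
    others. *)
Let V_bd : sqbnd (fun n => d * wt n * qk k d n) ((2 * (2 * r) / (L * k%:R)) ^+ 2).
Proof.
apply: ell_gap => [|n]; first by rewrite mulr_ge0 // ltW.
rewrite !ncM; have := nc_wt n; have := ncq n; have := nc_ge0 (wt n).
have := nc_ge0 (qk k d n); have := nc_ge0 d => a1 a2 a3 a4 a5.
have b1 : nc d * nc (wt n) <= r by rewrite -[leRHS]mulr1 ler_pM.
have -> : 2 * r * gapI k n = r * (2 * gapI k n) by ring.
by apply: ler_pM => //; exact: mulr_ge0.
Qed.

Let V : H := mkH ((ell2P _).2 (ex_intro _ _ V_bd)).
Let F : H := delta k + V.

Let FE n : F n = d * wt n * pw n.
Proof.
rewrite /F HD deltaE pwE mulrDr; congr (_ + _); case: eqP => [->|_]; last by rewrite mulr0.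
by rewrite /wt gtn_eqF // mulr1 divff.
Qed.

Let F0 : F 0%N = d * s2^-1 * z^-1. Proof. by rewrite FE pw0 /wt eqxx. Qed.

Let nmV : nm (F - delta k) <= 2 * (2 * r) / (L * k%:R).
Proof.
have -> : F - delta k = V by rewrite /F addrC addrA addNr add0r.
apply: nm_le; last exact: V_bd.
by apply: divr_ge0; [do 2![apply: mulr_ge0; first exact: ler0n]|]; exact: ltW.
Qed.

(** [P] is the derivative of [F] in [d], divided by [G]. Its k-th coordinate is 0, because that of
    [F] is constantly 1. *)
Let P_bd : sqbnd (fun n => G^-1 * wt n * (qk k d n - d * qk k d n ^+ 2))
  ((2 * (4 * r ^+ 2) / (L * k%:R)) ^+ 2).
Proof.
apply: ell_gap => [|n]; first by rewrite mulr_ge0 ?sqr_ge0.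
have -> : G^-1 * wt n * (qk k d n - d * qk k d n ^+ 2) =
  (G^-1 * wt n) * (qk k d n * (1 - d * qk k d n)) by ring.
have b1 : nc (G^-1 * wt n) <= r ^+ 2.
  by rewrite ncM -[leRHS]mulr1 ler_pM ?nc_ge0 ?nc_wt.
have b2 : nc (1 - d * qk k d n) <= 2.
  apply: (le_trans (ncB _ _)); rewrite nc1 ncM.
  have := ncq1 n; have := ler_wpM2r (nc_ge0 (qk k d n)) hd; lra.
have b3 : nc (qk k d n * (1 - d * qk k d n)) <= 2 * gapI k n * 2.
  by rewrite ncM ler_pM ?nc_ge0.
rewrite ncM; apply: (@le_trans _ _ (r ^+ 2 * (2 * gapI k n * 2))).
  by rewrite ler_pM ?nc_ge0.
by rewrite le_eqVlt; apply/orP; left; apply/eqP; ring.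
Qed.

Let P : H := mkH ((ell2P _).2 (ex_intro _ _ P_bd)).

Let PE n : P n = G^-1 * (d^-1 * F n - F n * pw n).
Proof.
have -> : P n = G^-1 * wt n * (qk k d n - d * qk k d n ^+ 2) by [].
rewrite FE pwE; case: eqP => [->|_]; last first.
  by rewrite add0r; field; rewrite ?G_neq0 ?d_neq0.
by rewrite /qk eqxx; field; rewrite ?G_neq0 ?d_neq0.
Qed.

Let nmP : nm P <= 2 * (4 * r ^+ 2) / (L * k%:R).
Proof.
apply: nm_le; last exact: P_bd.
by apply: divr_ge0; [do 2![apply: mulr_ge0; first exact: ler0n]; exact: sqr_ge0|exact: ltW].
Qed.

Let sum1 : hsum (fun n => 2 * lamI n + (cc n * qk k d n + ((if n == k then 2 / d else 0) +
   (if n == 0%N then - z^-1 else 0)))) (th - z^-1).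
Proof.
have -> : th - z^-1 = 2 * csum lamI + (Ek k d + (2 / d + - z^-1)).
  by have := tauE; rewrite /tauT => /eqP; rewrite subr_eq => /eqP ->; ring.
apply: hsumD; first by apply: hsumZ; exact: lamI_hsum.
apply: hsumD => //; apply: hsumD; exact: hsum1.
Qed.

Let sum2 : hsum (fun n => cc n * qk k d n ^+ 2 + ((if n == k then 2 / d ^+ 2 else 0) +
   (if n == 0%N then - z^-1 ^+ 2 else 0))) (G - z^-1 ^+ 2).
Proof.
have -> : G - z^-1 ^+ 2 = Gk k d + (2 / d ^+ 2 + - z^-1 ^+ 2) by rewrite /G; ring.
apply: hsumD; first by split=> //; exact: GkP.1.
apply: hsumD; exact: hsum1.
Qed.

(** Partial fractions: 1 / (lam_n (z - lam_n)) = (1 / lam_n + 1 / (z - lam_n)) / z. The term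
    [- z^-1] at n = 0 compensates mode 0, as [wv] vanishes there. *)
Let term1 n : wv n * F n = - F 0%N * (2 * lamI n + (cc n * qk k d n +
  ((if n == k then 2 / d else 0) + (if n == 0%N then - z^-1 else 0)))).
Proof.
rewrite F0 s2V FE wvE; have s20 := s2_neq0 R.
have [->|n0] := posnP n.
  by rewrite lamI0 /cc /qk eqxx (ltn_eqF k0) cl0 subr0 -/z; ring.
have cn := cl_neq0 L0 n0; have zn := zn_neq0 n.
rewrite /cc /qk /wt /pw /lamI (gtn_eqF n0) -/z.
have [nk|nk] := eqVneq n k.
  have zz := z_neq0; rewrite nk /z in cn zn zz *.
  have -> : cl k + d - cl k = d by rewrite addrAC subrr add0r.
  by field; rewrite zz d_neq0 cn.
by field; rewrite z_neq0 cn zn.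
Qed.

Let term2 n : wv n * (F n * pw n) = - F 0%N * (z^-1 * (2 * lamI n + (cc n * qk k d n +
  ((if n == k then 2 / d else 0) + (if n == 0%N then - z^-1 else 0)))) +
  (cc n * qk k d n ^+ 2 + ((if n == k then 2 / d ^+ 2 else 0) +
   (if n == 0%N then - z^-1 ^+ 2 else 0)))).
Proof.
rewrite F0 s2V FE wvE; have s20 := s2_neq0 R.
have [->|n0] := posnP n.
  by rewrite lamI0 /cc /qk eqxx (ltn_eqF k0) cl0 subr0 -/z; ring.
have cn := cl_neq0 L0 n0; have zn := zn_neq0 n.
rewrite /cc /qk /wt /pw /lamI (gtn_eqF n0) -/z.
have [nk|nk] := eqVneq n k.
  have zz := z_neq0; rewrite nk /z in cn zn zz *.
  have -> : cl k + d - cl k = d by rewrite addrAC subrr add0r.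
  by field; rewrite zz d_neq0 cn.
by field; rewrite z_neq0 cn zn.
Qed.

Let dotF : dot wv F = - F 0%N * (th - z^-1).
Proof.
have [h _] := dot_hsum wv F; apply: (hsum_unique h).
by apply: (eq_hsum _ (hsumZ (- F 0%N) sum1)) => n; rewrite term1.
Qed.

Let dotP : dot wv P = G^-1 * (d^-1 * (- F 0%N * (th - z^-1)) +
  F 0%N * (z^-1 * (th - z^-1) + (G - z^-1 ^+ 2))).
Proof.
have [h _] := dot_hsum wv P; apply: (hsum_unique h).
have h1 := hsumZ (- F 0%N) sum1.
have h2 := hsumZ (F 0%N) (hsumD (hsumZ z^-1 sum1) sum2).
apply: (eq_hsum _ (hsumZ G^-1 (hsumD (hsumZ d^-1 h1) h2))) => n.
rewrite -term1 -[X in _ + X]opprK -[X in - X]mulNr -term2 PE; ring.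
Qed.

(** For any d near 0 the vector F (d) satisfies T F - F / z = F_0 (tau - sum of cc_n / (z - lam_n))
    delta_0. At a root this vanishes; its derivative there, divided by [G], is the equation for [P],
    where [c] comes from differentiating 1 / z. *)
Lemma eigen_pair : exists F P c,
  [/\ T F = z^-1 *: F, nm (F - delta k) <= 4 * r / (L * k%:R),
      T P - z^-1 *: P = c *: F + F 0%N *: delta 0, nm P <= 8 * r ^+ 2 / (L * k%:R) &
      nc c <= 2 * r / (L * k%:R)] /\ [/\ z != 0 & nc z^-1 <= 2 / (L * k%:R)].
Proof.
have zb : nc z^-1 <= 2 / (L * k%:R).
  have h1 : L * k%:R <= lam k.
    by rewrite /lam ler_pM2l // expr2 ler_peMl // ler1n.
  have h2 : lam k - r <= nc z.
    have := ncB z d; rewrite {1}/z addrK /cl ncR => h3.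
    have := ler_norm (lam k); have := hd; lra.
  have -> : 2 / (L * k%:R) = (L * k%:R / 2)^-1 by rewrite invf_div.
  have zp := nc_gt0 z_neq0.
  rewrite ncV lef_pV2 ?posrE ?divr_gt0 //; have := hk; lra.
exists F, P, (- (z^-1 ^+ 2 / G)); split; last by split.
have eF n : (0 < n)%N -> F n = d * pw n by move=> n0; rewrite FE /wt gtn_eqF // mulr1.
split.
- apply: HE => n; rewrite HZ; have [->|n0] := posnP n; first by rewrite T0 dotF; ring.
  rewrite TS // wvE F0 eF // /pw /lamI.
  have cn := cl_neq0 L0 n0; have zn := zn_neq0 n; have s20 := s2_neq0 R.
  by field; rewrite s20 z_neq0 cn zn.
- by move: nmV; congr (_ <= _); congr (_ / _); ring.
- apply: HE => n; rewrite HB_ [(_ *: F + _) n]HD !HZ deltaE; have [->|n0] := posnP n.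
    by rewrite T0 dotP PE pw0; field; rewrite G_neq0 z_neq0 d_neq0.
  rewrite TS // mulr0 addr0 !PE pw0 wvE F0 eF // /pw /lamI.
  have cn := cl_neq0 L0 n0; have zn := zn_neq0 n; have s20 := s2_neq0 R.
  by field; rewrite s20 z_neq0 cn zn G_neq0 d_neq0.
- by move: nmP; congr (_ <= _); congr (_ / _); ring.
- rewrite ncN ncM expr2 ncM.
  have h1 : nc z^-1 * r <= 1.
    have := ler_wpM2r (ltW r0) zb; have : 2 / (L * k%:R) * r <= 1.
      by rewrite mulrAC ler_pdivrMr // mul1r.
    by move=> a1 a2; exact: le_trans a2 a1.
  have p1 := nc_ge0 z^-1; have p2 := nc_ge0 G^-1.
  apply: (@le_trans _ _ (nc z^-1 * nc z^-1 * r ^+ 2)).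
    by rewrite ler_wpM2l // mulr_ge0.
  have -> : nc z^-1 * nc z^-1 * r ^+ 2 = (nc z^-1 * r) * (nc z^-1 * r) by ring.
  apply: (@le_trans _ _ (1 * (nc z^-1 * r))).
    by rewrite ler_wpM2r // mulr_ge0 // ltW.
  by rewrite mul1r; have := ler_wpM2r (ltW r0) zb; rewrite mulrAC.
Qed.

End OneRoot.

Theorem scalar_roots : 0 < complex.Im tauT ->
  exists K0 C0 g (z : nat -> C) (F P : nat -> H) (c : nat -> C),
  [/\ 0 < C0, 0 < g,
   forall k, (K0 <= k)%N -> (0 < k)%N ->
     [/\ T (F k) = (z k)^-1 *: F k, T (P k) - (z k)^-1 *: P k = c k *: F k + F k 0%N *: delta 0,
         nm (F k - delta k) <= C0 / k%:R, nm (P k) <= C0 / k%:R & nc (c k) <= C0 / k%:R],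
   forall k, (K0 <= k)%N -> (0 < k)%N ->
     [/\ z k != 0, nc (z k)^-1 <= C0 / k%:R & complex.Im (z k) <= - g] &
   forall j k, (K0 <= j)%N -> (0 < j)%N -> (K0 <= k)%N -> (0 < k)%N -> z j = z k -> j = k].
Proof.
move=> t0; have [K0 hK] := root_exists L0 t0.
pose r := rho tauT; have r0 : 0 < r by exact: rho_gt0.
have /choice[d hd] k : exists d, (K0 <= k)%N -> (0 < k)%N ->
    [/\ 2 * r <= L * k%:R, nc d <= r, complex.Im d <= - gam tauT,
      summ (fun n => cc n * qk k d n) & d * (tauT - Ek k d) = 2]
  /\ rk L k <= (r ^+ 2)^-1.
  case: (boolP ((K0 <= k)%N && (0 < k)%N)) => [/andP[h1 h2]|h].
    by have [d h3] := hK k h1 h2; exists d.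
  by exists 0 => h1 h2; move: h; rewrite h1 h2.
pose C0 := (4 * r + 8 * r ^+ 2 + 2 * r + 2) / L.
have r2 : 0 <= r ^+ 2 by exact: sqr_ge0.
have C0p : 0 < C0 by rewrite divr_gt0 //; lra.
have le0 k x : (0 < k)%N -> x <= 4 * r + 8 * r ^+ 2 + 2 * r + 2 -> x / (L * k%:R) <= C0 / k%:R.
  move=> k0 hx; rewrite /C0 invfM mulrA ler_wpM2r ?invr_ge0 ?ler0n //.
  by rewrite ler_wpM2r // invr_ge0 ltW.
have /choice[FPc hF] k : exists y : H * H * C, (K0 <= k)%N -> (0 < k)%N ->
  [/\ T y.1.1 = (cl k + d k)^-1 *: y.1.1,
      T y.1.2 - (cl k + d k)^-1 *: y.1.2 = y.2 *: y.1.1 + y.1.1 0%N *: delta 0,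
         nm (y.1.1 - delta k) <= C0 / k%:R, nm y.1.2 <= C0 / k%:R & nc y.2 <= C0 / k%:R]
  /\ [/\ cl k + d k != 0 & nc (cl k + d k)^-1 <= C0 / k%:R].
  case: (boolP ((K0 <= k)%N && (0 < k)%N)) => [/andP[h1 h2]|h]; last first.
    by exists (0, 0, 0) => h1 h2; move: h; rewrite h1 h2.
  have [[b1 b2 b3 b4 b5] b6] := hd k h1 h2.
  have [F [P [c [[c1 c2 c3 c4 c5] [c6 c7]]]]] := eigen_pair h2 r0 b1 b2 b4 b5 b6.
  exists (F, P, c) => _ _ /=; split; first split=> //.
  - apply: (le_trans c2); apply: le0 => //; lra.
  - apply: (le_trans c4); apply: le0 => //; lra.
  - apply: (le_trans c5); apply: le0 => //; lra.
  - split=> //; apply: (le_trans c7); apply: le0 => //; lra.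
exists K0, C0, (gam tauT), (fun k => cl k + d k), (fun k => (FPc k).1.1), (fun k => (FPc k).1.2),
  (fun k => (FPc k).2); split=> //.
- exact: gam_gt0.
- by move=> k h1 h2; have [] := hF k h1 h2.
- move=> k h1 h2; have [_ [c6 c7]] := hF k h1 h2; have [[_ _ b3 _ _] _] := hd k h1 h2.
  by split=> //; rewrite ImD /= add0r.
(* Equal roots would put lam_j and lam_k within 2 r, whereas their gap is at least L (j + k) >= 4
   r. *)
- move=> j k j1 j2 k1 k2 e; apply/eqP/negPn/negP => jk.
  have [[a1 a2 _ _ _] _] := hd j j1 j2; have [[b1 b2 _ _ _] _] := hd k k1 k2.
  have h : `|lam k - lam j| <= r + r.
    rewrite -ncR rmorphB -/(cl k) -/(cl j).
    have -> : cl k - cl j = d j - d k.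
      by apply/eqP; rewrite subr_eq addrAC [d j + _]addrC e addrK.
    by apply: (le_trans (ncB _ _)); exact: lerD.
  have e2 := lam_gap L0 jk.
  have d1 := natr_dist1 R jk.
  have : L * (k + j)%:R <= r + r.
    apply: le_trans h; rewrite e2 ler_pM2l // ler_peMl ?ler0n //.
  rewrite natrD mulrDr; lra.
Qed.

End EigenVectors.

(** * From asymptotic eigenvectors to the triangular form *)

Section Perturbation.
Variable R : realType.
Local Notation C := R[i].
Local Notation nc := (@Normc.normc R).
Local Notation H := (ell2T R).
Local Notation delta := (@delta R).

Let h (j : nat) : R := if j == 0%N then 0 else (j%:R ^+ 2)^-1.

Let h_ge0 j : 0 <= h j.
Proof. by rewrite /h; case: ifP => // _; rewrite invr_ge0 sqr_ge0. Qed.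

Lemma sum_head (u : nat -> R) N M : (forall n, 0 <= u n) ->
  \sum_(n < M) (if (n < N)%N then u n else 0) <= \sum_(n < N) u n.
Proof.
move=> u0; rewrite -big_mkcond /=.
have [MN|/ltnW NM] := leqP M N.
  rewrite (eq_bigl xpredT) => [|i]; last by rewrite (leq_trans (ltn_ord i)).
  rewrite -!(big_mkord xpredT u) (big_cat_nat (n := M) (p := N)) //= lerDl.
  exact: sumr_ge0.
by rewrite -(big_ord_widen M u NM).
Qed.

Lemma sum_inv_tail e (D : R) : 0 <= D -> 0 < e ->
  exists N, forall M, \sum_(n < M) (if (n < N)%N then 0 else D * h n) <= e.
Proof.
move=> D0 e0.
have hp n : 0 <= D * h n.
  by rewrite mulr_ge0.
have hb M : \sum_(n < M) D * h n <= D * 2.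
  by rewrite -mulr_sumr ler_wpM2l // sum_inv_sq_le2.
have [N hN] := sqbnd_tail hp hb e0; exists N => M.
apply: le_trans (hN N M (leqnn N)).
rewrite -(big_mkord xpredT (fun n => if (n < N)%N then 0 else D * h n)).
have [MN|/ltnW NM] := leqP M N.
  rewrite big_nat big1 ?sumr_ge0 // => i /= iM; by rewrite (leq_trans iM).
rewrite (big_cat_nat (n := N)) //= big_nat big1 ?add0r; last by move=> i /= ->.
rewrite le_eqVlt; apply/orP; left; apply/eqP.
by apply: eq_big_nat => i /andP[Ni _]; rewrite ltnNge Ni.
Qed.

Variables (A : H -> H) (Psi : nat -> H) (nu c : nat -> C) (N1 : nat) (C1 : R).
Hypotheses (bA : blin A)
  (dense : forall n e, 0 < e -> exists g, nm (A g - delta n) <= e)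
  (hP : forall n, (N1 <= n)%N -> (0 < n)%N ->
    [/\ A (Psi n) = nu n *: Psi n + c n *: Psi n.+1, nu n != 0,
        exists m, iter m (sh A (nu n)) (Psi n) = 0,
        nm (Psi n - delta n) <= C1 / n%:R & nm (A (Psi n)) <= C1 / n%:R]).

Lemma C1_sq n x : (0 < n)%N -> nm x <= C1 / n%:R -> nm x ^+ 2 <= C1 ^+ 2 * h n.
Proof.
move=> n0 hx; rewrite /h gtn_eqF // -exprVn -exprMn ler_pXn2r ?nnegrE ?nm_ge0 //.
exact: le_trans (nm_ge0 _) hx.
Qed.

Lemma riesz_setup : exists N B B', [/\ (N1 <= N)%N, aut B B',
  setup (fun x => B' (A (B x))) N nu & forall n, (N <= n)%N -> B (delta n) = Psi n].
Proof.
(* The squared distances must sum to at most 1/4: the vectors beyond N2 contribute 1/8, and the N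
   replaced ones N e^2 = 1 / (16 N) <= 1/16. *)
have [N2 hN2] := @sum_inv_tail 8^-1 _ (sqr_ge0 C1) (ltac:(by rewrite invr_gt0)).
pose N := (maxn (maxn N1 N2) 1)%N.
have N1N : (N1 <= N)%N by rewrite /N !leq_max leqnn.
have N2N : (N2 <= N)%N by rewrite /N !leq_max leqnn orbT.
have N0 : (0 < N)%N by rewrite /N !leq_max leqnn !orbT.
pose e : R := (4 * N%:R)^-1.
have Np : 0 < N%:R :> R by rewrite ltr0n.
have e0 : 0 < e by rewrite invr_gt0 mulr_gt0.
have /choice[g hg] n : exists g, nm (A g - delta n) <= e by exact: dense.
pose W n := if (n < N)%N then A (g n) else Psi n.
pose v n := W n - delta n.
have hv M : \sum_(n < M) nm (v n) ^+ 2 <= 2^-1 ^+ 2.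
  apply: (@le_trans _ _ (\sum_(n < M) ((if (n < N)%N then e ^+ 2 else 0) +
     (if (n < N2)%N then 0 else C1 ^+ 2 * h n)))).
    apply: ler_sum => n _; rewrite /v /W; case: ltnP => nN.
      rewrite -[leLHS]addr0; apply: lerD.
        by rewrite ler_pXn2r ?nnegrE ?nm_ge0 // ltW.
      by case: ifP => // _; rewrite mulr_ge0 ?sqr_ge0.
    rewrite ltnNge (leq_trans N2N nN) /= add0r; apply: C1_sq; first exact: leq_trans nN.
    by have [] := hP (leq_trans N1N nN) (leq_trans N0 nN).
  rewrite big_split /=; apply: (le_trans (lerD (sum_head _ _ (fun _ => sqr_ge0 e)) (hN2 M))).
  rewrite sumr_const card_ord -(mulr_natr (e ^+ 2) N).
  have -> : e ^+ 2 * N%:R = (16 * N%:R)^-1 by rewrite /e; field; rewrite gt_eqF.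
  have : (16 * N%:R)^-1 <= 16^-1 :> R.
    by rewrite lef_pV2 ?posrE ?mulr_gt0 // ler_peMr // ler1n.
  lra.
have h2 : 0 < 2^-1 :> R by rewrite invr_gt0.
have [L [bL Ld hL]] := hs_colop h2 hv.
have [||B' aB] := @neumann_aut R L 2^-1 bL; [by apply/andP; split; lra|exact: hL|].
pose B x := x + L x; rewrite -/B in aB.
have [bB bB' BK B'K] := aB.
have Bd n : B (delta n) = W n by rewrite /B Ld /v addrC subrK.
have Bt n : (N <= n)%N -> B (delta n) = Psi n by move=> Nn; rewrite Bd /W ltnNge Nn.
have B'P n : (N <= n)%N -> B' (Psi n) = delta n by move=> Nn; rewrite -Bt // BK.
exists N, B, B'; split=> //.
have bAB : blin (fun x => B' (A (B x))) by apply: blin_comp => //; exact: blin_comp.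
have PN n : (N <= n)%N -> _ := fun Nn => hP (leq_trans N1N Nn) (leq_trans N0 Nn).
split=> //.
- move=> n Nn; have [e1 _ _ _ _] := PN n Nn.
  rewrite /sh Bt // e1 (blinD _ _ bB') !(blinZ _ _ bB') !B'P //; last exact: leqW.
  by rewrite addrAC subrr add0r; apply: tailZ; exact: tail_delta.
- move=> n Nn; have [_ n0 [m hm] _ _] := PN n Nn; split=> //; exists m.
  by rewrite (conj_iter A (nu n) m (delta n) aB) Bt // hm blin0.
- have [K K0 hK] := bB'.2; pose T n := nm (B' (A (B (delta n)))) ^+ 2.
  have T0 n : 0 <= T n by exact: sqr_ge0.
  have hp n : 0 <= K ^+ 2 * (C1 ^+ 2 * h n).
    by rewrite mulr_ge0 ?sqr_ge0 // mulr_ge0 ?sqr_ge0.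
  exists (\sum_(n < N) T n + K ^+ 2 * (C1 ^+ 2 * 2)) => M.
  apply: (@le_trans _ _ (\sum_(n < M) ((if (n < N)%N then T n else 0) +
     K ^+ 2 * (C1 ^+ 2 * h n)))).
    apply: ler_sum => n _; rewrite -/(T n); case: ltnP => nN; first by rewrite lerDl.
    rewrite add0r /T Bt //.
    apply: (@le_trans _ _ ((K * nm (A (Psi n))) ^+ 2)).
      by rewrite ler_pXn2r ?nnegrE ?nm_ge0 ?hK // mulr_ge0 ?nm_ge0 // ltW.
    rewrite exprMn ler_wpM2l ?sqr_ge0 //; apply: C1_sq; first exact: leq_trans nN.
    by have [] := PN n nN.
  rewrite big_split /= lerD ?sum_head // -!mulr_sumr !ler_wpM2l ?sqr_ge0 //.
  exact: sum_inv_sq_le2.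
- move=> n nN; exists (B' (g n)); rewrite B'K.
  have -> : A (g n) = B (delta n) by rewrite Bd /W nN.
  by rewrite BK.
Qed.

Theorem riesz_triangular : exists N Q Q' nu', [/\ (N1 <= N)%N, aut Q Q',
  setup (fun x => Q' (A (Q x))) 0 nu' & forall n, (N <= n)%N -> nu' n = nu n].
Proof.
have [N [B [B' [N1N aB S _]]]] := riesz_setup.
have [Q [Q' [nu' [aQ S' e]]]] := triangularize S.
exists N, (fun x => B (Q x)), (fun x => Q' (B' x)), nu'; split=> //.
exact: aut_comp.
Qed.

End Perturbation.

(** * The coupled operator *)

Section Interleave.
Variable R : realType.
Local Notation C := R[i].
Local Notation nc := (@Normc.normc R).
Local Notation H := (ell2T R).
Local Notation delta := (@delta R).
Implicit Types (x u w : H).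

Lemma sum_double k (f : nat -> R) :
  \sum_(n < k.*2) f n = \sum_(j < k) (f j.*2 + f j.*2.+1).
Proof.
elim: k => [|k IH]; first by rewrite !big_ord0.
by rewrite doubleS !big_ord_recr /= IH addrA.
Qed.

Lemma sum_mono (f : nat -> R) m n : (forall i, 0 <= f i) -> (m <= n)%N ->
  \sum_(i < m) f i <= \sum_(i < n) f i.
Proof.
move=> f0 mn; rewrite -!(big_mkord xpredT f) (big_cat_nat (n := m) (p := n)) //= lerDl.
exact: sumr_ge0.
Qed.

Lemma join_bd u w : sqbnd (fun n => if odd n then u n./2 else w n./2) ((nm u + nm w) ^+ 2).
Proof.
move=> M; pose f n := nc (if odd n then u n./2 else w n./2) ^+ 2.
apply: (@le_trans _ _ (\sum_(n < M.*2) f n)).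
  apply: (sum_mono (f := f)) => [i|]; first exact: sqr_ge0.
  by rewrite -addnn leq_addr.
rewrite sum_double /f; under eq_bigr do rewrite odd_double /= odd_double doubleK uphalf_double.
rewrite big_split /=; have := nm_sq u M; have := nm_sq w M.
have := nm_ge0 u; have := nm_ge0 w; rewrite sqrrD => a1 a2.
have : 0 <= nm u * nm w by rewrite mulr_ge0.
set s1 := \sum_(i < M) _; set s2 := \sum_(i < M) _; lra.
Qed.

(** The second copy takes the even indices, the first the odd ones. The coupling leads from the
    second copy to the first, hence from index 2k to 2k + 1, which is lower triangular. *)
Definition join u w : H := mkH ((ell2P _).2 (ex_intro _ _ (join_bd u w))).

Lemma joinE u w n : join u w n = if odd n then u n./2 else w n./2. Proof. by []. Qed.

Lemma nm_join u w : nm (join u w) <= nm u + nm w.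
Proof. by apply: nm_le; [rewrite addr_ge0 ?nm_ge0|exact: join_bd]. Qed.

Lemma ev_bd x : sqbnd (fun k => x k.*2) (nm x ^+ 2).
Proof.
move=> M; apply: le_trans (nm_sq x M.*2).
rewrite (sum_double M (fun i => nc (x i) ^+ 2)).
by apply: ler_sum => i _; rewrite lerDl sqr_ge0.
Qed.

Lemma od_bd x : sqbnd (fun k => x k.*2.+1) (nm x ^+ 2).
Proof.
move=> M; apply: le_trans (nm_sq x M.*2).
rewrite (sum_double M (fun i => nc (x i) ^+ 2)).
by apply: ler_sum => i _; rewrite lerDr sqr_ge0.
Qed.

Definition evH x : H := mkH ((ell2P _).2 (ex_intro _ _ (ev_bd x))).
Definition odH x : H := mkH ((ell2P _).2 (ex_intro _ _ (od_bd x))).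

Lemma evE x k : evH x k = x k.*2. Proof. by []. Qed.
Lemma odE x k : odH x k = x k.*2.+1. Proof. by []. Qed.
Lemma nm_ev x : nm (evH x) <= nm x.
Proof. by apply: nm_le; [exact: nm_ge0|exact: ev_bd]. Qed.
Lemma nm_od x : nm (odH x) <= nm x.
Proof. by apply: nm_le; [exact: nm_ge0|exact: od_bd]. Qed.

Lemma ev_join u w : evH (join u w) = w.
Proof. by apply: HE => k; rewrite evE joinE odd_double doubleK. Qed.
Lemma od_join u w : odH (join u w) = u.
Proof. by apply: HE => k; rewrite odE joinE /= odd_double /= uphalf_double. Qed.
Lemma join_evod x : join (odH x) (evH x) = x.
Proof.
apply: HE => n; rewrite joinE odE evE; case: ifP => on.
  by rewrite -[in RHS](odd_double_half n) on.
by rewrite -[in RHS](odd_double_half n) on.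
Qed.

Lemma evL c x y : evH (c *: x + y) = c *: evH x + evH y.
Proof. by apply: HE => k; rewrite HD HZ !evE HD HZ. Qed.
Lemma odL c x y : odH (c *: x + y) = c *: odH x + odH y.
Proof. by apply: HE => k; rewrite HD HZ !odE HD HZ. Qed.
Lemma joinL c u w u' w' : join (c *: u + u') (c *: w + w') = c *: join u w + join u' w'.
Proof. by apply: HE => k; rewrite HD HZ !joinE; case: ifP => _; rewrite HD HZ. Qed.
Lemma joinZ c u w : c *: join u w = join (c *: u) (c *: w).
Proof. by apply: HE => k; rewrite HZ !joinE; case: ifP => _; rewrite HZ. Qed.
Lemma joinD u w u' w' : join u w + join u' w' = join (u + u') (w + w').
Proof. by apply: HE => k; rewrite HD !joinE; case: ifP => _; rewrite HD. Qed.
Lemma joinB u w u' w' : join u w - join u' w' = join (u - u') (w - w').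
Proof. by apply: HE => k; rewrite HB_ !joinE; case: ifP => _; rewrite HB_. Qed.
Lemma join0 : join 0 0 = 0.
Proof. by apply: HE => k; rewrite joinE if_same. Qed.

Lemma join_delta n : delta n = if odd n then join (delta n./2) 0 else join 0 (delta n./2).
Proof.
apply: HE => i; have E : (i == n) = (odd i == odd n) && (i./2 == n./2).
  rewrite -{1}(odd_double_half i) -{1}(odd_double_half n).
  case: (odd i) (odd n) => [] [] /=; rewrite ?add0n ?add1n ?eqSS.
  - by rewrite (inj_eq double_inj).
  - by apply/eqP => /(congr1 odd) /=; rewrite !odd_double.
  - by apply/eqP => /(congr1 odd) /=; rewrite !odd_double.
  - by rewrite (inj_eq double_inj).
rewrite deltaE E; case: (odd n); rewrite joinE deltaE; by case: (odd i).
Qed.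

Variables (T1 T2 : H -> H) (e : C).
Hypotheses (b1 : blin T1) (b2 : blin T2).

Definition Rh x : H := join (T1 (odH x) + (e * evH x 0%N) *: delta 0) (T2 (evH x)).

Lemma blin_Rh : blin Rh.
Proof.
split=> [c x y|].
  rewrite /Rh evL odL -joinL b1.1 b2.1; congr join.
  by rewrite HD HZ scalerDr addrACA; congr (_ + _); rewrite scalerA -scalerDl; congr (_ *: _); ring.
case: b1.2 b2.2 => K1 K10 h1 [K2 K20 h2].
exists (K1 + nc e * nm (delta 0) + K2).
  by rewrite addr_gt0 // ltr_wpDr // mulr_ge0 ?nc_ge0 ?nm_ge0.
move=> x; apply: (le_trans (nm_join _ _)).
have a1 := le_trans (h1 (odH x)) (ler_wpM2l (ltW K10) (nm_od x)).
have a2 := le_trans (h2 (evH x)) (ler_wpM2l (ltW K20) (nm_ev x)).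
have a3 := nmD (T1 (odH x)) ((e * evH x 0%N) *: delta 0).
have a4 := nmZ_le (e * evH x 0%N) (delta 0).
have a5 : nc (e * evH x 0%N) * nm (delta 0) <= nc e * nm (delta 0) * nm x.
  rewrite ncM mulrAC ler_wpM2l ?mulr_ge0 ?nc_ge0 ?nm_ge0 //.
  exact: le_trans (nm_coord _ _) (nm_ev x).
rewrite !mulrDl; lra.
Qed.

Lemma Rh_od u : Rh (join u 0) = join (T1 u) 0.
Proof. by rewrite /Rh od_join ev_join H0 mulr0 scale0r addr0 (blin0 b2). Qed.

Lemma Rh_join u w : Rh (join u w) = join (T1 u + (e * w 0%N) *: delta 0) (T2 w).
Proof. by rewrite /Rh od_join ev_join. Qed.

End Interleave.

(** * Spectral data of the coupled operator *)

Section FullOperator.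
Variable R : realType.
Local Notation C := R[i].
Local Notation nc := (@Normc.normc R).
Local Notation H := (ell2T R).
Local Notation delta := (@delta R).
Variable L : R.
Hypothesis L0 : 0 < L.
Local Notation lamI := (@lamI R L).
Local Notation wv := (wv L0).

Definition scalar_op (th : C) (T : H -> H) : Prop :=
  [/\ blin T, forall x, T x 0%N = th * x 0%N + dot wv x &
      forall x n, (0 < n)%N -> T x n = lamI n * x n + x 0%N * wv n].

Lemma Im_tauT th : complex.Im (tauT L th) = complex.Im th.
Proof.
have -> : tauT L th = th - (csum lamI + csum lamI) by rewrite /tauT; ring.
rewrite ImD ImN ImD.
have -> : complex.Im (csum lamI) = 0.
  have [_ h] := hsum_ccvg (lamI_hsum L0).
  apply: (cvg_unique (@Rhausdorff R) h).
  have -> : (fun N => complex.Im (\sum_(i < N) lamI i)) = (fun=> 0 : R).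
    apply/funext => N; rewrite Im_sum big1 // => i _.
    by rewrite /lamI /cl -fmorphV.
  exact: cvg_cst.
by rewrite addr0 subr0.
Qed.

Variables (th1 th2 e : C) (T1 T2 : H -> H).
Hypotheses (hT1 : scalar_op th1 T1) (hT2 : scalar_op th2 T2).
Hypotheses (i1 : 0 < complex.Im th1) (i2 : 0 < complex.Im th2).
Hypothesis jordan : e != 0 -> T1 = T2.

Let b1 : blin T1. Proof. by case: hT1. Qed.
Let b2 : blin T2. Proof. by case: hT2. Qed.

Local Notation Rh := (Rh T1 T2 e).

Lemma Rh_im x nu : Rh x = nu *: x -> x <> 0 -> 0 < complex.Im nu.
Proof.
have [_ t10 t1S] := hT1; have [_ t20 t2S] := hT2.
rewrite -{1 2 3}(join_evod x) Rh_join joinZ => h x0.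
have h2 : T2 (evH x) = nu *: evH x by have := congr1 (@evH R) h; rewrite !ev_join.
have h1 := congr1 (@odH R) h; rewrite !od_join in h1.
have [w0|/eqP w0] := eqVneq (evH x) 0; last exact: (eigen_im t20 t2S i2 h2 w0).
move: h1; rewrite w0 H0 mulr0 scale0r addr0 => h1.
apply: (eigen_im t10 t1S i1 h1) => u0; apply: x0.
by rewrite u0 w0 join0.
Qed.

Lemma Rh_dense n ep : 0 < ep -> exists g, nm (Rh g - delta n) <= ep.
Proof.
have [_ t10 t1S] := hT1; have [_ t20 t2S] := hT2.
move=> ep0; rewrite join_delta; case: ifP => _.
  have [g _ hg] := range_dense b1 t10 t1S n./2 ep0.
  exists (join g 0); rewrite Rh_od // joinB subr0.
  by apply: (le_trans (nm_join _ _)); rewrite nm0 addr0.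
have [g g0 hg] := range_dense b2 t20 t2S n./2 ep0.
exists (join 0 g); rewrite Rh_join (blin0 b1) g0 mulr0 scale0r addr0 joinB subr0.
by apply: (le_trans (nm_join _ _)); rewrite nm0 add0r.
Qed.

(** If [e = 0] the copies are independent and [P], [c] are 0. Otherwise they carry the same
    operator, hence the same roots, and - e times the derivative vector of [eigen_pair] cancels the
    coupling term in coordinate 0. *)
Lemma root_data : exists K0 C0 g (z1 z2 : nat -> C) (F1 F2 P : nat -> H) (c : nat -> C),
  [/\ 0 < C0, 0 < g,
   forall k, (K0 <= k)%N -> (0 < k)%N ->
     [/\ T1 (F1 k) = (z1 k)^-1 *: F1 k, T2 (F2 k) = (z2 k)^-1 *: F2 k,
       T1 (P k) + (e * F2 k 0%N) *: delta 0 = (z2 k)^-1 *: P k + c k *: F1 k &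
       c k = 0 \/ z1 k = z2 k],
   forall k, (K0 <= k)%N -> (0 < k)%N ->
     [/\ nm (F1 k - delta k) <= C0 / k%:R, nm (F2 k - delta k) <= C0 / k%:R,
       nm (P k) <= C0 / k%:R & nc (c k) <= C0 / k%:R] &
   [/\ forall k, (K0 <= k)%N -> (0 < k)%N ->
     [/\ z1 k != 0, nc (z1 k)^-1 <= C0 / k%:R & complex.Im (z1 k) <= - g],
   forall k, (K0 <= k)%N -> (0 < k)%N ->
     [/\ z2 k != 0, nc (z2 k)^-1 <= C0 / k%:R & complex.Im (z2 k) <= - g],
   forall j k, (K0 <= j)%N -> (0 < j)%N -> (K0 <= k)%N -> (0 < k)%N -> z1 j = z1 k -> j = k &
   forall j k, (K0 <= j)%N -> (0 < j)%N -> (K0 <= k)%N -> (0 < k)%N -> z2 j = z2 k -> j = k]].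
Proof.
have [_ t10 t1S] := hT1; have [_ t20 t2S] := hT2.
have := i2; rewrite -Im_tauT => /(scalar_roots t20 t2S).
move=> [K2 [C2 [g2 [z2 [F2 [P2 [c2 [C20 g20 h2 k2 inj2]]]]]]]].
have [e0|en0] := eqVneq e 0.
  have := i1; rewrite -Im_tauT => /(scalar_roots t10 t1S).
  move=> [K1 [C1 [g1 [z1 [F1 [P1 [c1 [C10 g10 h1 k1 inj1]]]]]]]].
  have l1 k : C1 / k%:R <= (C1 + C2) / k%:R.
    by rewrite ler_wpM2r ?invr_ge0 ?ler0n // lerDl ltW.
  have l2 k : C2 / k%:R <= (C1 + C2) / k%:R.
    by rewrite ler_wpM2r ?invr_ge0 ?ler0n // lerDr ltW.
  have p k : 0 <= (C1 + C2) / k%:R.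
    by rewrite divr_ge0 ?ler0n // addr_ge0 // ltW.
  have K12 k : (maxn K1 K2 <= k)%N -> (K1 <= k)%N /\ (K2 <= k)%N.
    by rewrite geq_max => /andP[].
  exists (maxn K1 K2), (C1 + C2), (Order.min g1 g2), z1, z2, F1, F2, (fun=> 0), (fun=> 0).
  split.
  - by rewrite addr_gt0.
  - by rewrite lt_min g10.
  - move=> k /K12[m1 m2] k0; have [a1 _ _ _ _] := h1 k m1 k0; have [a2 _ _ _ _] := h2 k m2 k0.
    by split=> //; [rewrite (blin0 b1) e0 mul0r !scale0r scaler0|left].
  - move=> k /K12[m1 m2] k0; have [_ _ a1 _ _] := h1 k m1 k0; have [_ _ a2 _ _] := h2 k m2 k0.
    split; first exact: le_trans a1 (l1 k).
    + exact: le_trans a2 (l2 k).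
    + by rewrite nm0.
    + by rewrite nc0.
  - split.
    + move=> k /K12[m1 m2] k0; have [a1 a2 a3] := k1 k m1 k0; split=> //.
        exact: le_trans a2 (l1 k).
      by rewrite (le_trans a3) // lerN2 ge_min lexx.
    + move=> k /K12[m1 m2] k0; have [a1 a2 a3] := k2 k m2 k0; split=> //.
        exact: le_trans a2 (l2 k).
      by rewrite (le_trans a3) // lerN2 ge_min lexx orbT.
    + by move=> j k /K12[m1 m2] j0 /K12[m3 m4] k0; exact: inj1.
    + by move=> j k /K12[m1 m2] j0 /K12[m3 m4] k0; exact: inj2.
have T12 := jordan en0.
have l1 k : C2 / k%:R <= (C2 + nc e * C2) / k%:R.
  by rewrite ler_wpM2r ?invr_ge0 ?ler0n // lerDl mulr_ge0 ?nc_ge0 // ltW.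
have l2 k x : x <= C2 / k%:R -> nc e * x <= (C2 + nc e * C2) / k%:R.
  move=> hx; rewrite mulrDl -[leLHS]add0r lerD ?divr_ge0 ?ler0n ?(ltW C20) //.
  by rewrite -mulrA ler_wpM2l ?nc_ge0.
exists K2, (C2 + nc e * C2), g2, z2, z2, F2, F2, (fun k => - e *: P2 k), (fun k => - e * c2 k).
split=> //.
- by rewrite ltr_wpDr // mulr_ge0 ?nc_ge0 // ltW.
- move=> k m k0; have [a1 a2 _ _ _] := h2 k m k0; split; rewrite ?T12 //; last by right.
  rewrite (blinZ (- e) (P2 k) b2); move/eqP: a2; rewrite subr_eq => /eqP ->.
  by apply: HE => i; rewrite !(HD, HZ); ring.
- move=> k m k0; have [_ _ a1 a2 a3] := h2 k m k0; split.
  + exact: le_trans a1 (l1 k).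
  + exact: le_trans a1 (l1 k).
  + by rewrite (le_trans (nmZ_le _ _)) // ncN l2.
  + by rewrite ncM ncN l2.
- split=> // k m k0; have [a1 a2 a3] := k2 k m k0; split=> //; exact: le_trans a2 (l1 k).
Qed.

(** Distinctness holds only within one parity class: the two copies may share eigenvalues, and for a
    Jordan block their high ones coincide. *)
Theorem full_spectral : exists N Q Q' nu g,
  [/\ aut Q Q', setup (fun x => Q' (Rh (Q x))) 0 nu, 0 < g,
      forall n, (N <= n)%N -> complex.Im (nu n)^-1 <= - g &
      forall m n, (N <= m)%N -> (N <= n)%N -> odd m = odd n -> nu m = nu n -> m = n].
Proof.
have [K0 [C0 [g [z1 [z2 [F1 [F2 [P [c [C0p g0 hF hN [hz1 hz2 inj1 inj2]]]]]]]]]]] := root_data.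
have bR : blin Rh by exact: blin_Rh.
have [K Kp hK] := bR.2.
pose Psi n := if odd n then join (F1 n./2) 0 else join (P n./2) (F2 n./2).
pose nu n := if odd n then (z1 n./2)^-1 else (z2 n./2)^-1.
pose cn n := if odd n then 0 else c n./2.
pose N1 := (maxn K0 1).*2.+2.
have hlf n : (N1 <= n)%N -> (K0 <= n./2)%N /\ (0 < n./2)%N.
  move=> h; have : (maxn K0 1 <= n./2)%N.
    by rewrite -(doubleK (maxn K0 1)); apply: half_leq; apply: leq_trans h; rewrite /N1 ltnW.
  by rewrite geq_max => /andP[].
have hq n : (N1 <= n)%N -> (n./2)%:R^-1 <= 3 / n%:R :> R.
  move=> h; have [_ h0] := hlf n h.
  have n0 : (0 < n)%N by apply: leq_trans h.
  rewrite ler_pdivlMr ?ltr0n // mulrC ler_pdivrMr ?ltr0n // -natrM ler_nat.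
  by rewrite -{1}(odd_double_half n) -mul2n mulSn leq_add2r (leq_trans (leq_b1 _)).
have nu0 n : (N1 <= n)%N -> nu n != 0.
  move=> h; have [h1 h2] := hlf n h; rewrite /nu; case: ifP => _; rewrite invr_eq0.
    by have [] := hz1 _ h1 h2.
  by have [] := hz2 _ h1 h2.
have APsi n : (N1 <= n)%N -> Rh (Psi n) = nu n *: Psi n + cn n *: Psi n.+1.
  move=> h; have [h1 h2] := hlf n h; have [a1 a2 a3 _] := hF _ h1 h2.
  rewrite /Psi /nu /cn /=; case: (boolP (odd n)) => on /=.
    by rewrite Rh_od // a1 joinZ scaler0 scale0r addr0.
  rewrite Rh_join a2 a3 uphalf_half (negbTE on) add0n !joinZ joinD scaler0 addr0 //.
have gen n : (N1 <= n)%N -> exists m, iter m (sh Rh (nu n)) (Psi n) = 0.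
  move=> h; have [h1 h2] := hlf n h; have [_ _ _ a4] := hF _ h1 h2.
  have [cn0|cn0] := eqVneq (cn n) 0.
    by exists 1%N; rewrite /= /sh APsi // cn0 scale0r addr0 subrr.
  have on : odd n = false by move: cn0; rewrite /cn; case: (odd n); rewrite ?eqxx.
  have ze : nu n.+1 = nu n.
    rewrite /nu /= on /= uphalf_half on add0n; case: a4 => [c0|-> //].
    by move: cn0; rewrite /cn on c0 eqxx.
  exists 2%N; rewrite /= {2}/sh APsi // addrAC subrr add0r.
  rewrite /sh blinZ // APsi; last exact: leqW.
  by rewrite ze /cn /= on /= scale0r addr0 scalerA scalerA mulrC subrr.
have nP n : (N1 <= n)%N -> nm (Psi n - delta n) <= 6 * C0 / n%:R.
  move=> h; have [h1 h2] := hlf n h; have [a1 a2 a3 _] := hN _ h1 h2.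
  have hh : 2 * (C0 / (n./2)%:R) <= 6 * C0 / n%:R.
    have -> : 6 * C0 / n%:R = 2 * (C0 * (3 / n%:R)) by ring.
    by rewrite ler_wpM2l // ler_wpM2l ?(ltW C0p) // hq.
  apply: le_trans hh; have p : 0 <= C0 / (n./2)%:R by rewrite divr_ge0 ?ler0n // ltW.
  rewrite [delta n]join_delta /Psi; case: ifP => _; rewrite joinB subr0.
    by rewrite mulr_natl mulr2n (le_trans (nm_join _ _)) // nm0 addr0 (le_trans a1) // lerDl.
  by rewrite mulr_natl mulr2n (le_trans (nm_join _ _)) // lerD.
have nA n : (N1 <= n)%N -> nm (Rh (Psi n)) <= C0 * (6 * C0 + 1) * 6 / n%:R.
  move=> h; have [h1 h2] := hlf n h; have [_ _ _ a4] := hN _ h1 h2.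
  have n0 : (0 < n)%N by apply: leq_trans h.
  have bP m : (N1 <= m)%N -> nm (Psi m) <= 6 * C0 + 1.
    move=> hm; have := nmD (Psi m - delta m) (delta m); rewrite subrK => /le_trans -> //.
    have m1 : 1 <= m%:R :> R by rewrite ler1n (leq_trans _ hm).
    rewrite lerD //.
      apply: (le_trans (nP m hm)); rewrite ler_pdivrMr ?(lt_le_trans ltr01) //.
      by rewrite ler_peMr // mulr_ge0 // ltW.
    apply: nm_le => // M; rewrite expr1n.
    apply: le_trans (sum_one M m (@ler01 R)); apply: ler_sum => i _; rewrite deltaE.
    by case: ifP => _; rewrite ?nc1 ?nc0 ?expr1n ?expr0n.
  have bn : nc (nu n) <= C0 / (n./2)%:R.
    rewrite /nu; case: ifP => _; first by have [] := hz1 _ h1 h2.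
    by have [] := hz2 _ h1 h2.
  have p : 0 <= C0 / (n./2)%:R by rewrite divr_ge0 ?ler0n // ltW.
  have bc : nc (cn n) <= C0 / (n./2)%:R by rewrite /cn; case: ifP; rewrite ?nc0.
  rewrite APsi // (le_trans (nmD _ _)) //.
  have q : 0 <= 6 * C0 + 1 by lra.
  have e1 : nm (nu n *: Psi n) <= C0 / (n./2)%:R * (6 * C0 + 1).
    rewrite (le_trans (nmZ_le _ _)) // ler_pM ?nc_ge0 ?nm_ge0 ?bP //.
  have e2 : nm (cn n *: Psi n.+1) <= C0 / (n./2)%:R * (6 * C0 + 1).
    rewrite (le_trans (nmZ_le _ _)) // ler_pM ?nc_ge0 ?nm_ge0 ?bP //; exact: leqW.
  apply: (le_trans (lerD e1 e2)).
  have e3 := ler_wpM2l (mulr_ge0 (ltW C0p) q) (hq n h).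
  have -> : C0 * (6 * C0 + 1) * 6 / n%:R =
    C0 * (6 * C0 + 1) * (3 / n%:R) + C0 * (6 * C0 + 1) * (3 / n%:R) by ring.
  by rewrite [C0 / _ * _]mulrAC lerD.
pose D := Order.max (6 * C0) (C0 * (6 * C0 + 1) * 6).
have leD x n : x <= D -> x / n%:R <= D / n%:R.
  by move=> hx; rewrite ler_wpM2r // invr_ge0 ler0n.
have [|N [Q [Q' [nu' [N1N aQ S enu]]]]] := @riesz_triangular R Rh Psi nu cn N1 D bR Rh_dense.
  move=> n h _; split; [exact: APsi|exact: nu0|exact: gen| |].
  - by apply: le_trans (nP n h) (leD _ _ _); rewrite le_max lexx.
  - by apply: le_trans (nA n h) (leD _ _ _); rewrite le_max lexx orbT.
exists N, Q, Q', nu', g; split=> //.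
- move=> n Nn; rewrite enu //; have [h1 h2] := hlf n (leq_trans N1N Nn).
  rewrite /nu; case: ifP => _; rewrite invrK; first by have [] := hz1 _ h1 h2.
  by have [] := hz2 _ h1 h2.
- move=> m n Nm Nn; rewrite !enu // /nu => omn; rewrite -omn.
  have [h1 h2] := hlf m (leq_trans N1N Nm); have [h3 h4] := hlf n (leq_trans N1N Nn).
  have half_inj : m./2 = n./2 -> m = n.
    by move=> hmn; rewrite -(odd_double_half m) -(odd_double_half n) omn hmn.
  by case: ifP => _ /invr_inj => [/(inj1 _ _ h1 h2 h3 h4)|/(inj2 _ _ h1 h2 h3 h4)].
Qed.

End FullOperator.

(** * Transfer to L^2(0, l; C^2) *)

Section Coefficients.
Variables (R : realType) (l : R).
Hypothesis l0 : 0 < l.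
Local Notation mu := (@lebesgue_measure R).
Local Notation D := (itv0l l).
Local Notation C := R[i].
Local Notation nc := (@Normc.normc R).
Local Notation vfun := (R -> 'cV[C]_2).
Local Notation H := (ell2T R).
Local Notation delta := (@delta R).
Local Notation en := (en l).
Local Notation ip := (ip l).
Implicit Types (U V F : vfun).

Lemma C_eq (z w : C) : complex.Re z = complex.Re w -> complex.Im z = complex.Im w -> z = w.
Proof. by case: z w => [? ?] [? ?] /= -> ->. Qed.

Lemma inL2Z c U : inL2 l U -> inL2 l (fun x => c *: U x).
Proof.
move=> /inL2P h; apply/inL2P => -[] j; rewrite /crd /re_coord /im_coord.
  have -> : (fun x => complex.Re ((c *: U x) j 0)) =
    (fun x => complex.Re c * crd true U j x - complex.Im c * crd false U j x).
    by apply/funext => x; rewrite mxE Re_mul.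
  by apply: sqiB; apply: sqiZ.
have -> : (fun x => complex.Im ((c *: U x) j 0)) =
    (fun x => complex.Re c * crd false U j x + complex.Im c * crd true U j x).
  by apply/funext => x; rewrite mxE Im_mul.
by apply: sqiD; apply: sqiZ.
Qed.

Lemma inL2D U V : inL2 l U -> inL2 l V -> inL2 l (fun x => U x + V x).
Proof.
move=> /inL2P h /inL2P k; apply/inL2P => -[] j; rewrite /crd /re_coord /im_coord.
  have -> : (fun x => complex.Re ((U x + V x) j 0)) =
    (fun x => crd true U j x + crd true V j x) by apply/funext => x; rewrite mxE ReD.
  exact: sqiD.
have -> : (fun x => complex.Im ((U x + V x) j 0)) =
    (fun x => crd false U j x + crd false V j x) by apply/funext => x; rewrite mxE ImD.
exact: sqiD.
Qed.

Lemma inL2_0 : inL2 l (fun=> 0).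
Proof.
apply/inL2P => r j; have -> : crd r (fun=> 0) j = (fun=> 0 : R) by
  apply/funext => x; rewrite crdE vcrd0.
exact: sqi_cst.
Qed.

Definition coef U (j : 'I_2) (n : nat) : C :=
  (ip (crd true U j) (en n) +i* ip (crd false U j) (en n))%C.

Lemma coef_bd U j : inL2 l U ->
  sqbnd (coef U j) (ip (crd true U j) (crd true U j) + ip (crd false U j) (crd false U j)).
Proof.
move=> /inL2P h N; under eq_bigr do rewrite nc_sq /=.
by rewrite big_split; apply: lerD; [exact: (bessel l0 N (h true j))|exact: (bessel l0 N (h false j))].
Qed.

Lemma EH_sig : {E : 'I_2 -> vfun -> H | forall j U n, inL2 l U -> E j U n = coef U j n}.
Proof.
exists (fun j U => if pselect (ell2 (coef U j)) is left h then mkH h else 0) => j U n hU.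
case: pselect => // -[]; apply/ell2P; eexists; exact: coef_bd.
Qed.

(* The values of [EH] are hidden behind an opaque proof: comparing two of them
   by conversion would unfold Lebesgue integrals. *)
Definition EH := sval EH_sig.

Lemma EHE j U n : inL2 l U -> EH j U n = coef U j n.
Proof. exact: (svalP EH_sig). Qed.

Lemma EHD j U V : inL2 l U -> inL2 l V -> EH j (fun x => U x + V x) = EH j U + EH j V.
Proof.
move=> hU hV; apply: HE => n; rewrite [RHS]HD (EHE j n (inL2D hU hV)) (EHE j n hU) (EHE j n hV).
have sU := (inL2P l U).1 hU; have sV := (inL2P l V).1 hV.
rewrite /coef.
have -> : crd true (fun x => U x + V x) j = (fun x => crd true U j x + crd true V j x).
  by apply/funext => x; rewrite /crd /re_coord mxE ReD.
have -> : crd false (fun x => U x + V x) j = (fun x => crd false U j x + crd false V j x).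
  by apply/funext => x; rewrite /crd /im_coord mxE ImD.
have se := en_sqi l n.
by rewrite (ipDl (sU true j) (sV true j) se) (ipDl (sU false j) (sV false j) se).
Qed.

Lemma EHZ j c U : inL2 l U -> EH j (fun x => c *: U x) = c *: EH j U.
Proof.
move=> hU; apply: HE => n; rewrite [RHS]HZ (EHE j n (inL2Z c hU)) (EHE j n hU).
have sU := (inL2P l U).1 hU.
rewrite /coef.
have -> : crd true (fun x => c *: U x) j =
    (fun x => complex.Re c * crd true U j x - complex.Im c * crd false U j x).
  by apply/funext => x; rewrite /crd /re_coord mxE Re_mul.
have -> : crd false (fun x => c *: U x) j =
    (fun x => complex.Re c * crd false U j x + complex.Im c * crd true U j x).
  by apply/funext => x; rewrite /crd /im_coord mxE Im_mul.
have se := en_sqi l n; have Z r x : sqi l (fun y => x * crd r U j y) by exact: sqiZ.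
rewrite (ipBl (Z true _) (Z false _) se) (ipDl (Z false _) (Z true _) se) !ipZl //.
by apply: C_eq; rewrite ?(Re_mul, Im_mul).
Qed.

Lemma EH_eq U V : inL2 l U -> inL2 l V -> eqL2 l U V <-> forall j, EH j U = EH j V.
Proof.
move=> hU hV; have sU := (inL2P l U).1 hU; have sV := (inL2P l V).1 hV.
split=> [/eqL2P h j|h].
  apply: HE => n; rewrite !EHE // /coef; congr (_ +i* _)%C.
    exact: ae_ip (sU true j) (sV true j) (en_sqi l n) (h true j).
  exact: ae_ip (sU false j) (sV false j) (en_sqi l n) (h false j).
apply/eqL2P => r j; apply: coef_inj => // n.
have := congr1 (fun x : H => x n) (h j); rewrite /= !EHE // => -[h1 h2].
by case: r.
Qed.

Lemma EH_surj (h : 'I_2 -> H) : exists2 U, inL2 l U & forall j, EH j U = h j.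
Proof.
have rf (r : bool) j : exists f, sqi l f /\ forall n, ip f (en n) =
    if r then complex.Re (h j n) else complex.Im (h j n).
  have [|f [sf hf _]] := @riesz_fischer R l l0 (fun n => if r then complex.Re (h j n)
      else complex.Im (h j n)) (nm (h j) ^+ 2); last by exists f.
  move=> N; apply: le_trans (nm_sq (h j) N); apply: ler_sum => i _; rewrite nc_sq.
  by case: r; rewrite ?lerDl ?lerDr sqr_ge0.
have /choice[f hf] (q : bool * 'I_2) : exists f, sqi l f /\ forall n, ip f (en n) =
  if q.1 then complex.Re (h q.2 n) else complex.Im (h q.2 n) by exact: rf.
pose U := mkv (fun r j => f (r, j)).
have hU : inL2 l U by apply/inL2P => r j; rewrite crd_mkv; have [] := hf (r, j).
exists U => // j; apply: HE => n; rewrite EHE // /coef !crd_mkv.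
have [_ ->] := hf (true, j); have [_ ->] := hf (false, j).
by case: (h j n).
Qed.

Lemma normL2_sq U : inL2 l U -> normL2 l U ^+ 2 =
  (ip (crd true U 0) (crd true U 0) + ip (crd false U 0) (crd false U 0)) +
  (ip (crd true U 1) (crd true U 1) + ip (crd false U 1) (crd false U 1)).
Proof.
move=> hU; have sU := (inL2P l U).1 hU.
have e : \int[mu]_(x in D) (\sum_(j < 2) nc (U x j 0) ^+ 2) =
  (ip (crd true U 0) (crd true U 0) + ip (crd false U 0) (crd false U 0)) +
  (ip (crd true U 1) (crd true U 1) + ip (crd false U 1) (crd false U 1)).
  have i r j : intgble l (fun x => crd r U j x * crd r U j x) by exact: sqi_mul.
  rewrite -(intgD (i true 0) (i false 0)) -(intgD (i true 1) (i false 1)).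
  rewrite -intgD; try exact: intgbleD.
  apply: eq_intg => x _; rewrite big_ord_recl big_ord1 !nc_sq !expr2.
  by rewrite (_ : lift ord0 ord0 = 1) //; apply/val_inj.
by rewrite /normL2 e sqr_sqrtr // !addr_ge0 // ip_ge0.
Qed.

Lemma normL2_ge0 U : 0 <= normL2 l U. Proof. exact: sqrtr_ge0. Qed.

Lemma nm_EH j U : inL2 l U -> nm (EH j U) <= normL2 l U.
Proof.
move=> hU; apply: nm_le; first exact: normL2_ge0.
move=> N; rewrite normL2_sq //.
have e : \sum_(i < N) nc (EH j U i) ^+ 2 = \sum_(i < N) nc (coef U j i) ^+ 2.
  by apply: eq_bigr => i _; rewrite EHE.
rewrite e; apply: (le_trans (coef_bd j hU N)).
have [->|->] : j = 0 \/ j = 1 by case: j {e} => [[|[|//]] p]; [left|right]; apply/val_inj.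
  by rewrite lerDl addr_ge0 // ip_ge0.
by rewrite lerDr addr_ge0 // ip_ge0.
Qed.

(** Parseval bounds each component by the norm of its coefficients; together with [nm_EH] this makes
    the coordinate map bicontinuous. *)
Lemma normL2_le U : inL2 l U -> normL2 l U <= nm (EH 0 U) + nm (EH 1 U).
Proof.
move=> hU; have sU := (inL2P l U).1 hU.
have h j : ip (crd true U j) (crd true U j) + ip (crd false U j) (crd false U j) <= nm (EH j U) ^+ 2.
  have c := cvgD (parseval l0 (sU true j)) (parseval l0 (sU false j)).
  rewrite -(cvg_lim (@Rhausdorff R) (c _)); apply: limr_le; first exact: cvgP (c _).
  apply: nearW => N; apply: le_trans (nm_sq (EH j U) N).
  apply: (@le_trans _ _ (\sum_(i < N) (ip (crd true U j) (en i) ^+ 2 + ip (crd false U j) (en i) ^+ 2))).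
    by rewrite big_split; exact: lexx.
  by apply: ler_sum => i _; rewrite (EHE j i hU) nc_sq.
rewrite -(@ler_pXn2r _ 2) ?nnegrE ?addr_ge0 ?nm_ge0 ?normL2_ge0 // normL2_sq //.
have := h 0; have := h 1; rewrite sqrrD.
have : 0 <= nm (EH 0 U) * nm (EH 1 U) by rewrite mulr_ge0 ?nm_ge0.
set q := _ * _; set x1 := _ + ip _ _; set x2 := _ + ip _ _; lra.
Qed.

Lemma EH_sum n (c : 'I_n -> C) (U : 'I_n -> vfun) : (forall i, inL2 l (U i)) ->
  inL2 l (fun x => \sum_(i < n) c i *: U i x) /\
  forall j, EH j (fun x => \sum_(i < n) c i *: U i x) = \sum_(i < n) c i *: EH j (U i).
Proof.
move=> hU; elim: n c U hU => [|n IH] c U hU.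
  have -> : (fun x => \sum_(i < 0) c i *: U i x) = (fun=> 0).
    by apply/funext => x; rewrite big_ord0.
  split=> [|j]; first exact: inL2_0.
  rewrite big_ord0; have -> : (fun=> 0) = (fun x => (0 : C) *: (fun=> 0 : 'cV[C]_2) x) :> vfun.
    by apply/funext => x; rewrite scale0r.
  by rewrite EHZ ?scale0r //; exact: inL2_0.
have [i1 e1] := IH (fun i => c (widen_ord (leqnSn n) i)) (fun i => U (widen_ord (leqnSn n) i))
   (fun i => hU _).
have -> : (fun x => \sum_(i < n.+1) c i *: U i x) =
  (fun x => (\sum_(i < n) c (widen_ord (leqnSn n) i) *: U (widen_ord (leqnSn n) i) x) +
     c ord_max *: U ord_max x).
  by apply/funext => x; rewrite big_ord_recr.
have i2 : inL2 l (fun x => c ord_max *: U ord_max x) by exact: inL2Z.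
split=> [|j]; first exact: inL2D.
by rewrite EHD // e1 EHZ // big_ord_recr.
Qed.

End Coefficients.

Opaque ip dprim.

(** * The matrix of the explicit inverse in the cosine basis *)

Section CoefficientsOfResolvent.
Variables (R : realType) (l : R).
Hypothesis l0 : 0 < l.
Local Notation D := (itv0l l).
Local Notation C := R[i].
Local Notation nc := (@Normc.normc R).
Local Notation vfun := (R -> 'cV[C]_2).
Local Notation H := (ell2T R).
Local Notation delta := (@delta R).
Local Notation en := (en l).
Local Notation ip := (ip l).
Local Notation coef := (coef l).
Local Notation EH := (EH l0).
Local Notation EHE := (EHE l0).
Implicit Types (U V F : vfun).

Definition Lsp : R := (pi / l) ^+ 2.
Lemma Lsp_gt0 : 0 < Lsp. Proof. by rewrite exprn_gt0 // divr_gt0 // pi_gt0. Qed.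

Lemma lam_freq n : lam Lsp n = freq l n ^+ 2.
Proof. by rewrite /lam /freq exprMn mulrC. Qed.

Variables (a b : R).
Hypothesis b0 : b != 0.
Variable K : H -> H.
Hypothesis hK : scalar_op Lsp_gt0 ((l ^+ 2 / 3)%:C%C) K.

Lemma ip_cst c n : ip (fun=> c) (en n) = if n == 0%N then c * Num.sqrt l else 0.
Proof.
have sl : 0 < Num.sqrt l by rewrite sqrtr_gt0.
have one : (fun=> c) = (fun x => (c * Num.sqrt l) * en 0 x).
  apply/funext => x; rewrite /en cs0E mulr1 -mulrA /ec /= mul1r sqrtrV ?(ltW l0) //.
  by rewrite divff ?mulr1 // gt_eqF.
rewrite one ipZl; [|exact: en_sqi|exact: en_sqi].
by rewrite ip_en // eq_sym; case: eqP => _; rewrite ?mulr1 ?mulr0.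
Qed.

Lemma csum_pair N (f g : nat -> R) :
  \sum_(i < N) ((- f i) +i* (- g i))%C = ((- \sum_(i < N) f i) +i* (- \sum_(i < N) g i))%C.
Proof.
apply: C_eq; first by rewrite (Re_sum N (fun i => (- f i +i* - g i)%C)) /= sumrN.
by rewrite (Im_sum N (fun i => (- f i +i* - g i)%C)) /= sumrN.
Qed.

Lemma pair_cvg (f g : nat -> R) A B :
  \sum_(i < N) f i @[N --> \oo] --> A -> \sum_(i < N) g i @[N --> \oo] --> B ->
  ccvg (fun N => ((- \sum_(i < N) f i) +i* (- \sum_(i < N) g i))%C) ((- A) +i* (- B))%C.
Proof. by move=> hf hg; split; apply: cvgN. Qed.

Lemma pair_alg (z : C) (p q : R) n :
  ((((if n == 0%N then complex.Re ((Num.sqrt l)%:C%C * 'i%C * z) * Num.sqrt l else 0) + p) +i*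
    ((if n == 0%N then complex.Im ((Num.sqrt l)%:C%C * 'i%C * z) * Num.sqrt l else 0) + q))%C) =
  (p +i* q)%C + 'i%C * l%:C%C * z * (if n == 0%N then 1 else 0).
Proof.
have ll : Num.sqrt l * Num.sqrt l = l by rewrite -expr2 sqr_sqrtr // ltW.
case: (n == 0%N); last by rewrite mulr0 addr0 !add0r.
rewrite -[in RHS]ll mulr1.
by apply: C_eq; rewrite ?(ReD, ImD, Re_mul, Im_mul) /=; ring.
Qed.

Definition c0 F : 'cV[C]_2 := \col_j EH j F 0%N.

Lemma lamI_real n : lamI Lsp n = ((lam Lsp n)^-1)%:C%C.
Proof. by rewrite /lamI /cl -fmorphV. Qed.

(** [K] is the matrix of [dprim]: rows n > 0 are [dprim_coef], and row 0 is the limit in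
    [dprim_coef0], whose sums start at 1 because [wv] vanishes at 0. *)
Lemma K_coef F j n : inL2 l F -> K (EH j F) n =
  (ip (dprim l (crd true F j)) (en n) +i* ip (dprim l (crd false F j)) (en n))%C.
Proof.
move=> hF; have sF := (inL2P l F).1 hF; have [_ K0 KS] := hK.
case: n => [|n].
  rewrite K0.
  have [h _] := dot_hsum (wv Lsp_gt0) (EH j F).
  have hd r : \sum_(i < N) (ip (crd r F j) (en i.+1) * (Num.sqrt 2 / (freq l i.+1) ^+ 2)) @[N --> \oo] -->
    l ^+ 2 / 3 * ip (crd r F j) (en 0) - ip (dprim l (crd r F j)) (en 0) by exact: dprim_coef0.
  have e1 : ccvg (fun N => \sum_(i < N.+1) wv Lsp_gt0 i * EH j F i)
     ((- (l ^+ 2 / 3 * ip (crd true F j) (en 0) - ip (dprim l (crd true F j)) (en 0))) +i*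
     (- (l ^+ 2 / 3 * ip (crd false F j) (en 0) - ip (dprim l (crd false F j)) (en 0))))%C.
    have E N : \sum_(i < N.+1) wv Lsp_gt0 i * EH j F i =
      ((- \sum_(i < N) (ip (crd true F j) (en i.+1) * (Num.sqrt 2 / (freq l i.+1) ^+ 2))) +i*
      (- \sum_(i < N) (ip (crd false F j) (en i.+1) * (Num.sqrt 2 / (freq l i.+1) ^+ 2))))%C.
      rewrite big_ord_recl wv0 mul0r add0r.
      have T i : wv Lsp_gt0 (lift ord0 i) * EH j F (lift ord0 i) =
        ((- (ip (crd true F j) (en i.+1) * (Num.sqrt 2 / (freq l i.+1) ^+ 2))) +i*
        (- (ip (crd false F j) (en i.+1) * (Num.sqrt 2 / (freq l i.+1) ^+ 2))))%C.
        rewrite wvE EHE // lamI_real lam_freq /coef /s2 lift0.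
        by apply: C_eq; rewrite ?(Re_mul, Im_mul, ReN, ImN) /=; ring.
      rewrite (eq_bigr _ (fun i _ => T _ i)).
      exact: (csum_pair N (fun i => ip (crd true F j) (en i.+1) * (Num.sqrt 2 / (freq l i.+1) ^+ 2))
        (fun i => ip (crd false F j) (en i.+1) * (Num.sqrt 2 / (freq l i.+1) ^+ 2))).
    rewrite (funext E).
    by apply: (@pair_cvg (fun i => ip (crd true F j) (en i.+1) * (Num.sqrt 2 / (freq l i.+1) ^+ 2))
      (fun i => ip (crd false F j) (en i.+1) * (Num.sqrt 2 / (freq l i.+1) ^+ 2)));
      [exact: (hd true)|exact: (hd false)].
  have e2 : ccvg (fun N => \sum_(i < N.+1) wv Lsp_gt0 i * EH j F i) (dot (wv Lsp_gt0) (EH j F)).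
    have [c1 c2] := hsum_ccvg h; split.
      by move: c1; rewrite -(cvg_shiftS (fun N => complex.Re (\sum_(i < N) wv Lsp_gt0 i * EH j F i))).
    by move: c2; rewrite -(cvg_shiftS (fun N => complex.Im (\sum_(i < N) wv Lsp_gt0 i * EH j F i))).
  rewrite (ccvg_unique e2 e1) (EHE j 0 hF) /coef.
  by apply: C_eq; rewrite ?(ReD, ImD, Re_mul, Im_mul) /=; ring.
rewrite KS // wvE (EHE j n.+1 hF) (EHE j 0 hF) lamI_real lam_freq /coef /s2.
refine (etrans _ (esym (f_equal2 (@Complex R) (dprim_coef l0 n (sF true j))
  (dprim_coef l0 n (sF false j))))).
by apply: C_eq; rewrite ?(ReD, ImD, Re_mul, Im_mul, ReN, ImN) /=; ring.
Qed.

(** The constant part of the inverse acts on mode 0 only. The mean of F is sqrt l times its 0-th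
    coefficient and a constant c has 0-th coefficient c sqrt l; the two factors make the [l]. *)
Lemma coef_resolvent j F : inL2 l F ->
  EH j (resolvent0 l a b F) =
  K (EH j F) + ('i%C * l%:C%C * (invmx (Mab a b) *m c0 F) j 0) *: delta 0.
Proof.
move=> hF; have sF := (inL2P l F).1 hF; have hR := resolvent0_inL2 a b l0 hF.
have mE : vmean l F = (Num.sqrt l)%:C%C *: c0 F.
  apply/matrixP => i k; rewrite ord1 !mxE (EHE i 0 hF) /coef.
  rewrite (intgE_en0 l0 (sF true i)) (intgE_en0 l0 (sF false i)).
  by apply: C_eq; rewrite ?(Re_mul, Im_mul) /=; ring.
have rE : resu0 l a b F = ((Num.sqrt l)%:C%C * 'i%C) *: (invmx (Mab a b) *m c0 F).
  by rewrite /resu0 mE -scalemxAr scalerA mulrC.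
apply: HE => n; rewrite [RHS]HD [X in _ + X]HZ (EHE j n hR) (K_coef j n hF) /coef /resolvent0 !crd_mkv.
have se := en_sqi l n.
have sd r : sqi l (dprim l (crd r F j)) by apply: (dprim_sqi l0); exact: sqi_intgble.
have sc r : sqi l (fun=> vcrd r (resu0 l a b F) j) by exact: sqi_cst.
refine (etrans (f_equal2 (@Complex R) (ipDl (sc true) (sd true) se)
  (ipDl (sc false) (sd false) se)) _).
rewrite (ip_cst (vcrd true _ j) n) (ip_cst (vcrd false _ j) n) deltaE rE /vcrd mxE.
exact: pair_alg.
Qed.

End CoefficientsOfResolvent.

(** * Jordan form of the boundary matrix *)

Section JordanForm.
Variable R : realType.
Local Notation C := R[i].

Definition mk2 (x y z w : C) : 'M[C]_2 :=
  \matrix_(i, j) (if i == 0 then (if j == 0 then x else y) else (if j == 0 then z else w)).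

Lemma mk2M x y z w x' y' z' w' : mk2 x y z w *m mk2 x' y' z' w' =
  mk2 (x * x' + y * z') (x * y' + y * w') (z * x' + w * z') (z * y' + w * w').
Proof.
apply/matrixP => i j; rewrite !mxE big_ord_recl big_ord1 !mxE /=.
by case: (i == 0); case: (j == 0).
Qed.

Lemma mk2_1 : mk2 1 0 0 1 = 1%:M.
Proof. by apply/matrixP => -[[|[|//]] i] [[|[|//]] j]; rewrite !mxE. Qed.

Lemma mk2_inv x y z w : x * w - y * z != 0 ->
  mk2 x y z w *m ((x * w - y * z)^-1 *: mk2 w (- y) (- z) x) = 1%:M.
Proof.
move=> d0; rewrite -scalemxAr mk2M -mk2_1; apply/matrixP => i j; rewrite !mxE.
case: (i == 0); case: (j == 0) => /=; apply: (mulfI d0); rewrite mulVKf //; ring.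
Qed.

Lemma Mab_mk2 (a b : R) : Mab a b = mk2 a%:C%C b%:C%C (- b%:C%C) 0.
Proof.
by apply/matrixP => -[[|[|//]] i] [[|[|//]] j]; rewrite !mxE //= rmorphN.
Qed.

(** The eigenvalues are the roots (a + s) / 2 and (a - s) / 2 of m^2 - a m + b^2, with s^2 = a^2 - 4
    b^2 and eigenvectors (m, - b). For s = 0 the first basis vector completes the Jordan basis. *)
Lemma Mab_jordan (a b : R) : 0 < a -> b != 0 ->
  exists (P Pi : 'M[C]_2) (m1 m2 ep : C),
  [/\ P *m Pi = 1%:M, Mab a b *m P = P *m mk2 m1 ep 0 m2,
      0 < complex.Re m1, 0 < complex.Re m2 & ep != 0 -> m1 = m2].
Proof.
move=> a0 b0; rewrite Mab_mk2; set A := a%:C%C; set B := b%:C%C.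
have B0 : B != 0 by rewrite /B fmorph_eq0.
pose s : C := sqrtC (A ^+ 2 - 4 * B ^+ 2).
have ss : s ^+ 2 = A ^+ 2 - 4 * B ^+ 2 by rewrite /s sqrtCK.
(* As s^2 is real, s is real or purely imaginary; in the real case s^2 = a^2 - 4 b^2 < a^2. *)
have Rs : `|complex.Re s| < a.
  have h1 := congr1 (@complex.Re R) ss; have h2 := congr1 (@complex.Im R) ss.
  move: h1 h2; rewrite !expr2 /A /B; case: s {ss} => x y /= h1 h2.
  have bb : 0 < b * b by rewrite -expr2 exprn_even_gt0.
  rewrite -(@ltr_pXn2r _ 2) ?nnegrE ?(ltW a0) // real_normK ?num_real // !expr2.
  have /eqP : x * y = 0 by lra.
  rewrite mulf_eq0 => /orP[/eqP ->|/eqP y0]; first by rewrite mulr0 mulr_gt0.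
  by rewrite y0 in h1; lra.
have c2 : (2 : C) != 0 by rewrite pnatr_eq0.
have Rh (z : C) : complex.Re (z / 2) = complex.Re z / 2.
  have -> : (2 : C)^-1 = (2^-1 : R)%:C%C by rewrite fmorphV -(rmorph_nat (real_complex R)).
  by rewrite Re_mul /= mulr0 subr0.
have rts t : t ^+ 2 = s ^+ 2 -> ((A + t) / 2) ^+ 2 = A * ((A + t) / 2) - B ^+ 2.
  move=> ts; have : 4 * ((A + t) / 2) ^+ 2 = 4 * (A * ((A + t) / 2) - B ^+ 2).
    rewrite (_ : 4 * ((A + t) / 2) ^+ 2 = A ^+ 2 + 2 * A * t + t ^+ 2); last by field.
    by rewrite ts ss; field.
  by apply: mulfI; rewrite pnatr_eq0.
move: Rs; rewrite ltr_norml => /andP[s1 s2].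
have RA : complex.Re A = a by [].
have [s0|s0] := eqVneq s 0.
  pose m : C := A / 2.
  have mm : m ^+ 2 = A * m - B ^+ 2 by have := rts 0; rewrite addr0 s0 => ->.
  have A2 : A = 2 * m by rewrite /m mulrCA divff ?mulr1.
  have d0 : m * 0 - 1 * (- B) != 0 by rewrite mulr0 mul1r opprK add0r.
  exists (mk2 m 1 (- B) 0), ((m * 0 - 1 * (- B))^-1 *: mk2 0 (- 1) (- - B) m), m, m, 1.
  split=> //; first exact: mk2_inv.
  - rewrite !mk2M; congr mk2; rewrite ?A2; move: mm; rewrite A2.
    + by move=> mm; rewrite mulrN -[B * B]expr2 -mm expr2 mulr0 addr0.
    + by move=> _; ring.
    + by move=> _; ring.
    + by move=> _; ring.
  - by rewrite /m Rh RA divr_gt0.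
  - by rewrite /m Rh RA divr_gt0.
pose m1 : C := (A + s) / 2; pose m2 : C := (A + - s) / 2.
have e1 : m1 ^+ 2 = A * m1 - B ^+ 2 by exact: rts.
have e2 : m2 ^+ 2 = A * m2 - B ^+ 2 by apply: rts; rewrite sqrrN.
have d0 : m1 * (- B) - m2 * (- B) != 0.
  rewrite (_ : _ - _ = - (s * B)); first by rewrite oppr_eq0 mulf_neq0.
  by rewrite /m1 /m2; field.
exists (mk2 m1 m2 (- B) (- B)),
  ((m1 * (- B) - m2 * (- B))^-1 *: mk2 (- B) (- m2) (- - B) m1), m1, m2, 0.
split.
- exact: mk2_inv.
- rewrite !mk2M; congr mk2.
  + by rewrite mulr0 addr0 -expr2 e1; ring.
  + by rewrite mulr0 add0r -expr2 e2; ring.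
  + ring.
  + ring.
- by rewrite /m1 Rh ReD RA divr_gt0 //; lra.
- by rewrite /m2 Rh ReD ReN RA divr_gt0 //; lra.
- by rewrite eqxx.
Qed.

End JordanForm.

(** * Transfer from functions to the coupled operator on ell^2 *)

Section Transfer.
Variables (R : realType) (l a b : R).
Hypotheses (l0 : 0 < l) (b0 : b != 0).
Local Notation C := R[i].
Local Notation nc := (@Normc.normc R).
Local Notation vfun := (R -> 'cV[C]_2).
Local Notation H := (ell2T R).
Local Notation delta := (@delta R).
Local Notation EH := (EH l0).
Implicit Types (U V F : vfun).

Variables (P Pi : 'M[C]_2) (m1 m2 ep : C).
Hypotheses (PPi : P *m Pi = 1%:M) (MP : Mab a b *m P = P *m mk2 m1 ep 0 m2)
  (m10 : m1 != 0) (m20 : m2 != 0).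

Let PiP : Pi *m P = 1%:M. Proof. exact: mulmx1C. Qed.

Definition lc (M : 'M[C]_2) (j : 'I_2) (x y : H) : H := M j 0 *: x + M j 1 *: y.

Lemma lc_nm M j x y : nm (lc M j x y) <= nc (M j 0) * nm x + nc (M j 1) * nm y.
Proof. by apply: (le_trans (nmD _ _)); rewrite lerD ?nmZ_le. Qed.

Lemma mul2E n (M : 'M[C]_2) (N : 'M[C]_(2, n)) i j : (M *m N) i j = M i 0 * N 0 j + M i 1 * N 1 j.
Proof.
by rewrite mxE big_ord_recl big_ord1 (_ : lift ord0 ord0 = 1) //; apply/val_inj.
Qed.

Lemma lc_lc M N j x y : lc M j (lc N 0 x y) (lc N 1 x y) = lc (M *m N) j x y.
Proof.
rewrite /lc !mul2E !scalerDr !scalerA !scalerDl addrACA //.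
Qed.

Lemma lc_1 j x y : lc 1%:M j x y = if j == 0 then x else y.
Proof.
by case: j => [[|[|//]] p]; rewrite /lc !mxE /= ?scale1r ?scale0r ?addr0 ?add0r.
Qed.

Definition Jop U : H := join (lc Pi 0 (EH 0 U) (EH 1 U)) (lc Pi 1 (EH 0 U) (EH 1 U)).

Lemma EH_J j U : EH j U = lc P j (odH (Jop U)) (evH (Jop U)).
Proof.
rewrite /Jop od_join ev_join lc_lc PPi lc_1.
by case: j => [[|[|//]] p] /=; congr EH; apply/val_inj.
Qed.

Lemma JD U V : inL2 l U -> inL2 l V -> Jop (fun x => U x + V x) = Jop U + Jop V.
Proof.
by move=> hU hV; rewrite /Jop !EHD // joinD; congr join; rewrite /lc !scalerDr addrACA.
Qed.

Lemma JZ c U : inL2 l U -> Jop (fun x => c *: U x) = c *: Jop U.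
Proof.
by move=> hU; rewrite /Jop !EHZ // joinZ; congr join; rewrite /lc scalerDr !scalerA ![c * _]mulrC.
Qed.

Lemma J_eq U V : inL2 l U -> inL2 l V -> eqL2 l U V <-> Jop U = Jop V.
Proof.
move=> hU hV; rewrite (EH_eq l0 hU hV); split=> [h|h j]; first by rewrite /Jop !h.
by rewrite !EH_J h.
Qed.

Lemma J_surj (h : H) : exists2 U, inL2 l U & Jop U = h.
Proof.
have [U hU e] := EH_surj l0 (fun j => lc P j (odH h) (evH h)).
exists U => //; rewrite /Jop !e !lc_lc PiP !lc_1 /=.
exact: join_evod.
Qed.

Lemma J_sum n (c : 'I_n -> C) (U : 'I_n -> vfun) : (forall i, inL2 l (U i)) ->
  Jop (fun x => \sum_(i < n) c i *: U i x) = \sum_(i < n) c i *: Jop (U i).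
Proof.
move=> hU; have [_ e] := EH_sum l0 c hU.
apply: HE => k; rewrite (big_morph (fun w : H => (w k : C)) (fun a b => HD a b k) (H0 _ k)).
under [RHS]eq_bigr do rewrite HZ.
rewrite /Jop !e !joinE.
have S (j : 'I_2) i : (\sum_(q < n) c q *: EH j (U q)) i = \sum_(q < n) c q * EH j (U q) i.
  rewrite (big_morph (fun w : H => (w i : C)) (fun a b => HD a b i) (H0 _ i)).
  by apply: eq_bigr => q _; rewrite HZ.
case: ifP => ok; rewrite /lc HD !HZ !S !mulr_sumr -big_split; apply: eq_bigr => i _;
  by rewrite joinE ok HD !HZ mulrDr; congr (_ + _); exact: mulrCA.
Qed.

Lemma J_norm : exists2 c : R, 0 < c & forall U, inL2 l U ->
  nm (Jop U) <= c * normL2 l U /\ normL2 l U <= c * nm (Jop U).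
Proof.
pose n2 (M : 'M[C]_2) := nc (M 0 0) + nc (M 0 1) + nc (M 1 0) + nc (M 1 1).
have n20 M : 0 <= n2 M by rewrite !addr_ge0 ?nc_ge0.
have main (M : 'M[C]_2) x y t : nm x <= t -> nm y <= t ->
    nm (lc M 0 x y) + nm (lc M 1 x y) <= n2 M * t.
  move=> hx hy; apply: (le_trans (lerD (lc_nm _ _ _ _) (lc_nm _ _ _ _))).
  rewrite /n2 !mulrDl !addrA !lerD // ler_wpM2l ?nc_ge0 //.
exists (n2 P + n2 Pi + 1); first by rewrite ltr_wpDl // addr_ge0.
move=> U hU; split.
  apply: (le_trans (nm_join _ _)).
  apply: (le_trans (main Pi _ _ (normL2 l U) (nm_EH l0 0 hU) (nm_EH l0 1 hU))).
  rewrite ler_wpM2r ?normL2_ge0 //; have := n20 P; lra.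
apply: (le_trans (normL2_le l0 hU)); rewrite !EH_J.
apply: (le_trans (main P _ _ (nm (Jop U)) (nm_od _) (nm_ev _))).
rewrite ler_wpM2r ?nm_ge0 //; have := n20 Pi; lra.
Qed.

Variable K : H -> H.
Hypothesis hK : scalar_op (Lsp_gt0 l0) ((l ^+ 2 / 3)%:C%C) K.

(** On the copy with eigenvalue [m] of the boundary matrix, the constant part contributes i l / m to
    the entry of mode 0. Its imaginary part is l Re m / |m|^2, so positivity of Re m gives the sign
    required by the spectral analysis. *)
Definition Tm (m : C) (x : H) : H := K x + ('i%C * l%:C%C / m * x 0%N) *: delta 0.
Definition thm (m : C) : C := (l ^+ 2 / 3)%:C%C + 'i%C * l%:C%C / m.

Lemma Tm_scalar m : scalar_op (Lsp_gt0 l0) (thm m) (Tm m).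
Proof.
have [bK K0 KS] := hK; split.
- apply: (blinDf bK); split=> [c x y|]; first by rewrite HD HZ mulrDr scalerDl scalerA mulrCA.
  exists ((nc ('i%C * l%:C%C / m) + 1) * (nm (delta 0) + 1)) => [|x].
    by rewrite mulr_gt0 // ltr_wpDl ?nc_ge0 ?nm_ge0.
  apply: (le_trans (nmZ_le _ _)); rewrite ncM.
  apply: (@le_trans _ _ (nc ('i%C * l%:C%C / m) * nm x * nm (delta 0))).
    by rewrite ler_wpM2r ?nm_ge0 // ler_wpM2l ?nc_ge0 ?nm_coord.
  by rewrite mulrAC ler_wpM2r ?nm_ge0 // ler_pM ?nc_ge0 ?nm_ge0 // lerDl.
- by move=> x; rewrite /Tm HD HZ delta_same mulr1 K0 /thm mulrDl addrAC.
- by move=> x n n0; rewrite /Tm HD HZ deltaE gtn_eqF // mulr0 addr0 KS.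
Qed.

Lemma Im_thm m : 0 < complex.Re m -> 0 < complex.Im (thm m).
Proof.
move=> hm; rewrite /thm ImD /= add0r.
case: m hm => x y /= x0.
rewrite (_ : _ + _ = l * (x / (x ^+ 2 + y ^+ 2))); last by ring.
rewrite mulr_gt0 // divr_gt0 //.
by rewrite ltr_wpDr ?sqr_ge0 // exprn_gt0.
Qed.

(** i l times the off-diagonal entry of the inverse of the Jordan matrix. *)
Definition ejord : C := - ('i%C * l%:C%C * ep / (m1 * m2)).
Definition Sop : H -> H := Rh (Tm m1) (Tm m2) ejord.

Lemma J_resolvent F : inL2 l F -> Jop (resolvent0 l a b F) = Sop (Jop F).
Proof.
move=> hF; have [bK _ _] := hK.
pose Li := mk2 m1^-1 (- (ep / (m1 * m2))) 0 m2^-1.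
have LLi : mk2 m1 ep 0 m2 *m Li = 1%:M.
  by rewrite mk2M -mk2_1; congr mk2; field; rewrite ?m10 ?m20.
have PiM : Pi *m invmx (Mab a b) = Li *m Pi.
  have uM := Mab_unit a b0.
  have e : invmx (Mab a b) *m P = P *m Li.
    have := congr1 (fun X => invmx (Mab a b) *m X *m Li) MP.
    by rewrite mulKmx // -!mulmxA LLi mulmx1 => ->.
  have := congr1 (fun X => Pi *m X *m Pi) e.
  by rewrite /= -!mulmxA PPi mulmx1 !mulmxA PiP mul1mx.
pose u := lc Pi 0 (EH 0 F) (EH 1 F); pose w := lc Pi 1 (EH 0 F) (EH 1 F).
have Pic j : (Pi *m c0 l0 F) j 0 = lc Pi j (EH 0 F) (EH 1 F) 0%N.
  by rewrite mul2E [in RHS]/lc [in RHS]HD !HZ !mxE.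
have comp j : lc Pi j (EH 0 (resolvent0 l a b F)) (EH 1 (resolvent0 l a b F)) =
  K (lc Pi j (EH 0 F) (EH 1 F)) + ('i%C * l%:C%C * (Li *m (Pi *m c0 l0 F)) j 0) *: delta 0.
  rewrite !(coef_resolvent a b hK) // mulmxA -PiM -mulmxA.
  set q := invmx _ *m _; rewrite /lc (blinD _ _ bK) !(blinZ _ _ bK) !scalerDr addrACA.
  congr (_ + _); rewrite !scalerA -scalerDl; congr (_ *: _).
  by rewrite [in RHS]mul2E; ring.
have L00 : Li 0 0 = m1^-1 by rewrite mxE.
have L01 : Li 0 1 = - (ep / (m1 * m2)) by rewrite mxE.
have L10 : Li 1 0 = 0 by rewrite mxE.
have L11 : Li 1 1 = m2^-1 by rewrite mxE.
rewrite /Sop {1}/Jop !comp /Jop Rh_join -/u -/w; congr join.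
  rewrite /Tm -addrA -scalerDl; congr (_ + _ *: _).
  rewrite mul2E !Pic -/u -/w L00 L01 /ejord; move: (u 0%N) (w 0%N) => p q.
  by rewrite invfM; ring.
rewrite /Tm; congr (_ + _ *: _).
rewrite mul2E !Pic -/u -/w L10 L11; move: (u 0%N) (w 0%N) => p q.
by rewrite mul0r add0r mulrA.
Qed.

Lemma Tab_J U F : Tab l a b U F <-> [/\ inL2 l F, inL2 l U & Jop U = Sop (Jop F)].
Proof.
split=> [/(TabP a l0 b0)[hF hU e]|[hF hU e]].
  by split=> //; rewrite -J_resolvent //; apply/J_eq => //; exact: resolvent0_inL2.
apply/(TabP a l0 b0); split=> //; apply/J_eq => //; first exact: resolvent0_inL2.
by rewrite e J_resolvent.
Qed.

End Transfer.

(** [f] may repeat values, but it is injective on the even indices beyond [N]; so its range is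
    infinite and countable and can be listed without repetition. *)
Lemma enumerate_range (R : realType) (f : nat -> R[i]) (N : nat) :
  (forall m n, (N <= m)%N -> (N <= n)%N -> odd m = odd n -> f m = f n -> m = n) ->
  exists2 lambda : nat -> R[i], injective lambda & range lambda = range f.
Proof.
move=> hf.
have inf : infinite_set (range f).
  apply/infiniteP; pose h n := f (N + n).*2.
  have hi : injective h.
    move=> m n e; have le k : (N <= (N + k).*2)%N by rewrite -addnn -addnA leq_addr.
    have := hf _ _ (le m) (le n) (etrans (odd_double _) (esym (odd_double _))) e.
    by move=> /(congr1 half); rewrite !doubleK => /addnI.
  have e : (range h #= [set: nat])%card by apply: inj_card_eq => x y _ _ /hi.
  apply: (card_le_trans (B := range h)); first by rewrite (card_le_eqr e).
  by apply: subset_card_le => _ [n _ <-]; exists (N + n).*2.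
have cf : countable (range f) by exact: card_image_le.
have /card_set_bijP[F [hF1 hF2 hF3]] := eq_card_nat cf inf.
have /choice[lambda hl] n : exists z, range f z /\ F z = n.
  by have [z hz e] := hF3 n I; exists z.
exists lambda.
  by move=> m n e; rewrite -(hl m).2 -(hl n).2 e.
apply/seteqP; split=> [_ [n _ <-]|z hz]; first exact: (hl n).1.
by exists (F z) => //; apply: hF2; rewrite ?inE //; [exact: (hl _).1|exact: (hl _).2].
Qed.

(** * Spectrum, multiplicities and Riesz basis from the triangular form *)

Section Final.
Variables (R : realType) (l : R).
Local Notation C := R[i].
Local Notation nc := (@Normc.normc R).
Local Notation vfun := (R -> 'cV[C]_2).
Local Notation H := (ell2T R).
Local Notation delta := (@delta R).
Implicit Types (U V F : vfun).

Variables (T : vfun -> vfun -> Prop) (J : vfun -> H) (S : H -> H) (cJ : R).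
Hypotheses (hT : forall U F, T U F <-> [/\ inL2 l F, inL2 l U & J U = S (J F)])
  (JD : forall U V, inL2 l U -> inL2 l V -> J (fun x => U x + V x) = J U + J V)
  (JZ : forall c U, inL2 l U -> J (fun x => c *: U x) = c *: J U)
  (J_eq : forall U V, inL2 l U -> inL2 l V -> eqL2 l U V <-> J U = J V)
  (J_surj : forall h, exists2 U, inL2 l U & J U = h)
  (J_sum : forall n (c : 'I_n -> C) (U : 'I_n -> vfun), (forall i, inL2 l (U i)) ->
     inL2 l (fun x => \sum_(i < n) c i *: U i x) /\
     J (fun x => \sum_(i < n) c i *: U i x) = \sum_(i < n) c i *: J (U i))
  (cJ0 : 0 < cJ)
  (J_norm : forall U, inL2 l U -> nm (J U) <= cJ * normL2 l U /\ normL2 l U <= cJ * nm (J U))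
  (bS : blin S)
  (S_im : forall x nu, S x = nu *: x -> x <> 0 -> 0 < complex.Im nu).

Variables (N : nat) (Q Q' : H -> H) (nu : nat -> C) (g : R).
Hypotheses (aQ : aut Q Q') (St : setup (fun x => Q' (S (Q x))) 0 nu) (g0 : 0 < g)
  (nu_tail : forall n, (N <= n)%N -> complex.Im (nu n)^-1 <= - g)
  (nu_inj : forall m n, (N <= m)%N -> (N <= n)%N -> odd m = odd n -> nu m = nu n -> m = n).

Lemma inL2_sub U V : inL2 l U -> inL2 l V -> inL2 l (fun x => U x - V x).
Proof.
move=> hU hV; have -> : (fun x => U x - V x) = (fun x => U x + (fun y => (-1 : C) *: V y) x).
  by apply/funext => x; rewrite scaleN1r.
by apply: inL2D => //; exact: inL2Z.
Qed.

Lemma JB U V : inL2 l U -> inL2 l V -> J (fun x => U x - V x) = J U - J V.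
Proof.
move=> hU hV; have -> : (fun x => U x - V x) = (fun x => U x + (fun y => (-1 : C) *: V y) x).
  by apply/funext => x; rewrite scaleN1r.
rewrite JD //; last exact: inL2Z.
by rewrite JZ // scaleN1r.
Qed.

Lemma J0 : J (fun=> 0) = 0.
Proof.
have -> : (fun=> 0) = (fun x => (0 : C) *: (fun=> 0 : 'cV[C]_2) x) :> vfun.
  by apply/funext => x; rewrite scale0r.
by rewrite JZ ?scale0r //; exact: inL2_0.
Qed.

Lemma shiftP z U F : shift_op T z U F <-> [/\ inL2 l F, inL2 l U & J U = S (J F + z *: J U)].
Proof.
rewrite /shift_op; split=> [/hT[h1 h2 h3]|[h1 h2 h3]].
  have hF : inL2 l F.
    have -> : F = (fun x => (F x + z *: U x) + (- z) *: U x).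
      by apply/funext => x; rewrite scaleNr addrK.
    by apply: inL2D => //; exact: inL2Z.
  by split=> //; rewrite -JZ // -JD //; exact: inL2Z.
have hz : inL2 l (fun x => z *: U x) by exact: inL2Z.
apply/hT; split=> //; first exact: inL2D.
by rewrite JD // JZ.
Qed.

Let bQ : blin Q. Proof. by case: aQ. Qed.
Let bQ' : blin Q'. Proof. by case: aQ. Qed.
Let QK : cancel Q Q'. Proof. by case: aQ. Qed.
Let Q'K : cancel Q' Q. Proof. by case: aQ. Qed.

Lemma nu_neq0 n : nu n != 0. Proof. by have [_ _ h _ _] := St; have [] := h n (leq0n n). Qed.

Lemma eig_nu x z : S x = z *: x -> x <> 0 -> exists n, z = nu n.
Proof.
move=> e x0; have q0 : Q' x <> 0.
  by move=> q; apply: x0; rewrite -[x]Q'K q (blin0 bQ).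
have [n tn xn] := first_coord q0; exists n.
apply: (gen_eigen_nu (m := 1) St _ tn xn).
by rewrite /= /sh Q'K e (blinZ _ _ bQ') subrr.
Qed.

Lemma nu_eig n : exists2 x, x <> 0 & S x = nu n *: x.
Proof.
have [x x0 e] := nu_eigen n St; exists (Q x).
  by move=> q; apply: x0; rewrite -[x]QK q (blin0 bQ').
by rewrite -[LHS]Q'K e (blinZ _ _ bQ).
Qed.

Lemma op_eigenvalueP z : op_eigenvalue l T z <-> exists n, z = (nu n)^-1.
Proof.
split=> [[U /shiftP[_ hU e] nU]|[n ->]].
  have h0 : J U <> 0 by rewrite -J0 => h; apply: nU; apply/J_eq => //; exact: inL2_0.
  move: e; rewrite J0 add0r (blinZ _ _ bS) => e.
  have z0 : z != 0 by apply/eqP => z0; apply: h0; rewrite e z0 scale0r.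
  have [n hn] : exists n, z^-1 = nu n.
    by apply: (eig_nu _ h0); rewrite [in RHS]e scalerA mulVf // scale1r.
  by exists n; rewrite -hn invrK.
have [x x0 e] := nu_eig n; have [U hU Ux] := J_surj x.
exists U; last by move=> /J_eq h; apply: x0; rewrite -Ux h ?J0 //; exact: inL2_0.
apply/shiftP; split=> //; first exact: inL2_0.
by rewrite J0 add0r (blinZ _ _ bS) Ux e scalerA mulVf ?nu_neq0 // scale1r.
Qed.

Lemma nu_im n : complex.Im (nu n)^-1 < 0.
Proof.
have [x x0 e] := nu_eig n; have := S_im e x0.
rewrite Im_inv => h; rewrite mulNr oppr_lt0 divr_gt0 // exprn_gt0 // nc_gt0 //.
exact: nu_neq0.
Qed.

Lemma nu_im_uniform : exists2 gamma1, 0 < gamma1 & forall n, complex.Im (nu n)^-1 <= - gamma1.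
Proof.
suff [g1 g10 h1] : exists2 g1, 0 < g1 & forall n, (n < N)%N -> complex.Im (nu n)^-1 <= - g1.
  exists (Order.min g g1); first by rewrite lt_min g0.
  move=> n; case: (ltnP n N) => h; first by rewrite (le_trans (h1 n h)) // lerN2 ge_min lexx orbT.
  by rewrite (le_trans (nu_tail h)) // lerN2 ge_min lexx.
elim: (N) => [|M [g1 g10 h1]]; first by exists 1.
exists (Order.min (- complex.Im (nu M)^-1) g1); first by rewrite lt_min g10 oppr_gt0 nu_im.
move=> n; rewrite ltnS leq_eqVlt => /orP[/eqP ->|h].
  by rewrite lerNr ge_min lexx.
by rewrite (le_trans (h1 n h)) // lerN2 ge_min lexx orbT.
Qed.

Lemma resolventP z : resolvent_set l T z <-> forall n, z != (nu n)^-1.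
Proof.
split=> [[h1 _ _] n|h].
  apply/negP => /eqP e; have [U hU nU] : op_eigenvalue l T z by apply/op_eigenvalueP; exists n.
  exact: nU (h1 U hU).
have inj d : d = z *: S d -> d = 0.
  move=> e; apply: contrapT => d0.
  have z0 : z != 0 by apply/eqP => z0; apply: d0; rewrite e z0 scale0r.
  have [n hn] : exists n, z^-1 = nu n.
    by apply: (eig_nu _ d0); rewrite [in RHS]e scalerA mulVf // scale1r.
  by have := h n; rewrite -hn invrK eqxx.
have [c c0 solve] : exists2 c, 0 <= c & forall f, exists2 x, x = S (f + z *: x) & nm x <= c * nm f.
  have [K Kp hK] := bS.2.
  (* At z = 0 the resolvent is [S] itself. *)
  have [z0|z0] := eqVneq z 0.
    exists K; first exact: ltW.
    by move=> f; exists (S f) => //; rewrite z0 scale0r addr0.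
  have zv0 : z^-1 != 0 by rewrite invr_eq0.
  have [|c hc] := resolvent_bound St zv0.
    by move=> n; apply: contra (h n) => /eqP ->; rewrite invrK.
  have [K1 K10 hK1] := bQ.2; have [K2 K20 hK2] := bQ'.2.
  exists (K1 * (`|c| * (nc z^-1 * (K2 * K)))).
    by rewrite !mulr_ge0 ?nc_ge0 // ltW.
  (* Divided by - z, the equation x = S (f + z x) becomes (S - 1/z) x = - S f / z, which is solved
     in the coordinates given by [Q]. *)
  move=> f; have [y ey hy] := hc ((- z^-1) *: Q' (S f)); exists (Q y).
    have e1 : S (Q y) - z^-1 *: Q y = - z^-1 *: S f.
      have := congr1 Q ey; rewrite /sh (blinB _ _ bQ) !(blinZ _ _ bQ) !Q'K //.
    rewrite (blinD _ _ bS) (blinZ _ _ bS); move/eqP: e1; rewrite subr_eq => /eqP ->.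
    rewrite scalerDr !scalerA mulrN divff // scaleN1r scale1r addrA subrr add0r //.
  have a1 : nm ((- z^-1) *: Q' (S f)) <= nc z^-1 * (K2 * K) * nm f.
    apply: (le_trans (nmZ_le _ _)); rewrite ncN -!mulrA ler_wpM2l ?nc_ge0 //.
    by apply: (le_trans (hK2 _)); rewrite ler_wpM2l ?hK // ltW.
  apply: (le_trans (hK1 _)); rewrite -!mulrA ler_wpM2l ?(ltW K10) //.
  apply: (le_trans hy); apply: (@le_trans _ _ (`|c| * nm ((- z^-1) *: Q' (S f)))).
    by rewrite ler_wpM2r ?nm_ge0 // ler_norm.
  by rewrite ler_wpM2l //; apply: (le_trans a1); rewrite !mulrA.
have uniq x y f : x = S (f + z *: x) -> y = S (f + z *: y) -> x = y.
  move=> ex ey; apply/eqP; rewrite -subr_eq0; apply/eqP; apply: inj.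
  rewrite {1}ex {1}ey -(blinB _ _ bS) -(blinZ _ _ bS); congr S.
  by rewrite opprD addrACA subrr add0r scalerBr.
split.
- move=> U /shiftP[h1 hU e]; apply/J_eq => //; rewrite J0 in e *.
  by apply: (uniq _ _ 0 e); rewrite scaler0 addr0 (blin0 bS).
- move=> F hF; have [x ex _] := solve (J F); have [U hU Ux] := J_surj x.
  by exists U; apply/shiftP; split=> //; rewrite Ux.
- exists (cJ * (c * cJ)) => U F /shiftP[hF hU e].
  have [x ex hx] := solve (J F); have xU := uniq _ _ _ e ex.
  apply: (le_trans (J_norm hU).2); rewrite -mulrA ler_wpM2l ?(ltW cJ0) // xU.
  by apply: (le_trans hx); rewrite -mulrA ler_wpM2l // (J_norm hF).1.
Qed.

Lemma iter_comm w n x : iter n (sh S w) (S x) = S (iter n (sh S w) x).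
Proof.
by elim: n => [|n IH] //=; rewrite IH /sh (blinB _ _ bS) (blinZ _ _ bS).
Qed.

(** On a generalized eigenspace with w != 0 the operator [S] is onto: if [y] is a preimage of (S -
    w) x, then (x - y) / w is a preimage of x. *)
Lemma gen_preimage w n x : w != 0 -> iter n (sh S w) x = 0 ->
  exists2 y, S y = x & iter n (sh S w) y = 0.
Proof.
move=> w0; elim: n x => [|n IH] x.
  by move=> /= ->; exists 0; rewrite ?(blin0 bS).
rewrite iterSr => /IH[y ey iy].
have hB := blin_sh w bS; have hI := iter_blin n hB.
exists (w^-1 *: (x - y)).
  rewrite (blinZ _ _ bS) (blinB _ _ bS) ey /sh opprB addrC subrK scalerA mulVf //.
  by rewrite scale1r.
rewrite iterSr (blinZ _ _ hB) (blinZ _ _ hI) (blinB _ _ hB) (blinB _ _ hI) -{1}ey.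
rewrite iter_comm iy (blin0 bS) -[sh S w y]/(S y - w *: y) (blinB _ _ hI) iter_comm iy.
by rewrite (blin0 bS) (blinZ _ _ hI) iy scaler0 subr0 subr0 scaler0.
Qed.

(** (T - z) U = V reads (S - 1/z) J U = - S (J V) / z. The additional factor [S] commutes with the
    powers in one direction and is removed by [gen_preimage] in the other. *)
Lemma ker_powP z n U : z != 0 -> ker_pow l (shift_op T z) n U <->
  inL2 l U /\ iter n (sh S z^-1) (J U) = 0.
Proof.
move=> z0; have hB := blin_sh z^-1 bS.
elim: n U => [|n IH] U /=.
  split=> -[hU e]; split=> //.
    by rewrite -J0; apply/J_eq => //; exact: inL2_0.
  by apply/J_eq => //; rewrite ?J0 //; exact: inL2_0.
split=> [[V /shiftP[hV hU e] /IH[_ iV]]|[hU e]].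
  split=> //; rewrite -iterS iterSr.
  have -> : sh S z^-1 (J U) = - z^-1 *: S (J V).
    have := congr1 (fun x => - z^-1 *: x) e; rewrite (blinD _ _ bS) (blinZ _ _ bS).
    rewrite scalerDr scalerA mulNr mulVf // scaleN1r /sh => e1.
    by rewrite addrC -scaleNr e1 subrK.
  rewrite (blinZ _ _ (iter_blin n hB)) iter_comm iV (blin0 bS) scaler0 //.
move: e; rewrite -iterS iterSr => /(gen_preimage (invr_neq0 z0))[y ey iy].
have [V hV Vy] := J_surj (- z *: y); exists V.
  apply/shiftP; split=> //; rewrite Vy (blinD _ _ bS) !(blinZ _ _ bS) ey /sh.
  by rewrite scalerBr scalerA mulNr divff // scaleN1r opprK scaleNr addrAC addNr add0r.
by apply/IH; split=> //; rewrite Vy (blinZ _ _ (iter_blin n hB)) iy scaler0.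
Qed.

(** Besides the first [N] indices, each parity class has at most one index where [nu] takes the
    value [w]: hence [N + 2]. *)
Lemma nu_fiber w : exists2 s : seq nat, (size s <= N.+2)%N & forall n, nu n = w -> n \in s.
Proof.
have pick (o : bool) : exists a, forall n, (N <= n)%N -> odd n = o -> nu n = w -> n = a.
  have [[a [Na oa ea]]|h] := pselect (exists a, [/\ (N <= a)%N, odd a = o & nu a = w]).
    by exists a => n Nn on en; apply: nu_inj => //; rewrite ?on ?en.
  by exists 0%N => n Nn on en; case: h; exists n.
have [a ha] := pick true; have [b hb] := pick false.
exists (a :: b :: iota 0 N); first by rewrite /= size_iota.
move=> n en; rewrite !inE mem_iota /= add0n.
case: (ltnP n N) => [|Nn]; first by rewrite !orbT.
case on : (odd n); first by rewrite (ha n Nn on en) eqxx.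
by rewrite (hb n Nn on en) eqxx orbT.
Qed.

Lemma blin_bigsum A p (c : 'I_p -> C) (x : 'I_p -> H) : blin A ->
  A (\sum_(i < p) c i *: x i) = \sum_(i < p) c i *: A (x i).
Proof.
move=> bA; elim/big_rec2: _ => [|i y1 y2 _ <-]; first exact: blin0.
by rewrite bA.1.
Qed.

Lemma multiplicity_le z : op_eigenvalue l T z ->
  (algebraic_multiplicity l T z <= ((N.+2)%:R)%:E)%E.
Proof.
move=> /op_eigenvalueP[n0 zE]; have z0 : z != 0 by rewrite zE invr_neq0 ?nu_neq0.
apply: ge_ereal_sup => _ [p [U [hU free]] <-]; rewrite lee_fin ler_nat.
have [s sN hs] := nu_fiber z^-1; apply: leq_trans sN.
have gU i : inL2 l (U i) /\ exists m, iter m (sh S z^-1) (J (U i)) = 0.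
  by have [m _ /(ker_powP _ _ z0)[h1 h2]] := hU i; split=> //; exists m.
apply: (gen_mult (x := fun i => Q' (J (U i))) St hs).
  move=> i; have [_ [m hm]] := gU i; exists m.
  by rewrite (conj_iter S z^-1 m (Q' (J (U i))) aQ) Q'K hm (blin0 bQ').
move=> c e; apply: free.
have [hs1 hs2] := J_sum c (fun i => (gU i).1).
apply/J_eq => //; first exact: inL2_0.
rewrite hs2 J0 -[LHS]Q'K blin_bigsum // e (blin0 bQ) //.
Qed.

(** An automorphism carries the canonical basis of ell^2 to a Riesz basis; [Psi k] is the function
    with coordinates [Q (delta k)]. *)
Lemma riesz : exists2 Psi : nat -> vfun, riesz_basis l Psi &
  forall k, gen_eigenfunction l T (Psi k).
Proof.
have /choice[Psi hPsi] k : exists U, inL2 l U /\ J U = Q (delta k).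
  by have [U hU e] := J_surj (Q (delta k)); exists U.
have [K1 K10 hK1] := bQ.2; have [K2 K20 hK2] := bQ'.2.
have partJ (u : nat -> C) n := J_sum (fun i : 'I_n => u i) (fun i => (hPsi i).1).
have partE (u : nat -> C) n : J (fun x => \sum_(k < n) u k *: Psi k x) =
    \sum_(k < n) u k *: Q (delta k).
  by rewrite (partJ u n).2; apply: eq_bigr => i _; rewrite (hPsi i).2.
have sumP u (hu : ell2 u) U : is_sumL2 l Psi u U <-> inL2 l U /\ J U = Q (mkH hu).
  split=> [[hU cv]|[hU e]]; split=> //.
    apply/eqP; rewrite -subr_eq0; apply/eqP; apply: nm_small => e e0.
    have e20 : 0 < e / 2 by rewrite divr_gt0.
    have [M hM] := blin_approx (mkH hu) bQ e20.
    move/cvgrPdist_le: cv => /(_ (e / 2 / cJ) (divr_gt0 e20 cJ0))[M' _ hM'].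
    have h1 := hM (maxn M M') (leq_maxl _ _); have h2 := hM' (maxn M M') (leq_maxr _ _).
    pose Sg := \sum_(k < maxn M M') u k *: Q (delta k).
    have c2 : nm (Sg - Q (mkH hu)) <= e / 2 by rewrite (nm_subC Sg).
    have h3 := J_norm (inL2_sub hU (partJ u (maxn M M')).1).
    rewrite (JB hU (partJ u _).1) partE in h3.
    have c1 : nm (J U - Sg) <= e / 2.
      apply: (le_trans h3.1); move: h2; rewrite /= sub0r normrN ger0_norm ?normL2_ge0 //.
      by rewrite ler_pdivlMr // mulrC.
    apply: (le_trans (@nm_triangle R Sg (J U) (Q (mkH hu)))).
    by apply: (le_trans (lerD c1 c2)); rewrite -splitr.
  apply/cvgrPdist_le => e1 e10.
  have [M hM] := blin_approx (mkH hu) bQ (divr_gt0 e10 cJ0).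
  exists M => // n /= Mn; rewrite sub0r normrN ger0_norm ?normL2_ge0 //.
  have h3 := J_norm (inL2_sub hU (partJ u n).1).
  rewrite (JB hU (partJ u n).1) partE e in h3.
  apply: (le_trans h3.2); rewrite mulrC -ler_pdivlMr //; exact: hM.
exists Psi.
  split.
  - by move=> k; exact: (hPsi k).1.
  - by move=> u hu; have [U hU e] := J_surj (Q (mkH hu)); exists U; apply/(sumP u hu).
  - exists (cJ * K1) => u U hu /(sumP u hu)[hU e].
    apply: (le_trans (J_norm hU).2); rewrite e -mulrA ler_wpM2l ?(ltW cJ0) //.
  - split.
      move=> u U v V hu hv /(sumP u hu)[hU eU] /(sumP v hv)[hV eV] /J_eq UV.
      have : mkH hu = mkH hv by rewrite -[LHS]QK -[RHS]QK -eU -eV UV.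
      by move=> /(congr1 (fun x : H => (x : nat -> C))).
    move=> U hU; have hu : ell2 (Q' (J U)) by exact: H_ell2.
    exists (Q' (J U)) => //; apply/(sumP _ hu); split=> //.
    rewrite -[LHS]Q'K; congr Q; exact: HE.
  - exists (K2 * cJ) => u U hu /(sumP u hu)[hU e].
    have -> : norm_ell2 u = nm (Q' (J U)) by rewrite e QK.
    apply: (le_trans (hK2 _)); rewrite -mulrA ler_wpM2l ?(ltW K20) //.
    exact: (J_norm hU).1.
move=> k; have [hk ek] := hPsi k; split.
  move=> /J_eq h; have : Q (delta k) = 0 by rewrite -ek h ?J0 //; exact: inL2_0.
  move=> q0; have := delta_neq0 R k; rewrite -[delta k]QK q0 (blin0 bQ') eqxx //.
exists (nu k)^-1; first by apply/op_eigenvalueP; exists k.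
have [_ _ /(_ k (leq0n k))[n0 [m hm]] _ _] := St.
(* The exponent in [gen_eigenspace] must be positive, which [m.+1] visibly is. *)
exists m.+1 => //; apply/(ker_powP _ _ (invr_neq0 n0)); split=> //.
rewrite invrK ek; have hI := iter_blin m (blin_sh (nu k) bS).
have e : iter m (sh S (nu k)) (Q (delta k)) = 0.
  by rewrite -[LHS]Q'K -(conj_iter S (nu k) m (delta k) aQ) hm (blin0 bQ).
exact: (iter_kill (blin_sh (nu k) bS) (leqnSn m) e).
Qed.

End Final.

Theorem theorem1p4 (R : realType) (l a b : R)
    (l_gt0 : 0 < l) (a_gt0 : 0 < a) (b_neq0 : b != 0) :
  exists lambda : nat -> R[i],
    [/\ [/\ injective lambda,
            spectrum l (Tab l a b) = range lambda &
            forall k, op_eigenvalue l (Tab l a b) (lambda k)],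
        exists2 m : nat, (1 <= m)%N &
          forall z, op_eigenvalue l (Tab l a b) z ->
            (algebraic_multiplicity l (Tab l a b) z <= (m%:R)%:E)%E,
        exists2 gamma1 : R, 0 < gamma1 &
          forall k, complex.Im (lambda k) <= - gamma1 &
        exists2 Psi : nat -> R -> 'cV[R[i]]_2,
          riesz_basis l Psi &
          forall k, gen_eigenfunction l (Tab l a b) (Psi k)].
Proof.
have [P [Pi [m1 [m2 [ep [PPi MP Rm1 Rm2 em]]]]]] := Mab_jordan a_gt0 b_neq0.
have nz (m : R[i]) : 0 < complex.Re m -> m != 0 by apply: contraTneq => ->; rewrite ltxx.
have [K [bK K0 KS]] := Rop_exists (Lsp_gt0 l_gt0) (l ^+ 2 / 3)%:C%C.
have hK : scalar_op (Lsp_gt0 l_gt0) (l ^+ 2 / 3)%:C%C K by [].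
have h1 := Tm_scalar hK m1; have h2 := Tm_scalar hK m2.
have i1 := Im_thm l_gt0 Rm1; have i2 := Im_thm l_gt0 Rm2.
have jd : ejord l m1 m2 ep != 0 -> Tm l K m1 = Tm l K m2.
  move=> e0; rewrite em //; apply: contra e0 => /eqP ->.
  by rewrite /ejord mulr0 mul0r oppr0.
have [N [Q [Q' [nu [g [aQ St g0 tl inj]]]]]] := full_spectral h1 h2 i1 i2 jd.

have hT := Tab_J b_neq0 PPi MP (nz _ Rm1) (nz _ Rm2) hK.
have [cJ cJ0 hJ] := J_norm l_gt0 PPi.
have JD := JD l_gt0 Pi; have JZ := JZ l_gt0 Pi.
have Jeq := J_eq l_gt0 PPi; have Jsu := J_surj l_gt0 PPi.
have Jsum n (c : 'I_n -> R[i]) (U : 'I_n -> R -> 'cV[R[i]]_2) (hU : forall i, inL2 l (U i)) :=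
  conj (EH_sum l_gt0 c hU).1 (J_sum l_gt0 Pi c hU).
have bS : blin (Sop l m1 m2 ep K) by apply: blin_Rh; [case: h1|case: h2].
have Sim := @Rh_im _ _ _ _ _ (ejord l m1 m2 ep) _ _ h1 h2 i1 i2.
have eP := op_eigenvalueP hT JD JZ Jeq Jsu bS aQ St.
have rP := resolventP hT JD JZ Jeq Jsu cJ0 hJ bS aQ St.
have inj' m n : (N <= m)%N -> (N <= n)%N -> odd m = odd n -> (nu m)^-1 = (nu n)^-1 -> m = n.
  by move=> h3 h4 h5 /invr_inj; exact: inj.
have [lambda linj lr] := enumerate_range inj'.
have ln k : exists n, lambda k = (nu n)^-1.
  have : range lambda (lambda k) by exists k.
  by rewrite lr => -[n _ <-]; exists n.
exists lambda; split.
- split=> //; last by move=> k; apply/eP.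
  rewrite lr; apply/seteqP; split=> z.
    move=> hz; apply: contrapT => nz'; apply: hz; apply/rP => n.
    by apply/eqP => e; apply: nz'; exists n.
  by move=> [n _ e] /rP/(_ n); rewrite e eqxx.
- exists N.+2 => // z; exact: (multiplicity_le hT JD JZ Jeq Jsu Jsum bS aQ St inj).
- have [g1 g10 hg] := nu_im_uniform Sim aQ St g0 tl.
  by exists g1 => // k; have [n ->] := ln k.
- exact: (riesz hT JD JZ Jeq Jsu Jsum cJ0 hJ bS aQ St).
Qed.
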